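(* For every integer $n\geq 1$, the vertex algebra $\mathcal{W}_{1+\infty,-n}$ is strongly generated by $\{j^0,j^1,\dots,j^{n^2+2n-1}\}$; that is, $\mathcal{W}_{1+\infty,-n}$ is spanned by the iterated Wick products $:\partial^{k_1}j^{l_1}\cdots\partial^{k_r}j^{l_r}:$ with $r\geq 0$, $k_1,\dots,k_r\geq 0$ and $0\leq l_1,\dots,l_r\leq n^2+2n-1$.
   Context: Vertex algebra conventions: $\partial$ is the translation operator, $:ab:\,=a\circ_{-1}b$ is the $(-1)$st product, and $:a_1a_2\cdots a_r:\,=\,:a_1(:a_2\cdots a_r:):$ (the empty product is the vacuum $1$). Let $\mathcal{D}$ be the Lie algebra of regular differential operators on $\mathbb{C}\setminus\{0\}$ with coordinate $t$, with basis $J^l_k=-t^{l+k}(\partial_t)^l$, $k\in\mathbb{Z}$, $l\geq 0$, and let $\hat{\mathcal{D}}=\mathcal{D}\oplus\mathbb{C}\kappa$ be its central extension with bracket $[A,B]+\Psi(A,B)\kappa$, where $\Psi(f(t)\partial_t^p,g(t)\partial_t^q)=\frac{p!\,q!}{(p+q+1)!}\mathrm{Res}_{t=0}f^{(q+1)}(t)g^{(p)}(t)\,dt$. Let $\mathcal{P}\subset\mathcal{D}$ be the span of $J^l_k$ with $l\ge0$, $l+k\geq 0$; $\Psi$ vanishes on $\mathcal{P}$. For $c\in\mathbb{C}$ let $\mathcal{M}_c=U(\hat{\mathcal{D}})\otimes_{U(\mathcal{P}\oplus\mathbb{C}\kappa)}C_0$, where $C_0$ is one-dimensional, $\mathcal{P}$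 acts by $0$ and $\kappa$ by $c$. $\mathcal{M}_c$ is a vertex algebra generated by fields $J^l(z)=\sum_k J^l_k z^{-k-l-1}$ of weight $l+1$ ($l\geq 0$). $\mathcal{I}_c$ is the maximal proper graded $\hat{\mathcal{D}}$-submodule of $\mathcal{M}_c$ (a vertex algebra ideal), $\mathcal{W}_{1+\infty,c}=\mathcal{M}_c/\mathcal{I}_c$ with projection $\pi_c$, and $j^l=\pi_c(J^l)$. *)

(* Defs.v *)
From HB Require Import structures.
From mathcomp Require Import all_boot all_order all_algebra generic_quotient ring_quotient.
From mathcomp Require Import boolp classical_sets reals.
From mathcomp Require Import complex zify.
From mathcomp Require Import freeg.

Set Implicit Arguments.
Unset Strict Implicit.
Unset Printing Implicit Defensive.

Import Order.TTheory GRing.Theory Num.Theory.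

Local Open Scope ring_scope.
Local Open Scope classical_set_scope.
Local Open Scope quotient_scope.

Section LinearMaps.
Context (K : numFieldType) (V W : lmodType K) (f : V -> W).
Hypothesis lf : linear f.
Let F : {linear V -> W} := HB.pack f (GRing.isLinear.Build _ _ _ _ f lf).

Lemma lin0 : f 0 = 0. Proof. exact: (raddf0 F). Qed.
Lemma linD x y : f (x + y) = f x + f y. Proof. exact: (raddfD F). Qed.
Lemma linB x y : f (x - y) = f x - f y. Proof. exact: (raddfB F). Qed.
Lemma linN x : f (- x) = - f x. Proof. exact: (raddfN F). Qed.
Lemma linZ a x : f (a *: x) = a *: f x. Proof. by have := lf a x 0; rewrite lin0 !addr0. Qed.
Lemma lin_sum I (r : seq I) P g :
  f (\sum_(i <- r | P i) g i) = \sum_(i <- r | P i) f (g i).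
Proof. exact: (raddf_sum F). Qed.

End LinearMaps.

Section Span.
Context (K : numFieldType) (V : lmodType K).
Implicit Types (S N : set V).

Definition lspan S : set V :=
  [set v | exists2 s : seq (K * V),
      forall p, p \in s -> S p.2 & v = \sum_(p <- s) p.1 *: p.2].

Definition subspace N := N 0 /\ forall a x y, N x -> N y -> N (a *: x + y).

Lemma sub_lspan S : S `<=` lspan S.
Proof.
move=> x Sx; exists [:: (1, x)]; last by rewrite big_seq1 scale1r.
by move=> p; rewrite inE => /eqP ->.
Qed.

Lemma lspan_subspace S : subspace (lspan S).
Proof.
split; first by exists [::]; rewrite ?big_nil.
move=> a _ _ [s sS ->] [t tS ->].
exists ([seq (a * p.1, p.2) | p <- s] ++ t).
  by move=> p; rewrite mem_cat => /orP[/mapP[q qs ->]|/tS //]; exact: (sS _ qs).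
rewrite big_cat big_map scaler_sumr /=; congr (_ + _).
by apply: eq_bigr => p _; rewrite scalerA.
Qed.

Lemma lspan_min S N : subspace N -> S `<=` N -> lspan S `<=` N.
Proof.
move=> [N0 ND] SN _ [s sS ->]; elim: s sS => [|p s IH] sS; first by rewrite big_nil.
rewrite big_cons; apply: ND; first by apply/SN/sS; rewrite mem_head.
by apply: IH => q qs; apply: sS; rewrite inE qs orbT.
Qed.

Lemma subspaceD N x y : subspace N -> N x -> N y -> N (x + y).
Proof. by move=> [_ ND] Nx Ny; rewrite -[x]scale1r; exact: ND. Qed.

Lemma subspaceZ N a x : subspace N -> N x -> N (a *: x).
Proof. by move=> [N0 ND] Nx; rewrite -[_ *: _]addr0; exact: ND. Qed.

Lemma subspaceN N x : subspace N -> N x -> N (- x).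
Proof. by move=> sN Nx; rewrite -scaleN1r; exact: subspaceZ. Qed.

Lemma subspace_sum N I (r : seq I) (P : pred I) (f : I -> V) : subspace N ->
  (forall i, P i -> N (f i)) -> N (\sum_(i <- r | P i) f i).
Proof.
by move=> sN Nf; apply: big_ind => //; [case: sN|move=> x y; exact: subspaceD].
Qed.

Definition lspanb S : {pred V} := fun v => `[< lspan S v >].

Lemma lspanb_zmod S : zmod_closed (lspanb S).
Proof.
have sS := lspan_subspace S; split; first by apply/asboolP; case: sS.
by move=> x y /asboolP Sx /asboolP Sy; apply/asboolP/(subspaceD sS Sx)/(subspaceN sS Sy).
Qed.

HB.instance Definition _ S := GRing.isZmodClosed.Build V (lspanb S) (lspanb_zmod S).

Definition lquot S : Type := Quotient.quot (lspanb S).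
HB.instance Definition _ S := GRing.Zmodule.on (lquot S).

Definition lproj S (v : V) : lquot S := \pi_(Quotient.quot (lspanb S)) v.

Lemma lproj_eq S x y : (lproj S x = lproj S y) <-> lspan S (x - y).
Proof.
split.
  by move=> /eqP; rewrite /lproj -Quotient.idealrBE => /asboolP.
by move=> h; apply/eqP; rewrite /lproj -Quotient.idealrBE; apply/asboolP.
Qed.

Lemma lprojD S x y : lproj S (x + y) = lproj S x + lproj S y.
Proof. exact: (Quotient.pi_add (lspanb S)). Qed.

Lemma lproj_repr S (q : lquot S) : lproj S (repr q) = q.
Proof. exact: reprK. Qed.

Lemma lprojP S (q : lquot S) : exists v, q = lproj S v.
Proof. by exists (repr q); rewrite lproj_repr. Qed.

Definition lquot_scale S a (q : lquot S) : lquot S := lproj S (a *: repr q).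

Lemma lprojZ S a x : lproj S (a *: x) = lquot_scale a (lproj S x).
Proof.
apply/lproj_eq; rewrite -scalerBr; apply: subspaceZ; first exact: lspan_subspace.
by apply/lproj_eq; rewrite lproj_repr.
Qed.

Fact lquot_scaleA S a b (q : lquot S) :
  lquot_scale a (lquot_scale b q) = lquot_scale (a * b) q.
Proof. by have [v ->] := lprojP q; rewrite -!lprojZ scalerA. Qed.
Fact lquot_scale1 S : left_id 1 (@lquot_scale S).
Proof. by move=> q; have [v ->] := lprojP q; rewrite -lprojZ scale1r. Qed.
Fact lquot_scaleDr S : right_distributive (@lquot_scale S) +%R.
Proof.
move=> a q r; have [v ->] := lprojP q; have [w ->] := lprojP r.
by rewrite -lprojD -!lprojZ -lprojD scalerDr.
Qed.
Fact lquot_scaleDl S (q : lquot S) :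
  {morph (fun a => lquot_scale a q) : a b / a + b}.
Proof.
by move=> a b; have [v ->] := lprojP q; rewrite -!lprojZ -lprojD scalerDl.
Qed.

HB.instance Definition _ S := GRing.Zmodule_isLmodule.Build K (lquot S)
  (@lquot_scaleA S) (@lquot_scale1 S) (@lquot_scaleDr S) (@lquot_scaleDl S).

Lemma lproj_linear S : linear (lproj S).
Proof. by move=> a x y; rewrite lprojD lprojZ. Qed.

End Span.

Section Lift.
Context (K : numFieldType) (V W : lmodType K) (S : set V) (f : V -> W).
Implicit Types (q : lquot S).

Definition llift q : W := f (repr q).

Hypotheses (lf : linear f) (f0 : forall v, S v -> f v = 0).

Lemma lspan_ker : lspan S `<=` [set v | f v = 0].
Proof.
apply: lspan_min => //; split => /=; first exact: lin0.
by move=> a x y fx fy; rewrite lf fx fy scaler0 addr0.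
Qed.

Lemma llift_proj v : llift (lproj S v) = f v.
Proof.
apply/eqP; rewrite /llift -subr_eq0 -linB //; apply/eqP/lspan_ker.
by apply/lproj_eq; rewrite lproj_repr.
Qed.

Lemma llift_linear : linear llift.
Proof.
move=> a q r; have [v ->] := lprojP q; have [w ->] := lprojP r.
by rewrite -lproj_linear !llift_proj lf.
Qed.

End Lift.

Section Free.
Context (K : numFieldType) (X : choiceType) (M : lmodType K).

Lemma freeg_ind (N : set {freeg X / K}) :
  subspace N -> (forall x, N << x >>) -> forall v, N v.
Proof.
move=> sN Nx v; rewrite -[v]freeg_sumE; apply: subspace_sum => // x _.
have -> : << coeff x v *g x >> = coeff x v *: << x >> :> {freeg X / K}.
  by apply/eqP/freeg_eqP => y; rewrite coeffZ !coeffU mul1r.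
exact: subspaceZ.
Qed.

Lemma fglift_linear (f : X -> M) : linear (fglift f).
Proof.
have f0 : fglift f 0 = 0 by have := lift_is_additive f 0 0; rewrite !subrr.
have fN y : fglift f (- y) = - fglift f y.
  by rewrite -sub0r lift_is_additive f0 sub0r.
have fD : {morph fglift f : x y / x + y}.
  by move=> x y; rewrite -[y in LHS]opprK lift_is_additive fN opprK.
have fs (r : seq X) g : fglift f (\sum_(i <- r) g i) = \sum_(i <- r) fglift f (g i).
  by elim: r => [|i r IH]; rewrite ?big_nil // !big_cons fD IH.
move=> a x y; rewrite fD; congr (_ + _).
rewrite -[x]freeg_sumE scaler_sumr !fs scaler_sumr; apply: eq_bigr => z _.
have -> : a *: << coeff z x *g z >> = << a * coeff z x *g z >> :> {freeg X / K}.
  by apply/eqP/freeg_eqP => t; rewrite coeffZ !coeffU mulrA.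
by rewrite !liftU scalerA.
Qed.

Lemma fgliftU (f : X -> M) x : fglift f << x >> = f x.
Proof. by rewrite liftU scale1r. Qed.

End Free.

(** A field [a(z) = \sum_n a_n z^(-n-1)] is given by its modes [a n : V -> V].
    On coefficients of [z^(-m-1) w^(-n-1)], multiplication by [z - w] is
    [mulzw]. *)
Definition mulzw (V : zmodType) (X : int -> int -> V) : int -> int -> V :=
  fun m n => X (m + 1) n - X m (n + 1).

(** [(z - w)^N [a(z), b(w)] = 0] for some [N] *)
Definition mutually_local (V : zmodType) (a b : int -> V -> V) :=
  exists N, forall v m n,
    iter N (@mulzw V) (fun p q => a p (b q v) - b q (a p v)) m n = 0.

(** [va_prod n a b] is the circle product of [a] and [b] of index [n], that is
    the mode [a_n] of the field [Y(a, z)] applied to [b]. *)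
Record vertex_algebra (K : numFieldType) (V : lmodType K) := VertexAlgebra {
  va_vac : V;
  va_der : V -> V;
  va_prod : int -> V -> V -> V;
  va_der_linear : linear va_der;
  va_prod_linearl : forall n b, linear (fun a => va_prod n a b);
  va_prod_linearr : forall n a, linear (va_prod n a);
  va_truncation : forall a b, exists N : nat, forall n,
    N%:Z <= n -> va_prod n a b = 0;
  va_vacl : forall n b, va_prod n va_vac b = if n == -1 then b else 0;
  va_vacr_ge0 : forall n a, 0 <= n -> va_prod n a va_vac = 0;
  va_vacr : forall a, va_prod (-1) a va_vac = a;
  va_der_vac : va_der va_vac = 0;
  va_der_comm : forall n a b,
    va_der (va_prod n a b) - va_prod n a (va_der b)
      = - (n%:~R *: va_prod (n - 1) a b);
  va_locality : forall a b,
    mutually_local (fun n => va_prod n a) (fun n => va_prod n b)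
}.

Lemma va_derE (K : numFieldType) (V : lmodType K) (A : vertex_algebra V) a :
  va_der A a = va_prod A (-2) a (va_vac A).
Proof.
have := va_der_comm A (-1) a (va_vac A).
rewrite va_vacr va_der_vac (lin0 (va_prod_linearr A (-1) a)) subr0 => ->.
by rewrite mulrN1z scaleN1r opprK.
Qed.

(** The iterated Wick product [:d^k1 a1 (:d^k2 a2 ( ... ):):] of
    [s = [:: (k1, a1); (k2, a2); ...]] *)
Definition wick (K : numFieldType) (V : lmodType K) (A : vertex_algebra V)
    (s : seq (nat * V)) : V :=
  foldr (fun p b => va_prod A (-1) (iter p.1 (va_der A) p.2) b) (va_vac A) s.

Definition strongly_generated (K : numFieldType) (V : lmodType K)
    (A : vertex_algebra V) (S : set V) :=
  lspan [set wick A s | s in [set s : seq (nat * V) |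
                               forall p, p \in s -> S p.2]] = setT.

Section ThreeVariables.
Context (V : zmodType).
Implicit Types (X Y : int -> int -> int -> V) (Z : int -> int -> V).

Definition null3 X := forall p q r, X p q r = 0.
Definition Dzw X : int -> int -> int -> V := fun p q r => X (p + 1) q r - X p (q + 1) r.
Definition Dzy X : int -> int -> int -> V := fun p q r => X (p + 1) q r - X p q (r + 1).
Definition Dwy X : int -> int -> int -> V := fun p q r => X p (q + 1) r - X p q (r + 1).
Definition sub3 X Y : int -> int -> int -> V := fun p q r => X p q r - Y p q r.

Lemma fun3P X Y : (forall p q r, X p q r = Y p q r) -> X = Y.
Proof. by move=> h; apply/funext => p; apply/funext => q; apply/funext => r. Qed.

Lemma fun2P Z1 Z2 : (forall p q, Z1 p q = Z2 p q) -> Z1 = Z2.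
Proof. by move=> h; apply/funext => p; apply/funext => q. Qed.

Lemma Dwy_sub X : Dwy X = sub3 (Dzy X) (Dzw X).
Proof. by apply: fun3P => p q r; rewrite /Dwy /Dzy /Dzw /sub3 opprB [RHS]addrC addrA subrK. Qed.

Let subACA (a b c d : V) : a - b - (c - d) = a - c - (b - d).
Proof. by rewrite opprD addrACA -opprD. Qed.

Lemma Dzy_sub3 X Y : Dzy (sub3 X Y) = sub3 (Dzy X) (Dzy Y).
Proof. by apply: fun3P => p q r; rewrite /Dzy /sub3 subACA. Qed.
Lemma Dwy_sub3 X Y : Dwy (sub3 X Y) = sub3 (Dwy X) (Dwy Y).
Proof. by apply: fun3P => p q r; rewrite /Dwy /sub3 subACA. Qed.
Lemma Dzw_sub3 X Y : Dzw (sub3 X Y) = sub3 (Dzw X) (Dzw Y).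
Proof. by apply: fun3P => p q r; rewrite /Dzw /sub3 subACA. Qed.
Lemma mulzw_sub Z1 Z2 :
  mulzw (fun p q => Z1 p q - Z2 p q) = fun p q => mulzw Z1 p q - mulzw Z2 p q.
Proof. by apply: fun2P => p q; rewrite /mulzw subACA. Qed.

Lemma DzyDwy X : Dzy (Dwy X) = Dwy (Dzy X).
Proof. by apply: fun3P => p q r; rewrite /Dzy /Dwy subACA. Qed.
Lemma DzwDwy X : Dzw (Dwy X) = Dwy (Dzw X).
Proof. by apply: fun3P => p q r; rewrite /Dzw /Dwy subACA. Qed.
Lemma DzwDzy X : Dzw (Dzy X) = Dzy (Dzw X).
Proof. by apply: fun3P => p q r; rewrite /Dzw /Dzy subACA. Qed.

Lemma iter_comm (T : Type) (f g : T -> T) : (forall x, f (g x) = g (f x)) ->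
  forall m n x, iter m f (iter n g x) = iter n g (iter m f x).
Proof.
move=> fg m n x; elim: m => //= m ->.
by elim: n => //= n; rewrite fg => ->.
Qed.

Lemma null_Dzw X : null3 X -> null3 (Dzw X).
Proof. by move=> X0 p q r; rewrite /Dzw !X0 subrr. Qed.
Lemma null_Dzy X : null3 X -> null3 (Dzy X).
Proof. by move=> X0 p q r; rewrite /Dzy !X0 subrr. Qed.
Lemma null_Dwy X : null3 X -> null3 (Dwy X).
Proof. by move=> X0 p q r; rewrite /Dwy !X0 subrr. Qed.
Lemma null_sub3 X Y : null3 X -> null3 Y -> null3 (sub3 X Y).
Proof. by move=> X0 Y0 p q r; rewrite /sub3 X0 Y0 subrr. Qed.
Lemma null_iter D n X : (forall X, null3 X -> null3 (D X)) -> null3 X ->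
  null3 (iter n D X).
Proof. by move=> hD X0; elim: n => //= n; exact: hD. Qed.

Lemma Dwy_power N M X : null3 (iter N Dzy X) -> null3 (iter M Dzw X) ->
  null3 (iter (N + M) Dwy X).
Proof.
move=> XN XM.
suff H s : forall i j, (N + M <= s + i + j)%N ->
    null3 (iter s Dwy (iter i Dzy (iter j Dzw X))).
  by apply: (H _ 0%N 0%N); rewrite !addn0.
elim: s => [|s IH] i j /= hs.
  have [hi|hi] := leqP N i.
    rewrite -(iter_comm DzwDzy) -(subnK hi) iterD.
    apply: null_iter; first exact: null_Dzw.
    by apply: null_iter; [exact: null_Dzy|].
  apply: null_iter; first exact: null_Dzy.
  rewrite -(@subnK M j) ?iterD; last lia.
  by apply: null_iter; [exact: null_Dzw|].
rewrite -iterS iterSr Dwy_sub.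
have iter_sub Y Y' : iter s Dwy (sub3 Y Y') = sub3 (iter s Dwy Y) (iter s Dwy Y').
  by elim: s {IH hs} => //= s ->; rewrite Dwy_sub3.
rewrite iter_sub; apply: null_sub3.
  by apply: (IH i.+1 j); lia.
have -> : Dzw (iter i Dzy (iter j Dzw X)) = iter i Dzy (iter j.+1 Dzw X).
  exact: (iter_comm DzwDzy 1 i).
by apply: IH; lia.
Qed.

Lemma iter_Dzw n X p q r :
  iter n Dzw X p q r = iter n (@mulzw V) (fun p q => X p q r) p q.
Proof. by elim: n p q => //= n IH p q; rewrite /Dzw /mulzw !IH. Qed.
Lemma iter_Dwy n X p q r : iter n Dwy X p q r = iter n (@mulzw V) (X p) q r.
Proof. by elim: n q r => //= n IH q r; rewrite /Dwy /mulzw !IH. Qed.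
Lemma iter_Dzy n X p q r :
  iter n Dzy X p q r = iter n (@mulzw V) (fun p r => X p q r) p r.
Proof. by elim: n p r => //= n IH p r; rewrite /Dzy /mulzw !IH. Qed.

Lemma iter_mulzw_sub n Z1 Z2 p q :
  iter n (@mulzw V) (fun p q => Z1 p q - Z2 p q) p q
  = iter n (@mulzw V) Z1 p q - iter n (@mulzw V) Z2 p q.
Proof.
elim: n p q => //= n IH p q.
by rewrite /mulzw !IH subACA.
Qed.

Lemma iter_mulzw0 n Z p q : (forall p q, Z p q = 0) -> iter n (@mulzw V) Z p q = 0.
Proof. by move=> Z0; elim: n p q => //= n IH p q; rewrite /mulzw !IH subrr. Qed.

Lemma iter_mulzw_le m n Z : (m <= n)%N -> (forall p q, iter m (@mulzw V) Z p q = 0) ->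
  forall p q, iter n (@mulzw V) Z p q = 0.
Proof. by move=> mn Z0 p q; rewrite -(subnK mn) iterD iter_mulzw0. Qed.

Lemma iter_mulzw_swap0 n Z : (forall p q, iter n (@mulzw V) Z p q = 0) ->
  forall p q, iter n (@mulzw V) (fun p q => - Z q p) p q = 0.
Proof.
move=> Z0.
suff H m p q : iter m (@mulzw V) (fun p q => - Z q p) p q = iter m (@mulzw V) Z q p \/
               iter m (@mulzw V) (fun p q => - Z q p) p q = - iter m (@mulzw V) Z q p.
  by move=> p q; case: (H n p q) => ->; rewrite Z0 ?oppr0.
suff {p q} H : forall p q, iter m (@mulzw V) (fun p q => - Z q p) p q
               = iter m (@mulzw V) Z q p *~ ((-1) ^+ m.+1).
  rewrite H -signr_odd /=; case: (odd m); rewrite /= ?expr0 ?expr1 ?mulr1z; first by left.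
  by right; rewrite mulrN1z.
elim: m => [|m IH] p q /=; first by rewrite expr1 mulrN1z.
by rewrite /mulzw !IH -mulrzBl [in RHS]exprS mulN1r mulrNz -mulNrz opprB.
Qed.

End ThreeVariables.

Lemma iter_mulzw_lin (K : numFieldType) (V W : lmodType K) (f : V -> W) n
    (Z : int -> int -> V) p q : linear f ->
  iter n (@mulzw W) (fun p q => f (Z p q)) p q = f (iter n (@mulzw V) Z p q).
Proof. by move=> lf; elim: n p q => //= n IH p q; rewrite /mulzw !IH linB. Qed.

Lemma localC (V : zmodType) (a b : int -> V -> V) :
  mutually_local a b -> mutually_local b a.
Proof.
move=> [N ab]; exists N => v m n.
have -> : (fun p q => b p (a q v) - a q (b p v)) =
          (fun p q => - (a q (b p v) - b p (a q v))).
  by apply: fun2P => p q; rewrite opprB.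
exact: (iter_mulzw_swap0 (ab v)).
Qed.

Section EventualSum.
Context (V : zmodType).
Implicit Types (f g : nat -> V).

Definition evz f := exists N, forall j, (N <= j)%N -> f j = 0.

Definition evsum f : V :=
  if pselect (evz f) is left h then \sum_(j < projT1 (cid h)) f j else 0.

Lemma sum_evz f N M : (forall j, (N <= j)%N -> f j = 0) -> (N <= M)%N ->
  \sum_(j < M) f j = \sum_(j < N) f j.
Proof.
move=> f0 NM; rewrite -(subnKC NM) big_split_ord /= [X in _ + X]big1 ?addr0 //.
by move=> i _; apply: f0; rewrite leq_addr.
Qed.

Lemma evsumE f N : (forall j, (N <= j)%N -> f j = 0) ->
  evsum f = \sum_(j < N) f j.
Proof.
move=> fN; rewrite /evsum; case: pselect => [h|[]]; last by exists N.
case: (cid h) => M /= fM.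
by rewrite -(sum_evz fM (leq_maxl M N)) -(sum_evz fN (leq_maxr M N)).
Qed.

Lemma evsum_ev f : evz f -> exists N, forall M, (N <= M)%N -> evsum f = \sum_(j < M) f j.
Proof. by move=> [N fN]; exists N => M NM; rewrite (evsumE fN) (sum_evz fN NM). Qed.

Lemma evzD f g : evz f -> evz g -> evz (fun j => f j + g j).
Proof.
move=> [N fN] [M gM]; exists (maxn N M) => j.
by rewrite geq_max => /andP[/fN -> /gM ->]; rewrite addr0.
Qed.

End EventualSum.

Section Products.
Context (K : numFieldType) (V : lmodType K).
Implicit Types (a b c : int -> V -> V) (v : V).

Definition linf a := forall n, linear (a n).
Definition trunc a := forall v, exists N : nat, forall n, N%:Z <= n -> a n v = 0.
Definition idf : int -> V -> V := fun n v => if n == -1 then v else 0.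
Definition linc x a b : int -> V -> V := fun n v => x *: a n v + b n v.
Definition derf a : int -> V -> V := fun n v => - (n%:~R *: a (n - 1) v).
Definition comm2 a b v : int -> int -> V := fun p q => a p (b q v) - b q (a p v).
Definition cprod n a b : int -> V -> V :=
  fun m v => iter n (@mulzw V) (comm2 a b v) 0 m.
Definition nopt a b v p q (j : nat) : V :=
  a (p + (- 1 - j%:Z)) (b (q + j%:Z) v) + b (q + (- 1 - j%:Z)) (a (p + j%:Z) v).
Definition nop2 a b v : int -> int -> V := fun p q => evsum (nopt a b v p q).
Definition nop a b : int -> V -> V := fun m v => nop2 a b v 0 m.

Definition locN N a b := forall v m n, iter N (@mulzw V) (comm2 a b v) m n = 0.

Lemma locN_le M N a b : (M <= N)%N -> locN M a b -> locN N a b.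
Proof. by move=> MN ab v m n; apply: iter_mulzw_le MN _ m n => p q; exact: ab. Qed.

Definition killed N (X : int -> int -> int -> V) := null3 (iter N (@Dzy V) (iter N (@Dwy V) X)).

Lemma iter_sub3 D n (X Y : int -> int -> int -> V) :
  (forall X Y, D (sub3 X Y) = sub3 (D X) (D Y)) ->
  iter n D (sub3 X Y) = sub3 (iter n D X) (iter n D Y).
Proof. by move=> hD; elim: n => //= n ->; rewrite hD. Qed.

Lemma killed_sub N X Y : killed N X -> killed N Y -> killed N (sub3 X Y).
Proof.
move=> hX hY; rewrite /killed (iter_sub3 _ _ _ (@Dwy_sub3 V)) (iter_sub3 _ _ _ (@Dzy_sub3 V)).
exact: null_sub3.
Qed.

Lemma killed0 N : killed N (fun _ _ _ => 0).
Proof.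
by apply: null_iter; [exact: null_Dzy|apply: null_iter; [exact: null_Dwy|]].
Qed.

Lemma killed_add N X Y : killed N X -> killed N Y ->
  killed N (fun p q r => X p q r + Y p q r).
Proof.
move=> hX hY.
have -> : (fun p q r => X p q r + Y p q r) = sub3 X (sub3 (fun _ _ _ => 0) Y).
  by apply: fun3P => p q r; rewrite /sub3 sub0r opprK.
by apply: killed_sub => //; apply: killed_sub => //; exact: killed0.
Qed.

Lemma killed_sum N J (X : nat -> int -> int -> int -> V) :
  (forall j, killed N (X j)) -> killed N (fun p q r => \sum_(j < J) X j p q r).
Proof.
move=> hX; elim: J => [|J IH].
  have -> : (fun p q r => \sum_(j < 0) X j p q r) = (fun _ _ _ => 0).
    by apply: fun3P => p q r; rewrite big_ord0.
  exact: killed0.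
have -> : (fun p q r => \sum_(j < J.+1) X j p q r) =
          (fun p q r => \sum_(j < J) X j p q r + X J p q r).
  by apply: fun3P => p q r; rewrite big_ord_recr.
exact: killed_add.
Qed.

Lemma killed_Dzw N n X : killed N X -> killed N (iter n (@Dzw V) X).
Proof.
move=> hX; rewrite /killed -(iter_comm (@DzwDwy V)) -(iter_comm (@DzwDzy V)).
by apply: null_iter; [exact: null_Dzw|].
Qed.

Lemma killed_shift N X s t : killed N X ->
  killed N (fun p q r => X (p + s) (q + t) r).
Proof.
move=> hX p q r.
have -> : iter N (@Dwy V) (fun p q r => X (p + s) (q + t) r) =
          (fun p q r => iter N (@Dwy V) X (p + s) (q + t) r).
  elim: {hX} N => //= N ->; apply: fun3P => p' q' r'.
  by rewrite /Dwy -!addrA [1 + t]addrC.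
have -> : forall Y, iter N (@Dzy V) (fun p q r => Y (p + s) (q + t) r) =
          (fun p q r => iter N (@Dzy V) Y (p + s) (q + t) r).
  move=> Y; elim: {hX} N => //= N ->; apply: fun3P => p' q' r'.
  by rewrite /Dzy -!addrA [1 + s]addrC.
exact: hX.
Qed.

Lemma killed_ev N X (XJ : nat -> int -> int -> int -> V) :
  (forall p q r, exists J0, forall J, (J0 <= J)%N -> X p q r = XJ J p q r) ->
  (forall J, killed N (XJ J)) -> killed N X.
Proof.
pose ev X (XJ : nat -> int -> int -> int -> V) :=
  forall p q r, exists J0, forall J, (J0 <= J)%N -> X p q r = XJ J p q r.
have ev_Dzy Y YJ : ev Y YJ -> ev (Dzy Y) (fun J => Dzy (YJ J)).
  move=> h p q r; have [J1 h1] := h (p + 1) q r; have [J2 h2] := h p q (r + 1).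
  by exists (maxn J1 J2) => J; rewrite geq_max /Dzy => /andP[/h1 -> /h2 ->].
have ev_Dwy Y YJ : ev Y YJ -> ev (Dwy Y) (fun J => Dwy (YJ J)).
  move=> h p q r; have [J1 h1] := h p (q + 1) r; have [J2 h2] := h p q (r + 1).
  by exists (maxn J1 J2) => J; rewrite geq_max /Dwy => /andP[/h1 -> /h2 ->].
move=> h hK.
have {}h : ev (iter N (@Dzy V) (iter N (@Dwy V) X))
              (fun J => iter N (@Dzy V) (iter N (@Dwy V) (XJ J))).
  elim: {1 3}N => [|n IH] /=; last exact: ev_Dzy.
  by elim: {hK} N => [|n IH] //=; exact: ev_Dwy.
by move=> p q r; have [J0 hJ] := h p q r; rewrite (hJ J0) // hK.
Qed.

Lemma killed_ab N a b c v : linf a -> linf c -> locN N a c -> locN N b c ->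
  killed N (fun p q r => a p (b q (c r v)) - c r (a p (b q v))).
Proof.
move=> la lc ac bc.
have -> : (fun p q r => a p (b q (c r v)) - c r (a p (b q v))) =
  (fun p q r => a p (comm2 b c v q r) + comm2 a c (b q v) p r).
  by apply: fun3P => p q r; rewrite /comm2 (linB (la p)) addrA subrK.
apply: killed_add.
  apply: null_iter => [X|p q r]; first exact: null_Dzy.
  by rewrite iter_Dwy iter_mulzw_lin // bc lin0.
rewrite /killed (iter_comm (@DzyDwy V)).
apply: null_iter => [X|p q r]; first exact: null_Dwy.
by rewrite iter_Dzy ac.
Qed.

Lemma killed_ba N a b c v : linf b -> linf c -> locN N a c -> locN N b c ->
  killed N (fun p q r => b q (a p (c r v)) - c r (b q (a p v))).
Proof.
move=> lb lc ac bc.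
have -> : (fun p q r => b q (a p (c r v)) - c r (b q (a p v))) =
  (fun p q r => b q (comm2 a c v p r) + comm2 b c (a p v) q r).
  by apply: fun3P => p q r; rewrite /comm2 (linB (lb q)) addrA subrK.
apply: killed_add.
  rewrite /killed (iter_comm (@DzyDwy V)).
  apply: null_iter => [X|p q r]; first exact: null_Dwy.
  by rewrite iter_Dzy iter_mulzw_lin // ac lin0.
apply: null_iter => [X|p q r]; first exact: null_Dzy.
by rewrite iter_Dwy bc.
Qed.

Lemma dong (Q : V -> int -> int -> V) c M N : linf c ->
  (forall v p q, iter M (@mulzw V) (Q v) p q = 0) ->
  (forall v, killed N (fun p q r => Q (c r v) p q - c r (Q v p q))) ->
  mutually_local (fun m v => Q v 0 m) c.
Proof.
move=> lc QM QN; exists (N + M + N)%N => v q r.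
set X := fun p q r => Q (c r v) p q - c r (Q v p q).
rewrite -[LHS](iter_Dwy (N + M + N) X 0 q r) iterD.
apply: Dwy_power; first exact: QN.
rewrite (iter_comm (@DzwDwy V)); apply: null_iter => [Y|p' q' r'].
  exact: null_Dwy.
by rewrite iter_Dzw iter_mulzw_sub iter_mulzw_lin // !QM lin0 // subrr.
Qed.

Lemma mutually_localE a b : mutually_local a b <-> exists N, locN N a b.
Proof. by []. Qed.

Lemma locN3 a b c : mutually_local a b -> mutually_local a c -> mutually_local b c ->
  exists N, [/\ locN N a b, locN N a c & locN N b c].
Proof.
move=> [N1 h1] [N2 h2] [N3 h3]; exists (maxn N1 (maxn N2 N3)).
split; [apply: locN_le h1|apply: locN_le h2|apply: locN_le h3];
  by rewrite !leq_max leqnn ?orbT.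
Qed.

Lemma cprod_local n a b c : linf a -> linf b -> linf c -> mutually_local a b ->
  mutually_local a c -> mutually_local b c -> mutually_local (cprod n a b) c.
Proof.
move=> la lb lc ab ac bc; have [N [{}ab {}ac {}bc]] := locN3 ab ac bc.
apply: (@dong (fun v => iter n (@mulzw V) (comm2 a b v)) c N N) => //.
  move=> v p q; rewrite -iterD addnC iterD.
  by apply: iter_mulzw0 => p' q'; exact: ab.
move=> v.
have -> : (fun p q r => iter n (@mulzw V) (comm2 a b (c r v)) p q
             - c r (iter n (@mulzw V) (comm2 a b v) p q)) =
   iter n (@Dzw V) (sub3 (fun p q r => a p (b q (c r v)) - c r (a p (b q v)))
                        (fun p q r => b q (a p (c r v)) - c r (b q (a p v)))).
  apply: fun3P => p q r; rewrite iter_Dzw -iter_mulzw_lin // -iter_mulzw_sub.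
  congr (iter _ _ _ _ _); apply: fun2P => p' q'; rewrite /comm2 /sub3 linB //.
  by rewrite opprB [in RHS]opprD opprK !addrA addrAC; congr (_ + _); rewrite addrAC.
apply: killed_Dzw; apply: killed_sub; first exact: (killed_ab v la lc ac bc).
exact: (killed_ba v lb lc ac bc).
Qed.

Lemma truncE a v k : trunc a -> exists J : nat, forall j, (J <= j)%N -> a (k + j%:Z) v = 0.
Proof.
move=> ta; have [N hN] := ta v; exists (N + `|k|)%N => j hj; apply: hN; lia.
Qed.

Lemma nopt_evz a b v p q : linf a -> linf b -> trunc a -> trunc b -> evz (nopt a b v p q).
Proof.
move=> la lb ta tb; have [J1 h1] := truncE v p ta; have [J2 h2] := truncE v q tb.
exists (maxn J1 J2) => j; rewrite geq_max => /andP[/h1 e1 /h2 e2].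
by rewrite /nopt e1 e2 (lin0 (la _)) (lin0 (lb _)) addr0.
Qed.

Lemma nop_mulzw a b v p q : linf a -> linf b -> trunc a -> trunc b ->
  mulzw (nop2 a b v) p q = comm2 a b v p q.
Proof.
move=> la lb ta tb; rewrite /mulzw /nop2.
have [J1 h1] := evsum_ev (nopt_evz v (p + 1) q la lb ta tb).
have [J2 h2] := evsum_ev (nopt_evz v p (q + 1) la lb ta tb).
have [J3 h3] := truncE v p ta; have [J4 h4] := truncE v q tb.
pose J := maxn (maxn J1 J2) (maxn J3 J4).
rewrite (h1 J) ?(h2 J); try by rewrite /J !leq_max !leqnn ?orbT.
pose H (j : nat) := b (q - j%:Z) (a (p + j%:Z) v) - a (p - j%:Z) (b (q + j%:Z) v).
rewrite -sumrB (eq_bigr (fun j : 'I_J => H j.+1 - H j)); last first.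
  move=> j _; rewrite /H /nopt.
  have -> : p + 1 + (- 1 - j%:Z) = p - j%:Z by lia.
  have -> : p + 1 + j%:Z = p + j.+1%:Z by lia.
  have -> : q + 1 + (- 1 - j%:Z) = q - j%:Z by lia.
  have -> : q + 1 + j%:Z = q + j.+1%:Z by lia.
  have -> : q + (- 1 - j%:Z) = q - j.+1%:Z by lia.
  have -> : p + (- 1 - j%:Z) = p - j.+1%:Z by lia.
  by rewrite [in RHS]opprB [RHS]addrACA -opprD; congr (_ - _); rewrite addrC.
rewrite -(big_mkord xpredT (fun j => H j.+1 - H j)) telescope_sumr //.
have -> : H J = 0.
  have e3 : a (p + J%:Z) v = 0 by apply: h3; rewrite /J !leq_max !leqnn ?orbT.
  have e4 : b (q + J%:Z) v = 0 by apply: h4; rewrite /J !leq_max !leqnn ?orbT.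
  by rewrite /H e3 e4 (lin0 (la _)) (lin0 (lb _)) subrr.
have e0 k : (k - 0%N%:Z = k) * (k + 0%N%:Z = k) by split; lia.
by rewrite sub0r /H opprB !e0.
Qed.

Lemma nop_local a b c : linf a -> linf b -> linf c -> trunc a -> trunc b ->
  mutually_local a b -> mutually_local a c -> mutually_local b c ->
  mutually_local (nop a b) c.
Proof.
move=> la lb lc ta tb ab ac bc; have [N [{}ab {}ac {}bc]] := locN3 ab ac bc.
apply: (@dong (nop2 a b) c N.+1 N) => //.
  move=> v p q; rewrite iterSr.
  have -> : mulzw (nop2 a b v) = comm2 a b v by apply: fun2P => p' q'; exact: nop_mulzw.
  exact: ab.
move=> v; apply: (@killed_ev _ _ (fun J p q r =>
   \sum_(j < J) (nopt a b (c r v) p q j - c r (nopt a b v p q j)))).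
  move=> p q r.
  have [J1 h1] := evsum_ev (nopt_evz (c r v) p q la lb ta tb).
  have [J2 h2] := evsum_ev (nopt_evz v p q la lb ta tb).
  exists (maxn J1 J2) => J; rewrite geq_max /nop2 => /andP[/h1 -> /h2 ->].
  by rewrite lin_sum // sumrB.
move=> J; apply: (@killed_sum N J (fun j p q r => nopt a b (c r v) p q j - c r (nopt a b v p q j))) => j.
set s : int := -1 - j%:Z; set t := j%:Z.
have -> : (fun p q r => nopt a b (c r v) p q j - c r (nopt a b v p q j)) =
  (fun p q r => (a (p + s) (b (q + t) (c r v)) - c r (a (p + s) (b (q + t) v)))
              + (b (q + s) (a (p + t) (c r v)) - c r (b (q + s) (a (p + t) v)))).
  by apply: fun3P => p q r; rewrite /nopt linD // opprD addrACA.
apply: killed_add.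
  by apply: (@killed_shift N (fun p q r => a p (b q (c r v)) - c r (a p (b q v)))); exact: (killed_ab v la lc ac bc).
by apply: (@killed_shift N (fun p q r => b q (a p (c r v)) - c r (b q (a p v)))); exact: (killed_ba v lb lc ac bc).
Qed.

Lemma der_local a c : linf c -> mutually_local a c -> mutually_local (derf a) c.
Proof.
move=> lc [N ac]; exists N.+1 => v.
have sc (x : K) u w r : - (x *: u) - c r (- (x *: w)) = - (x *: (u - c r w)).
  by rewrite (linN (lc r)) (linZ (lc r)) scalerBr opprB opprK addrC.
have -> : (fun p q => derf a p (c q v) - c q (derf a p v)) =
   (fun p q => - (p%:~R *: comm2 a c v (p - 1) q)).
  by apply: fun2P => p q; rewrite /derf sc.
have {ac} : forall p q, iter N (@mulzw V) (comm2 a c v) p q = 0 by exact: ac.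
move: (comm2 a c v) => X X0.
elim: N X X0 => [|N IH] X X0 p q.
  by rewrite /= in X0; rewrite /= /mulzw !X0 !scaler0 oppr0 subr0.
rewrite iterSr.
have -> : mulzw (fun p q => - (p%:~R *: X (p - 1) q)) =
  (fun p q => - X p q - p%:~R *: mulzw X (p - 1) q).
  apply: fun2P => p' q'; rewrite /mulzw addrK subrK.
  rewrite intrD scalerDl scale1r scalerBr opprK opprD [in RHS]opprB.
  by rewrite [LHS]addrC addrA [RHS]addrC.
rewrite (iter_mulzw_sub _ (fun p q => - X p q)).
have lN : linear (fun x : V => - x) by move=> x y z; rewrite opprD scalerN.
rewrite (iter_mulzw_lin _ _ _ _ lN) X0 oppr0 sub0r.
rewrite -(iter_mulzw_lin _ _ _ _ lN); apply: IH => p' q'.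
by rewrite -iterSr X0.
Qed.

End Products.

Section Good.
Context (K : numFieldType) (V : lmodType K) (T : V -> V) (vac : V).
Hypothesis lT : linear T.
Implicit Types (a b c : int -> V -> V) (v : V).

Record good a : Prop := Good {
  g_lin : linf a;
  g_trunc : trunc a;
  g_der : forall n v, T (a n v) = a n (T v) - n%:~R *: a (n - 1) v;
  g_crea : forall n, 0 <= n -> a n vac = 0
}.

Lemma good_idf : good (@idf K V).
Proof.
split.
- by move=> n a x y; rewrite /idf; case: eqP => // _; rewrite scaler0 addr0.
- by move=> v; exists 0%N => n hn; rewrite /idf; case: eqP => // hn'; lia.
- move=> n v; rewrite /idf; have [->|n1] := eqVneq n (-1).
    by rewrite /= scaler0 subr0.
  rewrite (lin0 lT) sub0r; case: eqP => hn; last by rewrite scaler0 oppr0.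
  by have -> : n = 0 by [lia]; rewrite scale0r oppr0.
- by move=> n hn; rewrite /idf; case: eqP => // hn'; lia.
Qed.

Lemma good_linc x a b : good a -> good b -> good (linc x a b).
Proof.
move=> [la ta da ca] [lb tb db cb]; split.
- move=> n y u w; rewrite /linc la lb !scalerDr !scalerA [x * y]mulrC.
  by rewrite addrACA.
- move=> v; have [N hN] := ta v; have [M hM] := tb v.
  by exists (maxn N M) => n hn; rewrite /linc hN ?hM ?scaler0 ?addr0 //; lia.
- move=> n v; rewrite /linc (linD lT) (linZ lT) da db scalerBr scalerDr opprD.
  by rewrite addrACA !scalerA [x * _]mulrC.
- by move=> n hn; rewrite /linc ca ?cb // scaler0 addr0.
Qed.

Lemma good_derf a : good a -> good (derf a).
Proof.
move=> [la ta da ca]; split.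
- move=> n y u w; rewrite /derf la scalerDr opprD scalerN !scalerA.
  by rewrite [y * _]mulrC.
- move=> v; have [N hN] := ta v.
  by exists N.+1 => n hn; rewrite /derf hN ?scaler0 ?oppr0 //; lia.
- move=> n v; rewrite /derf (linN lT) (linZ lT) da scalerBr scalerN opprB opprK.
  by rewrite addrC.
- move=> n hn; rewrite /derf; have [->|n0] := eqVneq n 0.
    by rewrite scale0r oppr0.
  by rewrite ca ?scaler0 ?oppr0 //; lia.
Qed.

Definition Tcov (Q : V -> int -> int -> V) := forall v p q,
  T (Q v p q) = Q (T v) p q - p%:~R *: Q v (p - 1) q - q%:~R *: Q v p (q - 1).

Lemma Tcov_comm2 a b : good a -> good b -> Tcov (comm2 a b).
Proof.
move=> [la ta da ca] [lb tb db cb] v p q; rewrite /comm2 (linB lT) !(da, db).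
rewrite (linB (la p)) (linB (lb q)) (linZ (la p)) (linZ (lb q)) !scalerBr.
rewrite !(opprB, opprD) !addrA [LHS](ACl (1*6*5*3*4*2)).
by [].
Qed.

Lemma Tcov_mulzw Q : Tcov Q -> Tcov (fun v => mulzw (Q v)).
Proof.
move=> hQ v p q; rewrite /mulzw /= (linB lT) !hQ !addrK ?subrK.
rewrite !intrD !scalerDl !scale1r !scalerBr !(opprB, opprD) !addrA.
by rewrite [LHS](ACl (1*8*7*2*5*4*(3*6))) /= addNr addr0.
Qed.

Lemma Tcov_iter n Q : Tcov Q -> Tcov (fun v => iter n (@mulzw V) (Q v)).
Proof. by move=> hQ; elim: n => //= n; exact: Tcov_mulzw. Qed.

Lemma Tcov_nop2 a b : good a -> good b -> Tcov (nop2 a b).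
Proof.
move=> [la ta da ca] [lb tb db cb] v p q; rewrite /nop2.
have ez := nopt_evz _ _ _ la lb ta tb.
have [J1 h1] := evsum_ev (ez v p q); have [J2 h2] := evsum_ev (ez (T v) p q).
have [J3 h3] := evsum_ev (ez v (p - 1) q); have [J4 h4] := evsum_ev (ez v p (q - 1)).
have [J5 h5] := truncE v (p - 1) ta; have [J6 h6] := truncE v (q - 1) tb.
pose J := maxn (maxn (maxn J1 J2) (maxn J3 J4)) (maxn J5 J6).
have [le1 le2 le3] : [/\ J1 <= J, J2 <= J & J3 <= J]%N by split; rewrite /J; lia.
have [le4 le5 le6] : [/\ J4 <= J, J5 <= J & J6 <= J]%N by split; rewrite /J; lia.
rewrite (h1 _ le1) (h2 _ le2) (h3 _ le3) (h4 _ le4) (lin_sum lT).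
pose G (j : nat) := (j%:Z)%:~R *: (a (p + (- 1 - j%:Z)) (b (q - 1 + j%:Z) v)
                            + b (q + (- 1 - j%:Z)) (a (p - 1 + j%:Z) v)).
rewrite (eq_bigr (fun j : 'I_J => (nopt a b (T v) p q j
    - p%:~R *: nopt a b v (p - 1) q j - q%:~R *: nopt a b v p (q - 1) j)
    + (G j.+1 - G j))); last first.
  move=> j _; rewrite /nopt /G (linD lT) !(da, db).
  rewrite !(linB (la _), linB (lb _), linZ (la _), linZ (lb _)).
  have -> : p - 1 + (- 1 - j%:Z) = p + (- 1 - j%:Z) - 1 by lia.
  have -> : q - 1 + (- 1 - j%:Z) = q + (- 1 - j%:Z) - 1 by lia.
  have -> : p - 1 + j%:Z = p + j%:Z - 1 by lia.
  have -> : q - 1 + j%:Z = q + j%:Z - 1 by lia.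
  have -> : p + (- 1 - j.+1%:Z) = p + (- 1 - j%:Z) - 1 by lia.
  have -> : q + (- 1 - j.+1%:Z) = q + (- 1 - j%:Z) - 1 by lia.
  have -> : p - 1 + j.+1%:Z = p + j%:Z by lia.
  have -> : q - 1 + j.+1%:Z = q + j%:Z by lia.
  have -> : j.+1%:Z = - (- 1 - j%:Z) by lia.
  move: (- 1 - j%:Z) => s; move: (j%:Z) => t.
  rewrite !(intrD _ _ s) !(intrD _ _ t) !scalerDl !scalerDr mulrNz !scaleNr.
  rewrite !(opprB, opprD) !addrA [LHS](ACl (1*6*4*7*2*9*5*10*3*8)).
  by [].
rewrite big_split /=.
rewrite -(big_mkord xpredT (fun j => G j.+1 - G j)) telescope_sumr //.
have -> : G J = 0.
  by rewrite /G (h5 _ le5) (h6 _ le6) (lin0 (la _)) (lin0 (lb _)) addr0 scaler0.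
by rewrite /G scale0r subrr addr0 !sumrB -!scaler_sumr.
Qed.

Lemma good_cprod n a b : good a -> good b -> good (cprod n a b).
Proof.
move=> ga gb; have [la ta da ca] := ga; have [lb tb db cb] := gb; split.
- move=> m x u w; rewrite /cprod.
  have -> : comm2 a b (x *: u + w) =
      (fun p q => x *: comm2 a b u p q - (- comm2 a b w p q)).
    apply: fun2P => p q; rewrite /comm2 opprK lb la la lb scalerBr opprD.
    by rewrite addrACA.
  rewrite (iter_mulzw_sub _ (fun p q => x *: comm2 a b u p q)).
  have lZ : linear (fun z : V => x *: z).
    by move=> y z t; rewrite scalerDr !scalerA mulrC.
  have lN : linear (fun z : V => - z) by move=> y z t; rewrite opprD scalerN.
  by rewrite (iter_mulzw_lin _ _ _ _ lZ) (iter_mulzw_lin _ _ _ _ lN) opprK.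
- move=> v; rewrite /cprod.
  suff H p : exists N : nat, forall q, N%:Z <= q ->
    iter n (@mulzw V) (comm2 a b v) p q = 0 by exact: H.
  elim: n p => [|n IH] p /=.
    have [N hN] := tb v; have [M hM] := tb (a p v).
    by exists (maxn N M) => q hq; rewrite /comm2 hN ?hM ?(lin0 (la _)) ?subrr //; lia.
  have [N hN] := IH (p + 1); have [M hM] := IH p.
  by exists (maxn N M) => q hq; rewrite /mulzw hN ?hM ?subrr //; lia.
- move=> m v; rewrite /cprod (Tcov_iter n (Tcov_comm2 ga gb)).
  by rewrite scale0r subr0.
- move=> m hm; rewrite /cprod.
  suff H p q : 0 <= p -> 0 <= q ->
    iter n (@mulzw V) (comm2 a b vac) p q = 0 by exact: H.
  elim: n p q => [|n IH] p q p0 q0 /=.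
    by rewrite /comm2 ca ?cb // (lin0 (la _)) (lin0 (lb _)) subrr.
  by rewrite /mulzw !IH ?subrr //; lia.
Qed.

Lemma cprod_vac n a b : good a -> good b ->
  cprod n a b (-1) vac = a n%:Z (b (-1) vac).
Proof.
move=> [la ta da ca] [lb tb db cb]; rewrite /cprod.
suff H p : 0 <= p -> iter n (@mulzw V) (comm2 a b vac) p (-1) = a (p + n%:Z) (b (-1) vac)
   /\ forall q, 0 <= q -> iter n (@mulzw V) (comm2 a b vac) p q = 0.
  by have [] := H 0 _; rewrite // add0r => ->.
elim: n p => [|n IH] p p0 /=.
  split=> [|q q0]; rewrite /comm2 ca // (lin0 (lb _)) subr0 ?addr0 //.
  by rewrite cb // (lin0 (la _)).
have p1 : 0 <= p + 1 by lia.
have [h1 h2] := IH _ p1; have [h3 h4] := IH _ p0.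
split=> [|q q0]; rewrite /mulzw.
  by rewrite h1 h4 // subr0; congr (a _ _); lia.
by rewrite h2 // h4 ?subrr //; lia.
Qed.

Lemma good_nop a b : good a -> good b -> good (nop a b).
Proof.
move=> ga gb; have [la ta da ca] := ga; have [lb tb db cb] := gb.
have ez := nopt_evz _ _ _ la lb ta tb; split.
- move=> m x u w; rewrite /nop /nop2.
  have [J1 h1] := evsum_ev (ez (x *: u + w) 0 m).
  have [J2 h2] := evsum_ev (ez u 0 m); have [J3 h3] := evsum_ev (ez w 0 m).
  pose J := maxn J1 (maxn J2 J3).
  rewrite (h1 J) ?(h2 J) ?(h3 J); try by rewrite /J; lia.
  rewrite scaler_sumr -big_split /=; apply: eq_bigr => j _.
  by rewrite /nopt lb la la lb scalerDr addrACA.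
- move=> v; rewrite /nop /nop2.
  have [J hJ] := truncE v 0 ta; have [N hN] := tb v.
  have [M hM] : exists M : nat, forall j, (j < J)%N -> forall n : int, M%:Z <= n ->
      b n (a (0 + j%:Z) v) = 0.
    elim: J {hJ} => [|J [M hM]]; first by exists 0%N.
    have [M' hM'] := tb (a (0 + J%:Z) v); exists (maxn M M') => j.
    rewrite ltnS leq_eqVlt => /orP[/eqP ->|jJ] n hn; first by apply: hM'; lia.
    by apply: hM => //; lia.
  exists (N + M + J).+1 => n hn.
  rewrite (@evsumE _ _ 0) ?big_ord0 // => j _.
  rewrite /nopt hN; last by lia.
  rewrite (lin0 (la _)) add0r; have [jJ|jJ] := ltnP j J.
    by rewrite hM //; lia.
  by rewrite hJ // (lin0 (lb _)).
- by move=> m v; rewrite /nop (Tcov_nop2 ga gb) scale0r subr0.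
- move=> m hm; rewrite /nop /nop2 (@evsumE _ _ 0) ?big_ord0 // => j _.
  by rewrite /nopt cb ?ca ?(lin0 (la _)) ?(lin0 (lb _)) ?addr0 //; lia.
Qed.

Lemma nop_vac a b : good a -> good b -> nop a b (-1) vac = a (-1) (b (-1) vac).
Proof.
move=> [la ta da ca] [lb tb db cb]; rewrite /nop /nop2 (@evsumE _ _ 1).
  rewrite big_ord_recl big_ord0 addr0 /nopt /= [a (0 + 0%N%:Z) _]ca //.
  by rewrite (lin0 (lb _)) addr0.
move=> [//|j] _; rewrite /nopt [a (0 + _) vac]ca; last by lia.
by rewrite (lin0 (lb _)) addr0 cb ?(lin0 (la _)) //; lia.
Qed.

Lemma good_iter_derf k a : good a -> good (iter k (@derf K V) a).
Proof. by move=> ga; elim: k => //= k; exact: good_derf. Qed.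

Lemma iter_derfE k a n : n < 0 -> exists2 u : K, u != 0 &
  forall v, iter k (@derf K V) a n v = u *: a (n - k%:Z) v.
Proof.
elim: k n => [|k IH] n n0 /=.
  by exists 1; rewrite ?oner_eq0 // => v; rewrite subr0 scale1r.
have n1 : n - 1 < 0 by lia.
have [u u0 hu] := IH _ n1; exists (- (n%:~R * u)).
  by rewrite oppr_eq0 mulf_neq0 // intr_eq0; lia.
move=> v; rewrite /derf hu scalerA scaleNr; congr (- (_ *: a _ _)); lia.
Qed.

Lemma goddard a b : T vac = 0 -> good a -> good b -> mutually_local a b ->
  a (-1) vac = 0 -> forall p, a p (b (-1) vac) = 0.
Proof.
move=> T0 [la ta da ca] [lb tb db cb] [N ab] a0 p.
have an n : a n vac = 0.
  have [n0|n0] := leP 0 n; first exact: ca.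
  have [k ->] : exists k : nat, n = - k.+1%:Z by exists (`|n|.-1)%N; lia.
  elim: k {n0} => [//|k IH]; apply/eqP.
  have /eqP := da (- k.+1%:Z) vac.
  rewrite IH T0 (lin0 lT) (lin0 (la _)) sub0r eq_sym oppr_eq0 scaler_eq0.
  rewrite intr_eq0 => /orP[/eqP|]; first by lia.
  by have -> : - k.+1%:Z - 1 = - k.+2%:Z by lia.
pose Z p q := a p (b q vac).
have Z0 p' q : iter N (@mulzw V) Z p' q = 0.
  have -> : Z = (fun p q => a p (b q vac) - b q (a p vac)).
    by apply: fun2P => p1 q1; rewrite an (lin0 (lb _)) subr0.
  exact: ab.
suff [H _] : iter N (@mulzw V) Z (p - N%:Z) (-1) = Z (p - N%:Z + N%:Z) (-1) /\
    forall q, 0 <= q -> iter N (@mulzw V) Z (p - N%:Z) q = 0.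
  by move: H; rewrite Z0 subrK.
elim: {Z0 ab} N (p - N%:Z) => [|n IH] r /=.
  split=> [|q q0]; rewrite /Z ?addr0 // cb // (lin0 (la _)).
by [].
have [h1 h2] := IH (r + 1); have [h3 h4] := IH r.
split=> [|q q0]; rewrite /mulzw.
  by rewrite h1 h4 // subr0; congr (Z _ _); lia.
by rewrite h2 // h4 ?subrr //; lia.
Qed.

End Good.

Section Reconstruction.
Context (K : numFieldType) (V : lmodType K) (T : V -> V) (vac : V).
Context (I : Type) (A : I -> int -> V -> V).

Record generating_fields : Prop := GeneratingFields {
  gf_T : linear T;
  gf_T0 : T vac = 0;
  gf_good : forall i, good T vac (A i);
  gf_local : forall i j, mutually_local (A i) (A j);
  gf_gen : forall S : set V, subspace S -> S vac ->
    (forall i n v, S v -> S (A i n v)) -> forall v, S v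
}.

Inductive vfield : (int -> V -> V) -> Prop :=
| vf_id : vfield (@idf K V)
| vf_lin (x : K) a b : vfield a -> vfield b -> vfield (linc x a b)
| vf_cprod n i a : vfield a -> vfield (cprod n (A i) a)
| vf_nop k i a : vfield a -> vfield (nop (iter k (@derf K V) (A i)) a).

Hypothesis gf : generating_fields.

Lemma vfield_good a : vfield a -> good T vac a.
Proof.
have lT := gf_T gf.
elim=> {a} [|x a b _ ga _ gb|n i a _ ga|k i a _ ga].
- exact: good_idf.
- exact: good_linc.
- by apply: good_cprod => //; exact: gf_good.
- by apply: good_nop => //; apply: good_iter_derf => //; exact: gf_good.
Qed.

Lemma idf_local (b : int -> V -> V) : linf b -> mutually_local (@idf K V) b.
Proof.
move=> lb; exists 0%N => v m n /=; rewrite /idf; case: eqP => _; first by rewrite subrr.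
by rewrite (lin0 (lb _)) subrr.
Qed.

Lemma linc_local (x : K) (a b c : int -> V -> V) : linf c -> mutually_local a c -> mutually_local b c ->
  mutually_local (linc x a b) c.
Proof.
move=> lc [N ac] [M bc]; exists (maxn N M) => v m n.
have -> : (fun p q => linc x a b p (c q v) - c q (linc x a b p v)) =
    (fun p q => x *: comm2 a c v p q - (- comm2 b c v p q)).
  apply: fun2P => p q; rewrite /linc /comm2 lc opprK scalerBr opprD.
  by rewrite addrACA.
rewrite (iter_mulzw_sub _ (fun p q => x *: comm2 a c v p q)).
have lZ : linear (fun z : V => x *: z).
  by move=> y z t; rewrite scalerDr !scalerA mulrC.
have lN : linear (fun z : V => - z) by move=> y z t; rewrite opprD scalerN.
rewrite (iter_mulzw_lin _ _ _ _ lZ) (iter_mulzw_lin _ _ _ _ lN).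
rewrite (locN_le (leq_maxl N M) ac) (locN_le (leq_maxr N M) bc).
by rewrite scaler0 oppr0 subr0.
Qed.

Lemma iter_derf_local k (a c : int -> V -> V) : linf c -> mutually_local a c ->
  mutually_local (iter k (@derf K V) a) c.
Proof. by move=> lc ac; elim: k => //= k; exact: der_local. Qed.

Lemma vfield_local_gen a : vfield a -> forall j, mutually_local a (A j).
Proof.
have lT := gf_T gf.
elim=> {a} [|x a b _ ha _ hb|n i a va ha|k i a va ha] j.
- exact/idf_local/(g_lin (gf_good gf j)).
- by apply: linc_local => //; exact: (g_lin (gf_good gf j)).
- apply: cprod_local => //; try exact: (g_lin (gf_good gf _)).
  + exact: (g_lin (vfield_good va)).
  + exact/localC/ha.
  + exact: (gf_local gf).
- have gi := good_iter_derf lT k (gf_good gf i).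
  have [la ta _ _] := vfield_good va.
  apply: nop_local => //; try exact: (g_lin (gf_good gf _)).
  + exact: (g_lin gi).
  + exact: (g_trunc gi).
  + by apply: iter_derf_local => //; exact/localC/ha.
  + by apply: iter_derf_local; [exact: (g_lin (gf_good gf _))|exact: (gf_local gf)].
Qed.

Lemma vfield_local a b : vfield a -> vfield b -> mutually_local a b.
Proof.
have lT := gf_T gf.
move=> va vb; have [lb tb _ _] := vfield_good vb.
elim: va => {a} [|x a c _ ha _ hc|n i a va ha|k i a va ha].
- exact: idf_local.
- exact: linc_local.
- apply: cprod_local => //; try exact: (g_lin (gf_good gf _)).
  + exact: (g_lin (vfield_good va)).
  + exact/localC/vfield_local_gen.
  + exact/localC/vfield_local_gen.
- have gi := good_iter_derf lT k (gf_good gf i).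
  have [la ta _ _] := vfield_good va.
  apply: nop_local => //.
  + exact: (g_lin gi).
  + exact: (g_trunc gi).
  + by apply: iter_derf_local => //; exact/localC/vfield_local_gen.
  + by apply: iter_derf_local => //; exact/localC/vfield_local_gen.
Qed.

Lemma vfield_ex v : exists a, vfield a /\ a (-1) vac = v.
Proof.
have lT := gf_T gf.
move: v; apply: (gf_gen gf).
- split; first by exists (linc (-1) (@idf K V) (@idf K V)); split;
    [apply: vf_lin; exact: vf_id|rewrite /linc scaleN1r addNr].
  move=> x _ _ [a [va <-]] [b [vb <-]].
  by exists (linc x a b); split => //; exact: vf_lin.
- by exists (@idf K V); split; [exact: vf_id|rewrite /idf eqxx].
- move=> i n _ [a [va <-]]; have ga := vfield_good va; have gi := gf_good gf i.
  have [n0|n0] := leP 0 n.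
    exists (cprod `|n|%N (A i) a); split; first exact: vf_cprod.
    by rewrite (@cprod_vac _ _ T) //; congr (A i _ _); lia.
  have [k ->] : exists k : nat, n = -1 - k%:Z by exists (`|n|.-1)%N; lia.
  have n1 : (-1 : int) < 0 by [].
  have [u u0 hu] := iter_derfE k (A i) n1.
  exists (linc (u^-1 - 1) (nop (iter k (@derf K V) (A i)) a) (nop (iter k (@derf K V) (A i)) a)).
  split; first by apply: vf_lin; exact: vf_nop.
  rewrite /linc -[X in _ + X]scale1r -scalerDl subrK.
  rewrite (@nop_vac _ _ T) //; last exact: good_iter_derf.
  by rewrite hu scalerA mulVf // scale1r.
Qed.

Lemma vfield_uniq a b : good T vac a ->
  (forall c, vfield c -> mutually_local a c) -> vfield b ->
  a (-1) vac = b (-1) vac -> a = b.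
Proof.
move=> ga aloc vb ab; have lT := gf_T gf; have gb := vfield_good vb.
have gd : good T vac (linc (-1) a b) by exact: good_linc.
apply/funext => n; apply/funext => v; have [c [vc <-]] := vfield_ex v.
apply/esym/eqP; rewrite -subr_eq0 addrC -scaleN1r; apply/eqP.
rewrite -[LHS]/(linc (-1) a b n (c (-1) vac)).
apply: (goddard lT (gf_T0 gf) gd (vfield_good vc)).
  apply: linc_local (aloc _ vc) (vfield_local vb vc).
  exact: (g_lin (vfield_good vc)).
by rewrite /linc ab scaleN1r addNr.
Qed.

Definition state_field v : int -> V -> V := projT1 (cid (vfield_ex v)).

Lemma state_fieldP v : vfield (state_field v).
Proof. by rewrite /state_field; case: cid => a []. Qed.
Lemma state_field_vac v : state_field v (-1) vac = v.
Proof. by rewrite /state_field; case: cid => a []. Qed.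
Lemma state_fieldE a : vfield a -> state_field (a (-1) vac) = a.
Proof.
move=> va; apply/esym/vfield_uniq; last by rewrite state_field_vac.
- exact: vfield_good.
- by move=> c; exact: vfield_local.
- exact: state_fieldP.
Qed.
Lemma state_field_gen i : state_field (A i (-1) vac) = A i.
Proof.
apply/esym/vfield_uniq; last by rewrite state_field_vac.
- exact: (gf_good gf).
- by move=> c vc; apply/localC/vfield_local_gen.
- exact: state_fieldP.
Qed.

Lemma state_field_linear n b : linear (fun a => state_field a n b).
Proof.
move=> x v w.
have vl : vfield (linc x (state_field v) (state_field w)).
  by apply: vf_lin; exact: state_fieldP.
have := state_fieldE vl; rewrite {1}/linc !state_field_vac => ->.
by [].
Qed.

Lemma state_field_vacl n b : state_field vac n b = if n == -1 then b else 0.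
Proof.
have := state_fieldE vf_id; rewrite {1}/idf eqxx => ->.
by [].
Qed.

Lemma state_field_der n a b :
  T (state_field a n b) - state_field a n (T b) = - (n%:~R *: state_field a (n - 1) b).
Proof. by rewrite (g_der (vfield_good (state_fieldP a))) addrC addrA addNr sub0r. Qed.

(** The vertex algebra with translation operator [T] generated by the fields [A]:
    [state_field v] is the only field with state [v] in the closure [vfield] of
    the fields [A i]. *)
Definition reconstruct : vertex_algebra V :=
  @VertexAlgebra K V vac T (fun n a b => state_field a n b)
    (gf_T gf) state_field_linear
    (fun n a => g_lin (vfield_good (state_fieldP a)) n)
    (fun a b => g_trunc (vfield_good (state_fieldP a)) b)
    state_field_vacl
    (fun n a n0 => g_crea (vfield_good (state_fieldP a)) n0)
    state_field_vac (gf_T0 gf) state_field_der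
    (fun a b => vfield_local (state_fieldP a) (state_fieldP b)).

End Reconstruction.

Section Intertwine.
Context (K : numFieldType) (V W : lmodType K) (pr : V -> W).
Context (TV : V -> V) (TW : W -> W) (vV : V) (vW : W) (I : Type).
Context (A : I -> int -> V -> V) (B : I -> int -> W -> W).
Hypotheses (gA : generating_fields TV vV A) (gB : generating_fields TW vW B).
Hypotheses (lpr : linear pr) (pr_vac : pr vV = vW).
Hypothesis prA : forall i n v, pr (A i n v) = B i n (pr v).

Lemma pr_iter_mulzw n Z p q :
  pr (iter n (@mulzw V) Z p q) = iter n (@mulzw W) (fun p q => pr (Z p q)) p q.
Proof. by rewrite iter_mulzw_lin. Qed.

Lemma vfield_intertwine a : vfield A a ->
  exists2 b, vfield B b & forall n v, pr (a n v) = b n (pr v).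
Proof.
elim=> {a} [|x a a' _ [b vb hb] _ [b' vb' hb']|n i a va [b vb hb]|k i a va [b vb hb]].
- exists (@idf K W); first exact: vf_id.
  by move=> n v; rewrite /idf; case: eqP => // _; rewrite (lin0 lpr).
- exists (linc x b b'); first exact: vf_lin.
  by move=> n v; rewrite /linc lpr hb hb'.
- exists (cprod n (B i) b); first exact: vf_cprod.
  move=> m v; rewrite /cprod pr_iter_mulzw; congr (iter _ _ _ _ _).
  by apply: fun2P => p q; rewrite /comm2 (linB lpr) !(prA, hb).
- exists (nop (iter k (@derf K W) (B i)) b); first exact: vf_nop.
  have hd n v : pr (iter k (@derf K V) (A i) n v) = iter k (@derf K W) (B i) n (pr v).
    elim: k n v => [|k IH] n v /=; first exact: prA.
    by rewrite /derf (linN lpr) (linZ lpr) IH.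
  have [la ta _ _] := vfield_good gA va; have [lb tb _ _] := vfield_good gB vb.
  have [li ti _ _] := good_iter_derf (gf_T gA) k (gf_good gA i).
  have [lj tj _ _] := good_iter_derf (gf_T gB) k (gf_good gB i).
  move=> m v; rewrite /nop /nop2.
  have [J1 h1] := evsum_ev (nopt_evz v 0 m li la ti ta).
  have [J2 h2] := evsum_ev (nopt_evz (pr v) 0 m lj lb tj tb).
  rewrite (h1 _ (leq_maxl J1 J2)) (h2 _ (leq_maxr J1 J2)) (lin_sum lpr).
  by apply: eq_bigr => j _; rewrite /nopt (linD lpr) !(hd, hb).
Qed.

Lemma reconstruct_hom n u v :
  pr (va_prod (reconstruct gA) n u v) = va_prod (reconstruct gB) n (pr u) (pr v).
Proof.
rewrite /=; have [b vb hb] := vfield_intertwine (state_fieldP gA u).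
rewrite hb; congr (_ n (pr v)).
have e : b (-1) vW = pr u by rewrite -[in LHS]pr_vac -hb state_field_vac.
by have := state_fieldE gB vb; rewrite e => ->.
Qed.

End Intertwine.

Section Induced.
Context (K : numFieldType) (g : lmodType K) (br : g -> g -> g).
Context (h : set g) (chi : g -> K).
Implicit Types (x y : g).

(** The enveloping algebra, as the quotient of the tensor algebra of [g] by the
    two-sided ideal of the relations [x y - y x = [x, y]]; the tensor algebra is
    itself presented by words in [g] modulo multilinearity. *)
Definition env_rel : set {freeg (seq g) / K} :=
  [set r | exists (u v : seq g) (x y : g) a,
     r = << u ++ (a *: x + y) :: v >> - (a *: << u ++ x :: v >> + << u ++ y :: v >>)]
  `|`
  [set r | exists (u v : seq g) (x y : g),
     r = << u ++ [:: x, y & v] >> - << u ++ [:: y, x & v] >> - << u ++ br x y :: v >>].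

Definition env : Type := lquot env_rel.
HB.instance Definition _ := GRing.Lmodule.on env.

Definition env_word w : env := lproj env_rel << w >>.

Definition env_mul x : env -> env :=
  llift (fun r => lproj env_rel (fglift (fun w => << x :: w >>) r)).

(** The module [U(g) (x)_(U(h)) C_chi], where [C_chi] is the one-dimensional
    [h]-module of character [chi] *)
Definition ind_rel : set env :=
  [set r | exists w x, h x /\ r = env_word (rcons w x) - chi x *: env_word w].

Definition ind : Type := lquot ind_rel.
HB.instance Definition _ := GRing.Lmodule.on ind.

Definition ind_vac : ind := lproj ind_rel (env_word [::]).

Definition ind_act x : ind -> ind :=
  llift (fun r => lproj ind_rel (env_mul x r)).

Record cyclic_rep (V : lmodType K) (act : g -> V -> V) (v0 : V) : Prop := CyclicRep {
  rep_linl : forall v, linear (fun x => act x v);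
  rep_linr : forall x, linear (act x);
  rep_comm : forall x y v, act x (act y v) - act y (act x v) = act (br x y) v;
  rep_chi : forall x, h x -> act x v0 = chi x *: v0;
  rep_gen : forall S : set V, subspace S -> S v0 ->
    (forall x v, S v -> S (act x v)) -> forall v, S v
}.

Lemma linear_proj (V W : lmodType K) (S : set W) (f : V -> W) :
  linear f -> linear (fun v => lproj S (f v)).
Proof. by move=> lf a x y; rewrite lf lproj_linear. Qed.

Let cons_lin x : linear (fglift (fun w => << x :: w >> : {freeg (seq g) / K})).
Proof. exact: fglift_linear. Qed.

Lemma lproj0 (V : lmodType K) (S : set V) v : S v -> lproj S v = 0.
Proof.
move=> Sv; rewrite -(lin0 (@lproj_linear _ _ S)); apply/lproj_eq; rewrite subr0.
exact: sub_lspan.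
Qed.

Lemma env_mul_proj x r :
  env_mul x (lproj env_rel r) = lproj env_rel (fglift (fun w => << x :: w >>) r).
Proof.
have lc := cons_lin x; rewrite /env_mul.
apply: (@llift_proj _ _ _ env_rel _ (linear_proj _ lc)) => {}r.
case=> [[u [v [y [z [a ->]]]]]|[u [v [y [z ->]]]]]; apply: lproj0.
  left; exists (x :: u), v, y, z, a.
  by rewrite (linB lc) (linD lc) (linZ lc) !fgliftU.
by right; exists (x :: u), v, y, z; rewrite !(linB lc) !fgliftU.
Qed.

Lemma env_mul_word x w : env_mul x (env_word w) = env_word (x :: w).
Proof. by rewrite env_mul_proj fgliftU. Qed.

Lemma env_mul_linear x : linear (env_mul x).
Proof.
move=> a q r; have [s ->] := lprojP q; have [t ->] := lprojP r.
by rewrite -lproj_linear !env_mul_proj cons_lin lproj_linear.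
Qed.

Lemma env_ind (S : set env) : subspace S -> (forall w, S (env_word w)) -> forall v, S v.
Proof.
move=> sS Sw v; have [r ->] := lprojP v; move: r; apply: freeg_ind => //.
case: (sS) => S0 SD; split; first by rewrite /= (lin0 (@lproj_linear _ _ _)).
by move=> a x y Sx Sy; rewrite /= lproj_linear; exact: SD.
Qed.

Lemma lin_env (V : lmodType K) (f1 f2 : env -> V) : linear f1 -> linear f2 ->
  (forall w, f1 (env_word w) = f2 (env_word w)) -> f1 =1 f2.
Proof.
move=> l1 l2 e; apply: env_ind => //; split => /=; first by rewrite !lin0.
by move=> a x y e1 e2; rewrite l1 l2 e1 e2.
Qed.

Lemma ind_act_proj x r : ind_act x (lproj ind_rel r) = lproj ind_rel (env_mul x r).
Proof.
have lm := env_mul_linear x.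
rewrite /ind_act; apply: (@llift_proj _ _ _ ind_rel _ (linear_proj _ lm)) => {}r [w [y [hy ->]]]; apply: lproj0.
by exists (x :: w), y; rewrite (linB lm) (linZ lm) !env_mul_word.
Qed.

Lemma ind_rep : cyclic_rep ind_act ind_vac.
Proof.
have lmul2 x y : linear (fun v => env_mul x (env_mul y v)).
  by move=> b q r; rewrite !env_mul_linear.
split.
- move=> v a x y; have [r ->] := lprojP v; rewrite !ind_act_proj -lproj_linear.
  congr lproj; move: r; apply: lin_env.
  + exact: env_mul_linear.
  + move=> b q r; rewrite !env_mul_linear scalerDr !scalerA mulrC scalerDr -!scalerA.
    by rewrite addrACA.
  move=> w; rewrite !env_mul_word /env_word -lproj_linear; apply/lproj_eq/sub_lspan.
  by left; exists [::], w, x, y, a.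
- move=> x a v w; have [q ->] := lprojP v; have [r ->] := lprojP w.
  by rewrite -lproj_linear !ind_act_proj env_mul_linear lproj_linear.
- move=> x y v; have [r ->] := lprojP v; rewrite !ind_act_proj.
  rewrite -(linB (@lproj_linear _ _ _)); congr lproj; move: r; apply: lin_env.
  + move=> b q r; rewrite !lmul2 scalerBr opprD addrACA.
    by [].
  + exact: env_mul_linear.
  move=> w; rewrite !env_mul_word /env_word -(linB (@lproj_linear _ _ _)).
  apply/lproj_eq/sub_lspan; right.
  by exists [::], w, x, y.
- move=> x hx; rewrite /ind_vac ind_act_proj env_mul_word.
  rewrite -(linZ (@lproj_linear _ _ _)); apply/lproj_eq/sub_lspan.
  by exists [::], x.
- move=> S sS S0 SA v; have [r ->] := lprojP v; move: r; apply: env_ind.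
    case: (sS) => SS0 SD; split; first by rewrite /= (lin0 (@lproj_linear _ _ _)).
    by move=> a x y Sx Sy; rewrite /= lproj_linear; exact: SD.
  elim=> [//|x w IH]; rewrite /= -env_mul_word -ind_act_proj.
  exact: SA.
Qed.

Section Quotient.
Context (V : lmodType K) (act : g -> V -> V) (v0 : V) (N : set V).
Hypothesis rV : cyclic_rep act v0.
Hypothesis sN : subspace N.
Hypothesis actN : forall x v, N v -> N (act x v).

Definition quot_act x : lquot N -> lquot N := llift (fun v => lproj N (act x v)).

Lemma quot_act_proj x v : quot_act x (lproj N v) = lproj N (act x v).
Proof.
rewrite /quot_act; apply: (@llift_proj _ _ _ N _ (linear_proj _ (rep_linr rV x))) => {}v Nv.
by apply/lproj0/actN.
Qed.

Lemma quot_rep : cyclic_rep quot_act (lproj N v0).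
Proof.
split.
- move=> q a x y; have [v ->] := lprojP q.
  by rewrite !quot_act_proj (rep_linl rV) lproj_linear.
- move=> x a q r; have [v ->] := lprojP q; have [w ->] := lprojP r.
  by rewrite -lproj_linear !quot_act_proj (rep_linr rV) lproj_linear.
- move=> x y q; have [v ->] := lprojP q.
  by rewrite !quot_act_proj -(linB (@lproj_linear _ _ _)) (rep_comm rV).
- by move=> x hx; rewrite quot_act_proj (rep_chi rV) // (linZ (@lproj_linear _ _ _)).
- move=> S sS S0 SA q; have [v ->] := lprojP q; move: v; apply: (rep_gen rV) => //.
    case: sS => SS0 SD; split; first by rewrite /= (lin0 (@lproj_linear _ _ _)).
    by move=> a x y Sx Sy; rewrite /= lproj_linear; exact: SD.
  by move=> x v Sv; rewrite /= -quot_act_proj; exact: SA.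
Qed.

End Quotient.

End Induced.

Section Bilinear.
Context (K : numFieldType) (X Y : choiceType) (M : lmodType K) (f : X -> Y -> M).

Definition bilift (A : {freeg X / K}) (B : {freeg Y / K}) : M :=
  fglift (fun x => fglift (f x) B) A.

Lemma bilift_linl B : linear (fun A => bilift A B).
Proof. exact: fglift_linear. Qed.

Lemma bilift_linr A : linear (bilift A).
Proof.
move: A; apply: freeg_ind => [|x]; last first.
  by move=> a B C; rewrite /bilift !fgliftU fglift_linear.
split=> [|a A A' hA hA'] b B C; rewrite /=.
  by rewrite !(lin0 (bilift_linl _)) scaler0 addr0.
rewrite !(bilift_linl _) hA hA' !scalerDr !scalerA mulrC addrACA.
by [].
Qed.

Lemma biliftU x y : bilift << x >> << y >> = f x y.
Proof. by rewrite /bilift !fgliftU. Qed.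

End Bilinear.

Section DifferentialOperators.
Context (K : numFieldType).

(** The basis vector [(m, p)] stands for [t^m (d/dt)^p]. *)
Definition diffop := {freeg (int * nat) / K}.
Definition dmon (m : int) (p : nat) : diffop := << (m, p) >>.

(** [zffact m i = m (m - 1) ... (m - i + 1)], so that the [i]-th derivative of
    [t^m] is [zffact m i * t^(m - i)]. *)
Definition zffact (m : int) (i : nat) : K := \prod_(j < i) (m - j%:Z)%:~R.

(** The Leibniz rule for the composite of [t^m (d/dt)^p] and [t^n (d/dt)^q] *)
Definition dmul : diffop -> diffop -> diffop :=
  bilift (fun a b : int * nat =>
    \sum_(i < a.2.+1) ('C(a.2, i)%:R * zffact b.1 i)
        *: dmon (a.1 + b.1 - i%:Z) (a.2 + b.2 - i)).

Definition dbr (A B : diffop) : diffop := dmul A B - dmul B A.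

(** The cocycle on [t^m (d/dt)^p] and [t^n (d/dt)^q]: the residue of
    [f^(q+1) g^(p)], with [f = t^m] and [g = t^n], is the coefficient of [t^-1] *)
Definition psi_mon (a b : int * nat) : K^o :=
  let: (m, p) := a in let: (n, q) := b in
  (p`! * q`!)%:R / ((p + q).+1)`!%:R *
  (if m - q.+1%:Z + (n - p%:Z) == -1 then zffact m q.+1 * zffact n p else 0).

Definition psi : diffop -> diffop -> K^o := bilift psi_mon.

(** [(A, x)] stands for [A + x kappa]. *)
Definition dhat := (diffop * K^o)%type.
HB.instance Definition _ := GRing.Lmodule.on dhat.

Definition dhat_br (x y : dhat) : dhat := (dbr x.1 y.1, psi x.1 y.1).

Definition Jop (l : nat) (k : int) : diffop := - dmon (l%:Z + k) l.
Definition J (l : nat) (k : int) : dhat := (Jop l k, 0).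

(** [Psub] is [P], and [Phat] is [P + C kappa] *)
Definition Psub : set diffop :=
  lspan [set A | exists l k, 0 <= l%:Z + k /\ A = Jop l k].
Definition Phat : set dhat := [set x | Psub x.1].

(** The character of [P + C kappa] which is [0] on [P] and [c] at [kappa] *)
Definition Pchar (c : K) (x : dhat) : K := c * x.2.

Definition dhat_rep (c : K) := @cyclic_rep K dhat dhat_br Phat (Pchar c).

Let E m p : dhat := (dmon m p, 0).
Let kappa a : dhat := (0, a).

Lemma JE l k : J l k = - E (l%:Z + k) l.
Proof. by rewrite /J /E /Jop -[RHS]/(- _, - _) /= oppr0. Qed.

Lemma J_shift l n : J l (n - l%:Z) = - E n l.
Proof. by rewrite JE; congr (- E _ _); lia. Qed.

Lemma psi_monE m p n q : psi (dmon m p) (dmon n q) = psi_mon (m, p) (n, q).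
Proof. exact: biliftU. Qed.

Lemma dmulE m p n q : dmul (dmon m p) (dmon n q) =
  \sum_(i < p.+1) ('C(p, i)%:R * zffact n i) *: dmon (m + n - i%:Z) (p + q - i).
Proof. exact: biliftU. Qed.

Lemma dbr_linl B : linear (fun A => dbr A B).
Proof.
move=> a A A'; rewrite /dbr /dmul (bilift_linl _ B) (bilift_linr _ B) scalerBr opprD.
by rewrite addrACA.
Qed.
Lemma dbr_linr A : linear (dbr A).
Proof.
move=> a B B'; rewrite /dbr /dmul (bilift_linl _ A) (bilift_linr _ A) scalerBr opprD.
by rewrite addrACA.
Qed.

Lemma dhat_br_linl y : linear (fun x => dhat_br x y).
Proof.
move=> a x x'; rewrite /dhat_br /= dbr_linl.
by rewrite /psi (bilift_linl _ y.1).
Qed.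
Lemma dhat_br_linr x : linear (dhat_br x).
Proof.
move=> a y y'; rewrite /dhat_br /= dbr_linr.
by rewrite /psi (bilift_linr _ x.1).
Qed.

Lemma dhat_ind (S : set dhat) : subspace S -> (forall l n, S (J l (n - l%:Z))) ->
  (forall a, S (kappa a)) -> forall x, S x.
Proof.
move=> sS SJ Sk [A a]; have -> : (A, a) = (A, 0) + kappa a.
  by rewrite /kappa -[RHS]/(_, _) /= addr0 add0r.
apply: subspaceD => //; move: A; apply: freeg_ind => [|[m p]].
  case: (sS) => S0 SD; split => [|b A B SA SB]; first exact: S0.
  have -> : (b *: A + B, 0) = b *: (A, 0) + (B, 0) :> dhat.
    by rewrite -[RHS]/(_, _) /= scaler0 addr0.
  exact: SD.
have := subspaceN sS (SJ p m); rewrite J_shift opprK.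
by [].
Qed.

Lemma zffactS m i : zffact m i.+1 = zffact m i * (m - i%:Z)%:~R.
Proof. by rewrite /zffact big_ord_recr. Qed.

Lemma zffactSl m i : zffact (m + 1) i.+1 = (m + 1)%:~R * zffact m i.
Proof.
rewrite /zffact big_ord_recl /= subr0; congr (_ * _).
by apply: eq_bigr => j _; congr (_%:~R); rewrite /bump /=; lia.
Qed.

Lemma zffact_diff m i : zffact (m + 1) i.+1 - zffact m i.+1 = i.+1%:R * zffact m i.
Proof.
rewrite zffactSl zffactS [zffact m i * _]mulrC -mulrBl; congr (_ * _).
by rewrite -intrB -[RHS]/(i.+1%:Z%:~R); congr (_%:~R); lia.
Qed.

Lemma zffact0 i : zffact 0 i.+1 = 0.
Proof. by rewrite /zffact big_ord_recl /= subr0 mul0r. Qed.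

Section Kills.
Context (V : lmodType K).
Implicit Types (X : int -> int -> V).

Definition kills N X := forall p q, iter N (@mulzw V) X p q = 0.

Lemma kills_le M N X : (M <= N)%N -> kills M X -> kills N X.
Proof. by move=> MN hX p q; exact: iter_mulzw_le MN hX p q. Qed.

Lemma kills_sub N X Y : kills N X -> kills N Y -> kills N (fun p q => X p q - Y p q).
Proof. by move=> hX hY p q; rewrite iter_mulzw_sub hX hY subrr. Qed.

Lemma kills0 N : kills N (fun _ _ => 0).
Proof. by move=> p q; rewrite iter_mulzw0. Qed.

Lemma kills_add N X Y : kills N X -> kills N Y -> kills N (fun p q => X p q + Y p q).
Proof.
move=> hX hY.
have -> : (fun p q => X p q + Y p q) = (fun p q => X p q - (0 - Y p q)).
  by apply: fun2P => p q; rewrite sub0r opprK.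
by apply: kills_sub => //; apply: kills_sub => //; exact: kills0.
Qed.

Lemma kills_scale N x X : kills N X -> kills N (fun p q => x *: X p q).
Proof.
move=> hX p q; have lZ : linear (fun z : V => x *: z).
  by move=> y z t; rewrite scalerDr !scalerA mulrC.
by rewrite (iter_mulzw_lin _ _ _ _ lZ) hX scaler0.
Qed.

Lemma kills_sum N n (X : 'I_n -> int -> int -> V) : (forall i, kills N (X i)) ->
  kills N (fun p q => \sum_(i < n) X i p q).
Proof.
elim: n X => [|n IH] X hX.
  have -> : (fun p q => \sum_(i < 0) X i p q) = (fun _ _ => 0).
    by apply: fun2P => p q; rewrite big_ord0.
  exact: kills0.
have -> : (fun p q => \sum_(i < n.+1) X i p q) =
  (fun p q => \sum_(i < n) X (widen_ord (leqnSn n) i) p q + X ord_max p q).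
  by apply: fun2P => p q; rewrite big_ord_recr.
by apply: kills_add => //; apply: IH.
Qed.

Lemma kills_zffact a b (G : int -> V) :
  kills (a + b).+1 (fun m n => (zffact m a * zffact n b) *: G (m + n)).
Proof.
suff {a b G} H s : forall a b (G : int -> V), (a + b <= s)%N ->
    kills s.+1 (fun m n => (zffact m a * zffact n b) *: G (m + n)) by exact: H.
elim: s => [|s IH] a b G hs p q; rewrite iterSr.
  have [-> ->] : a = 0%N /\ b = 0%N by lia.
  rewrite /= /mulzw /zffact !big_ord0 mulr1.
  by rewrite -!addrA [1 + q]addrC subrr.
have -> : mulzw (fun m n => (zffact m a * zffact n b) *: G (m + n)) =
  (fun m n => a%:R *: ((zffact m a.-1 * zffact n b) *: G (m + n + 1))
            - b%:R *: ((zffact m a * zffact n b.-1) *: G (m + n + 1))).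
  apply: fun2P => m n; rewrite /mulzw.
  have -> : m + 1 + n = m + n + 1 by lia.
  have -> : m + (n + 1) = m + n + 1 by lia.
  rewrite !scalerA -!scalerBl; congr (_ *: _).
  have d x i : zffact (x + 1) i = zffact x i + i%:R * zffact x i.-1.
    case: i => [|i]; first by rewrite mul0r addr0 /zffact !big_ord0.
    by rewrite -zffact_diff [RHS]addrC subrK.
  rewrite !d mulrDl mulrDr opprD addrACA subrr add0r.
  by congr (_ - _); rewrite ?mulrA // [zffact m a * _]mulrC mulrAC.
apply: kills_sub => {p q}.
  case: a hs => [|a] hs; first by move=> p q; rewrite iter_mulzw0 // => *; rewrite scale0r.
  by apply: kills_scale; apply: (IH a b (fun x => G (x + 1))); lia.
case: b hs => [|b] hs; first by move=> p q; rewrite iter_mulzw0 // => *; rewrite scale0r.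
by apply: kills_scale; apply: (IH a b (fun x => G (x + 1))); lia.
Qed.

End Kills.

Section Representation.
Context (c : K) (V : lmodType K) (act : dhat -> V -> V) (v0 : V).
Hypothesis rV : dhat_rep c act v0.

Definition Jfield (l : nat) : int -> V -> V := fun n => act (J l (n - l%:Z)).

Let aE m p v := act (E m p) v.

Lemma JfieldE l n v : Jfield l n v = - aE n l v.
Proof. by rewrite /Jfield J_shift (linN (rep_linl rV v)). Qed.

Lemma act_br m p n q v : act (dhat_br (E m p) (E n q)) v =
  \sum_(i < p.+1) ('C(p, i)%:R * zffact n i) *: aE (m + n - i%:Z) (p + q - i) v
  - \sum_(i < q.+1) ('C(q, i)%:R * zffact m i) *: aE (n + m - i%:Z) (q + p - i) v
  + psi_mon (m, p) (n, q) *: act (kappa 1) v.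
Proof.
have ll := rep_linl rV v.
have -> : dhat_br (E m p) (E n q) =
    (dmul (dmon m p) (dmon n q), 0) - (dmul (dmon n q) (dmon m p), 0)
    + psi_mon (m, p) (n, q) *: kappa 1.
  rewrite /dhat_br /dbr /= psi_monE -[RHS]/(_, _) /=.
  by rewrite scaler0 addr0 subr0 add0r -[_ *: 1]/(_ * 1) mulr1.
rewrite (linD ll) (linB ll) (linZ ll).
have ld : linear (fun A : diffop => act (A, 0) v).
  move=> a A B; rewrite -ll; congr act.
  by rewrite -[RHS]/(_, _) /= scaler0 addr0.
have := lin_sum ld => ls; rewrite !dmulE !ls.
by congr (_ - _ + _); apply: eq_bigr => i _; rewrite (linZ ld).
Qed.

Lemma Jcomm l m l' n v :
  Jfield l m (Jfield l' n v) - Jfield l' n (Jfield l m v) =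
  act (dhat_br (E m l) (E n l')) v.
Proof.
rewrite !JfieldE /aE !(linN (rep_linr rV _)) !opprK (rep_comm rV).
by [].
Qed.

Lemma Jfield_local l l' : mutually_local (Jfield l) (Jfield l').
Proof.
exists (l + l').+2 => v.
suff : kills (l + l').+2 (fun m n => act (dhat_br (E m l) (E n l')) v).
  have -> : (fun m n => act (dhat_br (E m l) (E n l')) v) =
     (fun p q => Jfield l p (Jfield l' q v) - Jfield l' q (Jfield l p v)).
    by apply: fun2P => p q; rewrite Jcomm.
  exact.
have -> : (fun m n => act (dhat_br (E m l) (E n l')) v) = fun m n =>
  \sum_(i < l.+1) ('C(l, i)%:R * zffact n i) *: aE (m + n - i%:Z) (l + l' - i) v
  - \sum_(i < l'.+1) ('C(l', i)%:R * zffact m i) *: aE (n + m - i%:Z) (l' + l - i) v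
  + psi_mon (m, l) (n, l') *: act (kappa 1) v.
  by apply: fun2P => m n; rewrite act_br.
apply: kills_add; first apply: kills_sub.
- apply: kills_sum => i.
  have -> : (fun m n => ('C(l, i)%:R * zffact n i) *: aE (m + n - i%:Z) (l + l' - i) v) =
    (fun m n => 'C(l, i)%:R *: ((zffact m 0 * zffact n i) *: aE (m + n - i%:Z) (l + l' - i) v)).
    by apply: fun2P => m n; rewrite scalerA /zffact big_ord0 mul1r.
  apply: kills_scale; apply: (@kills_le _ (0 + i).+1); first by case: i => /= i; lia.
  exact: (@kills_zffact V 0 i (fun x => aE (x - i%:Z) (l + l' - i) v)).
- apply: kills_sum => i.
  have -> : (fun m n => ('C(l', i)%:R * zffact m i) *: aE (n + m - i%:Z) (l' + l - i) v) =
    (fun m n => 'C(l', i)%:R *: ((zffact m i * zffact n 0) *: aE (m + n - i%:Z) (l' + l - i) v)).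
    by apply: fun2P => m n; rewrite scalerA /zffact big_ord0 mulr1 [n + m]addrC.
  apply: kills_scale; apply: (@kills_le _ (i + 0).+1); first by case: i => /= i; lia.
  exact: (@kills_zffact V i 0 (fun x => aE (x - i%:Z) (l' + l - i) v)).
- pose G (x : int) : V := if x == (l + l')%N%:Z then act (kappa 1) v else 0.
  have -> : (fun m n => psi_mon (m, l) (n, l') *: act (kappa 1) v) =
    (fun m n => ((l`! * l'`!)%:R / ((l + l').+1)`!%:R) *:
        ((zffact m l'.+1 * zffact n l) *: G (m + n))).
    apply: fun2P => m n; rewrite scalerA /psi_mon /G.
    have -> : (m - l'.+1%:Z + (n - l%:Z) == -1) = (m + n == (l + l')%N%:Z).
      by apply/eqP/eqP; lia.
    by case: ifP; rewrite ?mulr0 ?scaler0 ?scale0r.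
  apply: kills_scale; apply: (@kills_le _ (l'.+1 + l).+1); first by lia.
  exact: kills_zffact.
Qed.

Lemma act_kappa0 x v : act (dhat_br x (kappa 0)) v = 0.
Proof.
have -> : kappa 0 = 0 by [].
by rewrite (lin0 (dhat_br_linr x)) (lin0 (rep_linl rV v)).
Qed.

Lemma Phat_kappa a : Phat (kappa a).
Proof. by rewrite /Phat /=; case: (lspan_subspace [set A | exists l k, 0 <= l%:Z + k /\ A = Jop l k]). Qed.

Lemma dhat_br_kappal a x : dhat_br (kappa a) x = 0.
Proof.
rewrite /dhat_br /= (lin0 (dbr_linl _)) /psi (lin0 (bilift_linl _ _)).
by [].
Qed.

Lemma dhat_br_kappar a x : dhat_br x (kappa a) = 0.
Proof.
rewrite /dhat_br /= (lin0 (dbr_linr _)) /psi (lin0 (bilift_linr _ _)).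
by [].
Qed.

Lemma act_kappa a v : act (kappa a) v = (c * a) *: v.
Proof.
move: v; apply: (rep_gen rV).
- split => [|b x y hx hy]; first by rewrite /= (lin0 (rep_linr rV _)) scaler0.
  by rewrite /= (rep_linr rV) hx hy scalerDr !scalerA [b * _]mulrC.
- by rewrite /= (rep_chi rV) //; exact: Phat_kappa.
- move=> x v /= hv; have /eqP := rep_comm rV (kappa a) x v.
  rewrite dhat_br_kappal (lin0 (rep_linl rV v)) subr_eq0 => /eqP ->.
  by rewrite hv (linZ (rep_linr rV x)).
Qed.

Lemma Jfield_vac l n : 0 <= n -> Jfield l n v0 = 0.
Proof.
move=> n0; rewrite /Jfield (rep_chi rV) ?/Pchar ?mulr0 ?scale0r //.
by apply: sub_lspan; exists l, (n - l%:Z); split => //; lia.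
Qed.

Lemma Jfield_trunc l : trunc (Jfield l).
Proof.
move=> v; move: v l.
apply: (rep_gen rV (S := [set v | forall l, exists N : nat, forall n,
   N%:Z <= n -> Jfield l n v = 0])).
- split => [l|b x y hx hy l] /=.
    by exists 0%N => n _; rewrite /Jfield (lin0 (rep_linr rV _)).
  have [N hN] := hx l; have [M hM] := hy l; exists (maxn N M) => n hn.
  by rewrite /Jfield (rep_linr rV) -!/(Jfield _ _ _) hN ?hM ?scaler0 ?addr0 //; lia.
- by move=> l; exists 0%N => n n0; exact: Jfield_vac.
move=> x v hv l; move: x; apply: dhat_ind.
- split => [|b x y [N hN] [M hM]] /=.
    exists 0%N => n _; rewrite (lin0 (rep_linl rV _)).
    by rewrite /Jfield (lin0 (rep_linr rV _)).
  exists (maxn N M) => n hn; rewrite (rep_linl rV) /Jfield (rep_linr rV) -!/(Jfield _ _ _).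
  by rewrite hN ?hM ?scaler0 ?addr0 //; lia.
- move=> l' k /=.
  have [M hM] : exists M : nat, forall j, (j <= l + l')%N -> forall n,
      M%:Z <= n -> aE n j v = 0.
    move: (l + l')%N => s; elim: s => [|s [M hM]].
      have [M hM] := hv 0%N; exists M => j; rewrite leqn0 => /eqP -> n /hM.
      by rewrite JfieldE => /eqP; rewrite oppr_eq0 => /eqP.
    have [M' hM'] := hv s.+1; exists (maxn M M') => j.
    rewrite leq_eqVlt => /orP[/eqP ->|js] n hn; last by apply: hM => //; lia.
    have : Jfield s.+1 n v = 0 by apply: hM'; lia.
    by rewrite JfieldE => /eqP; rewrite oppr_eq0 => /eqP.
  have [N hN] := hv l; exists (N + M + `|k| + l + l').+1 => n hn.
  rewrite -/(Jfield l' k v); have /eqP := Jcomm l n l' k v.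
  rewrite [Jfield l n v]hN; last by lia.
  rewrite [Jfield l' k 0](lin0 (rep_linr rV _)) subr0 => /eqP ->.
  rewrite act_br !big1 ?subrr ?add0r.
  + rewrite /psi_mon; case: eqP => [e|_]; first by lia.
    by rewrite mulr0 scale0r.
  + by move=> i _; rewrite hM ?scaler0 //; case: i => /= i; lia.
  + by move=> i _; rewrite hM ?scaler0 //; case: i => /= i; lia.
- move=> a /=; have [N hN] := hv l; exists N => n /hN hn.
  by rewrite act_kappa /Jfield (linZ (rep_linr rV _)) -/(Jfield _ _ _) hn scaler0.
Qed.

(** [J^1_(-1)], that is [- d/dt], acts as the translation operator *)
Definition transl : V -> V := act (J 1 (- 1)).

Lemma translE v : transl v = - aE 0 1 v.
Proof. by rewrite /transl JE (linN (rep_linl rV v)). Qed.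

Lemma Jfield_transl l n v :
  transl (Jfield l n v) = Jfield l n (transl v) - n%:~R *: Jfield l (n - 1) v.
Proof.
rewrite !translE -!(@JfieldE 1 0); apply/eqP; rewrite addrC -subr_eq; apply/eqP.
rewrite Jcomm act_br !big_ord_recl big_ord0 /= big1; last first.
  move=> i _; rewrite /bump /= add1n zffact0 mulr0 scale0r.
  by [].
rewrite /psi_mon zffact0 mul0r; case: ifP => _; rewrite ?mulr0 scale0r !addr0.
all: rewrite /zffact !big_ord_recl !big_ord0 /= !bin0 !bin1 !mul1r !mulr1 !scale1r.
all: have -> : 0 + n = n by [lia].
all: have -> : (1 + l - 0 = l + 1)%N by [lia].
all: have -> : (l + 1 - 0 = l + 1)%N by [lia].
all: rewrite addrC addrA addNr add0r JfieldE scalerN opprK /bump /=.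
all: by congr (_%:~R *: aE _ _ _); lia.
Qed.

Lemma rep_fields : generating_fields transl v0 Jfield.
Proof.
split.
- exact: (rep_linr rV).
- exact: (@Jfield_vac 1 0).
- move=> l; split; [by move=> n; exact: (rep_linr rV)|exact: Jfield_trunc| |].
    by move=> n v; exact: Jfield_transl.
  by move=> n; exact: Jfield_vac.
- exact: Jfield_local.
- move=> S sS S0 SJ; apply: (rep_gen rV) => // x v Sv; move: x; apply: dhat_ind.
  + case: (sS) => Sz SD; split; first by rewrite /= (lin0 (rep_linl rV v)).
    by move=> b x y Sx Sy; rewrite /= (rep_linl rV); exact: SD.
  + by move=> l n; exact: SJ.
  + by move=> a; rewrite /= act_kappa; exact: subspaceZ.
Qed.

End Representation.

End DifferentialOperators.

Section Winfinity.
Context (K : numFieldType) (c : K).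

Definition Mc : Type := ind (@dhat_br K) (@Phat K) (Pchar c).
HB.instance Definition _ := GRing.Lmodule.on Mc.

Definition Mc_act : dhat K -> Mc -> Mc := @ind_act K (dhat K) _ _ _.
Definition Mc_vac : Mc := ind_vac _ _ _.

Lemma Mc_rep : dhat_rep c Mc_act Mc_vac.
Proof. exact: ind_rep. Qed.

(** The vertex algebra [M_c]: the mode [J^l_n] of [J^l(z)], as an element of
    [dhat], is [J l (n - l)] since [J^l(z) = \sum_k J^l_k z^(-k-l-1)]. *)
Definition Mc_va : vertex_algebra Mc := reconstruct (rep_fields Mc_rep).

Definition Jst (l : nat) : Mc := Mc_act (J K l (- 1 - l%:Z)) Mc_vac.

Lemma Mc_va_vac : va_vac Mc_va = Mc_vac.
Proof. by []. Qed.

Lemma Mc_va_J l n v : va_prod Mc_va n (Jst l) v = Mc_act (J K l (n - l%:Z)) v.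
Proof. by rewrite /= -[Jst l]/(Jfield Mc_act l (-1) Mc_vac) state_field_gen. Qed.

(** The homogeneous component of [M_c] of weight [m]; [J^l_k] has weight [-k] *)
Definition Mc_weight (m : int) : set Mc :=
  lspan [set v | exists2 s : seq (nat * int), \sum_(p <- s) - p.2 = m &
                   v = foldr (fun p => Mc_act (J K p.1 p.2)) Mc_vac s].

Definition graded_submodule (N : set Mc) :=
  [/\ subspace N, forall x v, N v -> N (Mc_act x v)
    & N `<=` lspan (N `&` \bigcup_m Mc_weight m)].

Definition proper_graded_submodule (N : set Mc) :=
  graded_submodule N /\ N <> setT.

(** The maximal proper graded submodule [I_c], as the sum of all proper graded
    submodules; see [IcE]. *)
Definition Ic : set Mc := lspan (\bigcup_(N in proper_graded_submodule) N).

Lemma Ic_subspace : subspace Ic.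
Proof. exact: lspan_subspace. Qed.

Lemma sub_Ic N : proper_graded_submodule N -> N `<=` Ic.
Proof. by move=> pN v Nv; apply: sub_lspan; exists N. Qed.

Lemma Ic_act x v : Ic v -> Ic (Mc_act x v).
Proof.
move: v; apply: lspan_min.
  have [I0 ID] := Ic_subspace; split.
    by rewrite /= (lin0 (rep_linr Mc_rep x)).
  by move=> a u w Iu Iw; rewrite /= (rep_linr Mc_rep); exact: ID.
move=> v [N pN Nv]; apply: (sub_Ic pN).
by have [[_ actN _] _] := pN; exact: actN.
Qed.

Lemma Ic_graded : graded_submodule Ic.
Proof.
split; [exact: Ic_subspace|exact: Ic_act|].
apply: lspan_min; first exact: lspan_subspace.
move=> v [N pN Nv]; have [[_ _ gN] _] := pN.
have := gN v Nv; apply: lspan_min; first exact: lspan_subspace.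
by move=> u [Nu hu]; apply: sub_lspan; split => //; exact: (sub_Ic pN).
Qed.

Lemma IcE N : proper_graded_submodule N ->
  (forall N', proper_graded_submodule N' -> N' `<=` N) -> Ic = N.
Proof.
move=> pN maxN; apply/seteqP; split; last exact: sub_Ic.
apply: lspan_min; first by have [[]] := pN.
by move=> v [N' pN' /(maxN _ pN')].
Qed.

Definition Winf : Type := lquot Ic.
HB.instance Definition _ := GRing.Lmodule.on Winf.

Definition Winf_proj : Mc -> Winf := lproj Ic.

Definition Winf_act : dhat K -> Winf -> Winf := quot_act Mc_act (N := Ic).

Lemma Winf_rep : dhat_rep c Winf_act (Winf_proj Mc_vac).
Proof. exact: (quot_rep Mc_rep Ic_act). Qed.

(** The vertex algebra [W_(1+infinity, c)]; by [Winf_proj_hom], it is the quotient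
    of [Mc_va] by [Ic]. *)
Definition Winf_va : vertex_algebra Winf := reconstruct (rep_fields Winf_rep).

Definition jst (l : nat) : Winf := Winf_proj (Jst l).

Lemma Winf_proj_act x v : Winf_proj (Mc_act x v) = Winf_act x (Winf_proj v).
Proof. by rewrite /Winf_act /Winf_proj (quot_act_proj Mc_rep Ic_act). Qed.

Lemma Winf_proj_hom n u v :
  Winf_proj (va_prod Mc_va n u v) = va_prod Winf_va n (Winf_proj u) (Winf_proj v).
Proof.
apply: reconstruct_hom => //; first exact: lproj_linear.
by move=> i m w; exact: Winf_proj_act.
Qed.

Lemma Winf_proj_vac : Winf_proj (va_vac Mc_va) = va_vac Winf_va.
Proof. by []. Qed.

Lemma Winf_va_j l n v : va_prod Winf_va n (jst l) v = Winf_act (J K l (n - l%:Z)) v.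
Proof.
rewrite /= /jst /Jst Winf_proj_act.
by rewrite -[Winf_act _ _]/(Jfield Winf_act l (-1) (Winf_proj Mc_vac)) state_field_gen.
Qed.

End Winfinity.

(* Main.v *)
(** [M_(-n)] maps to the Fock space of [n] pairs of Weyl fields, with vacuum going to
    [1]; the kernel is a proper graded submodule, so every relation that holds there
    also holds in [W_(1+infinity, -n)].  The quadratics [quad a b], the states of
    [(d/dt)^a t^(-1) (d/dt)^b], are the entries of a matrix of rank at most [n], so
    the determinant of [quad i j] with [0 <= i, j <= n] vanishes.  Modulo words in the
    lower generators a product of [quad (a i) (b i)] is [n^2 + 2n + 1] times
    the sum over all cyclic permutations [c] of
    [\prod_i (b i + a (c i) + 1)^-1], times the state of [t^(-1) (d/dt)^(n^2 + 2n)];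
    hence the determinant contributes, up to sign, [(n^2 + 2n + 1) n!] times the
    determinant of a Hilbert matrix, which is nonzero.  So [j^(n^2 + 2n)] is a Wick
    polynomial in the [j^l] of smaller order, and by induction on the weight, raising
    the order with [t (d/dt)^2], so are all the others. *)
Require Import Defs.
From mathcomp Require Import freeg finmap monalg.
From mathcomp Require Import all_boot all_order all_algebra fingroup perm.
From mathcomp Require Import boolp classical_sets reals complex zify ring.

Set Implicit Arguments.
Unset Strict Implicit.
Unset Printing Implicit Defensive.

Import Order.TTheory GRing.Theory Num.Theory.
Local Open Scope ring_scope.
Local Open Scope classical_set_scope.

(** The obstacle is that the entries [quad] are multiplied in a commutative algebra, while [words]
    asks for operators applied in succession. Trading one factor for the operator [eop] costs
    corrections with one factor fewer and the same total weight. In weight [N + 1] the repeated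
    corrections end in single quadratics, the only place where order [N] can occur. The reciprocals
    they collect obey the partial fraction identity that inserts one point into a cycle, hence the
    cyclic permutations. For a fixed cycle the signed sum over the terms of the determinant is the
    determinant of a Hilbert matrix with permuted rows; all cycles of length [n + 1] have the sign
    [(-1)^n], so the contributions cannot cancel. The order [n^2 + 2n] comes from the weight of the
    determinant: in each term the indices [0, ..., n] occur twice and each of the [n + 1] factors
    adds 1, which makes [(n + 1)^2]. The kernel has to be graded to lie in [Ic], and this is
    obtained from the Euler operator [t (d/dt)], which acts on words by minus their weight. *)

Definition dE (K : numFieldType) (m : int) (p : nat) : dhat K := (dmon K m p, 0).

(** * Words in the negative modes and their weights *)

Section Words.
Context (K : numFieldType) (V : lmodType K) (act : dhat K -> V -> V) (v0 : V).

(** The letter [(k, l)] stands for [t^(-1-k) (d/dt)^l], of weight [k + l + 1]. *)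
Definition word (s : seq (nat * nat)) : V :=
  foldr (fun p => act (dE K (- 1 - p.1%:Z) p.2)) v0 s.

Definition wt (s : seq (nat * nat)) : int := \sum_(p <- s) (p.1 + p.2 + 1)%N%:Z.

Definition words (P : pred nat) (z : int) : set V :=
  lspan [set v | exists2 s, all (fun p => P p.2) s /\ wt s = z & v = word s].

Lemma words_subspace P z : subspace (words P z).
Proof. exact: lspan_subspace. Qed.

Lemma word_words (P : pred nat) s : all (fun p => P p.2) s -> words P (wt s) (word s).
Proof. by move=> Ps; apply: sub_lspan; exists s. Qed.

Lemma words_v0 (P : pred nat) : words P 0 v0.
Proof. by have := @word_words P [::] isT; rewrite /wt big_nil. Qed.

Lemma wt_cons p s : wt (p :: s) = (p.1 + p.2 + 1)%N%:Z + wt s.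
Proof. by rewrite /wt big_cons. Qed.

Lemma wt_ge0 s : 0 <= wt s.
Proof. by elim: s => [|p s IH]; rewrite ?/wt ?big_nil // -/(wt _) wt_cons; lia. Qed.

Lemma words_lt0 (P : pred nat) z v : z < 0 -> words P z v -> v = 0.
Proof.
move=> z0; move: v; apply: lspan_min.
  by split => //= a x y -> ->; rewrite scaler0 addr0.
by move=> v [s [_ sz]]; have := wt_ge0 s; lia.
Qed.

Hypothesis linr : forall x, linear (act x).

Lemma words_letter (P : pred nat) (m : int) l z v : m < 0 -> P l -> words P z v ->
  words P (z + l%:Z - m) (act (dE K m l) v).
Proof.
move=> m0 Pl; move: v; apply: lspan_min.
  have [W0 WD] := words_subspace P (z + l%:Z - m).
  split=> [|a x y Wx Wy] /=; first by rewrite (lin0 (linr _)).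
  by rewrite linr; exact: WD.
move=> _ [s [Ps <-] ->]; apply: sub_lspan; exists (((`|m|.-1)%N, l) :: s).
  split; first by rewrite /= Pl.
  by rewrite wt_cons /=; lia.
by rewrite /=; congr (act (dE K _ l) _); lia.
Qed.

End Words.

(** * From one decoupling relation to strong generation *)

Section Rep.
Context (K : numFieldType) (c : K) (V : lmodType K) (act : dhat K -> V -> V) (v0 : V).
Hypothesis rV : dhat_rep c act v0.

Let linr := rep_linr rV.
Notation aE m p := (act (dE K m p)).
Notation word := (word act v0).
Notation words := (words act v0).

Lemma act_comm x y v : act x (act y v) = act y (act x v) + act (dhat_br x y) v.
Proof. by rewrite -(rep_comm rV) addrC subrK. Qed.

(** By the Leibniz rule a commutator consists of terms of one and the same degree, plus a central
    term that vanishes unless [m + n = p + q]. *)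
Lemma act_br_mem (S : set V) m p n q v : subspace S ->
  (forall i, (i <= p)%N \/ (i <= q)%N -> S (aE (m + n - i%:Z) (p + q - i) v)) ->
  (m + n = (p + q)%N%:Z -> S v) ->
  S (act (dhat_br (dE K m p) (dE K n q)) v).
Proof.
move=> sS SE Sv; rewrite (act_br rV); apply: subspaceD => //.
  apply: subspaceD => //.
    apply: subspace_sum => // i _; apply: subspaceZ => //; apply: SE.
    by left; rewrite -ltnS.
  apply: subspaceN => //; apply: subspace_sum => // i _; apply: subspaceZ => //.
  have -> : n + m = m + n by rewrite addrC.
  by rewrite [(q + p)%N]addnC; apply: SE; right; rewrite -ltnS.
rewrite /psi_mon; case: eqP => h; last first.
  by rewrite mulr0 scale0r; case: sS.
apply: subspaceZ => //; rewrite (act_kappa rV); apply: subspaceZ => //; apply: Sv; lia.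
Qed.

Lemma aE_vac m p : 0 <= m -> aE m p v0 = 0.
Proof.
move=> m0; have := Jfield_vac rV p m0; rewrite (JfieldE rV) => /eqP.
by rewrite oppr_eq0 => /eqP.
Qed.

(** The operator is moved to the right past one letter at a time; at the vacuum it either is a
    letter itself or gives 0. The commutators act on shorter words. *)
Lemma aE_words z v m p : words predT z v -> words predT (z + p%:Z - m) (aE m p v).
Proof.
move: v; apply: lspan_min.
  have [W0 WD] := words_subspace act v0 predT (z + p%:Z - m).
  split=> [|a x y Wx Wy] /=; first by rewrite (lin0 (linr _)).
  by rewrite linr; exact: WD.
move=> _ [s [_ <-] ->]; elim: s m p {z} => [|[k l] s IH] m p /=.
  have [m0|m0] := ltP m 0.
    by apply: (words_letter linr) => //; rewrite /wt big_nil; exact: words_v0.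
  by rewrite aE_vac //; case: (words_subspace act v0 predT (wt [::] + p%:Z - m)).
have sW z := words_subspace act v0 predT z.
rewrite act_comm; apply: subspaceD => //.
  rewrite wt_cons /=.
  have -> : (k + l + 1)%N%:Z + wt s + p%:Z - m =
            (wt s + p%:Z - m) + l%:Z - (- 1 - k%:Z) by lia.
  by apply: (words_letter linr) => //; lia.
apply: act_br_mem => // [i hi|h].
  have := IH (m + (- 1 - k%:Z) - i%:Z) (p + l - i)%N.
  by congr (words predT _ _); rewrite wt_cons /=; case: hi; lia.
have <- : wt s = wt ((k, l) :: s) + p%:Z - m by rewrite wt_cons /=; lia.
by apply: sub_lspan; exists s => //; split => //; exact: all_predT.
Qed.

Lemma words_span v : lspan (\bigcup_z words predT z) v.
Proof.
have sS := lspan_subspace (\bigcup_z words predT z).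
move: v; apply: (rep_gen rV) => //; first by apply: sub_lspan; exists 0 => //; exact: words_v0.
move=> x v Sv; move: x; apply: dhat_ind.
- case: (sS) => S0 SD; split => [|a x y Sx Sy] /=; first by rewrite (lin0 (rep_linl rV v)).
  by rewrite (rep_linl rV); exact: SD.
- move=> l m; move: v Sv; apply: lspan_min.
    case: (sS) => S0 SD; split => [|a x y Sx Sy] /=; first by rewrite (lin0 (linr _)).
    by rewrite linr; exact: SD.
  move=> v [z _ Wv]; rewrite -[act _ _]/(Jfield act l m v) (JfieldE rV).
  apply: subspaceN => //; apply: sub_lspan; exists (z + l%:Z - m) => //.
  exact: aE_words.
- by move=> a; rewrite (act_kappa rV); exact: subspaceZ.
Qed.

Let gf := rep_fields rV.

(** The condition on a field [B] of conformal weight [beta] that lets [B] replace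
    a letter of a word of weight [z], once all smaller weights are settled. *)
Definition wfield (P : pred nat) (z beta : int) (B : int -> V -> V) :=
  (forall k v y, words predT y v -> words predT (y + beta - k - 1) (B k v)) /\
  (forall k v y, k < 0 -> y < z -> y + beta - k - 1 = z -> words predT y v ->
     words P z (B k v)).

Lemma iter_derf_aE i l n : exists u, forall v,
  iter i (@derf K V) (Jfield act l) n v = u *: aE (n - i%:Z) l v.
Proof.
elim: i n => [|i IH] n /=.
  by exists (-1) => v; rewrite (JfieldE rV) scaleN1r subr0.
have [u hu] := IH (n - 1); exists (- (n%:~R * u)) => v.
rewrite /derf hu scalerA scaleNr; congr (- (_ *: aE _ _ _)); lia.
Qed.

(** [B] is the nested normally ordered product of the letters. The condition survives in both halves
    of a normally ordered product: where the new letter stands outside, it acts on a vector of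
    weight below [z]; where it acts first, the mode of the inner field has index [k - 1 - j < 0], so
    the induction applies. *)
Lemma word_field (P : pred nat) z s :
  (forall y, y < z -> words predT y `<=` words P y) -> all (fun p => P p.2) s ->
  exists B u, [/\ vfield (Jfield act) B, B (-1) v0 = u *: word s, u != 0
                & wfield P z (wt s) B].
Proof.
move=> Pz; elim: s => [_|[i l] s IH] /=.
  exists (@idf K V), 1; split; rewrite ?oner_eq0 ?scale1r //; first exact: vf_id.
  split=> k v y; rewrite /idf /wt big_nil; case: eqP => [->|_] /=.
  - by have -> : y + 0 - -1 - 1 = y by lia.
  - by case: (words_subspace act v0 predT (y + 0 - k - 1)).
  - by move=> *; lia.
  - by case: (words_subspace act v0 P z).
case/andP=> Pl /IH {IH} [B [u [vB Bv u0 [B1 B2]]]].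
have ga := good_iter_derf (gf_T gf) i (gf_good gf l); have gB := vfield_good gf vB.
have n1 : (-1 : int) < 0 by [].
have [u' u'0 hu'] := iter_derfE i (Jfield act l) n1.
exists (nop (iter i (@derf K V) (Jfield act l)) B), (- (u' * u)); split.
- exact: vf_nop.
- rewrite (nop_vac ga gB) Bv (linZ (g_lin ga _)) hu' (JfieldE rV) /= !scalerN scaleNr.
  by rewrite scalerA mulrC.
- by rewrite oppr_eq0 mulf_neq0.
have nE k v (S : set V) : subspace S ->
    (forall j : nat, S (aE (-1 - (i + j)%N%:Z) l (B (k + j%:Z) v))) ->
    (forall j : nat, S (B (k - 1 - j%:Z) (aE (j%:Z - i%:Z) l v))) ->
    S (nop (iter i (@derf K V) (Jfield act l)) B k v).
  move=> sS S1 S2; rewrite /nop /nop2.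
  have [J hJ] := evsum_ev (nopt_evz v 0 k (g_lin ga) (g_lin gB) (g_trunc ga) (g_trunc gB)).
  rewrite (hJ J) //; apply: subspace_sum => // j _; rewrite /nopt; apply: subspaceD => //.
    have [w ->] := iter_derf_aE i l (0 + (-1 - j%:Z)); apply: subspaceZ => //.
    by have := S1 j; congr (S (aE _ _ _)); lia.
  have [w ->] := iter_derf_aE i l (0 + j%:Z); rewrite (linZ (g_lin gB _)).
  apply: subspaceZ => //; have := S2 j.
  by rewrite add0r; congr (S (B _ _)); lia.
split=> k v y; rewrite wt_cons /=.
  move=> Wv; apply: nE => [|j|j]; first exact: words_subspace.
    have := aE_words (-1 - (i + j)%N%:Z) l (B1 (k + j%:Z) _ _ Wv).
    by congr (words predT _ _); lia.
  have := B1 (k - 1 - j%:Z) _ _ (aE_words (j%:Z - i%:Z) l Wv).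
  by congr (words predT _ _); lia.
move=> k0 yz hz Wv; apply: nE => [|j|j]; first exact: words_subspace.
  set w := B _ v; have : words predT (z - l%:Z - (i + j)%N%:Z - 1) w.
    by have := B1 (k + j%:Z) _ _ Wv; congr (words predT _ _); lia.
  move/Pz => Pw; have := words_letter linr (m := -1 - (i + j)%N%:Z) _ Pl (Pw _).
  by move=> h; have := h ltac:(lia) ltac:(lia); congr (words P _ _); lia.
(* The intermediate weight is [z - (wt s - k + j)], which is below [z] because [k < 0]. *)
have := wt_ge0 s => s0.
by apply: (B2 _ _ (y + l%:Z - (j%:Z - i%:Z))); [lia..|exact: aE_words].
Qed.

Lemma state_field_words (P : pred nat) z beta b :
  (forall y, y < z -> words predT y `<=` words P y) -> words P beta b ->
  wfield P z beta (state_field gf b).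
Proof.
move=> Pz; have sl n v := state_field_linear gf n v.
have sW Q y := words_subspace act v0 Q y.
move: b; apply: lspan_min.
  split=> [|a x y [x1 x2] [y1 y2]]; split => k v y' /=.
  - by move=> _; rewrite (lin0 (sl _ _)); case: (sW predT (y' + beta - k - 1)).
  - by move=> *; rewrite (lin0 (sl _ _)); case: (sW P z).
  - move=> Wv; rewrite sl; case: (sW predT (y' + beta - k - 1)) => _; apply; auto.
  - move=> k0 yz hz Wv; rewrite sl; case: (sW P z) => _; apply; eauto.
move=> _ [s [Ps <-] ->].
have [B [u [vB Bv u0 [B1 B2]]]] := word_field Pz Ps.
have -> : state_field gf (word s) = fun k v => u^-1 *: B k v.
  apply/funext => k; apply/funext => v; rewrite -(state_fieldE gf vB) Bv (linZ (sl _ _)).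
  by rewrite scalerA mulVf // scale1r.
split=> k v y; first by move=> Wv; apply: subspaceZ => //; exact: B1.
by move=> *; apply: subspaceZ => //; apply: B2; eauto.
Qed.

(** The operator [aE m l] is a mode of the field of the state [aE (-1) l v0]. Once this state is a
    combination of words in [P], the letter can be traded for them, even when [l] is outside [P]. *)
Lemma words_subst (P : pred nat) z l m v y :
  (forall y, y < z -> words predT y `<=` words P y) ->
  words P (l.+1)%:Z (aE (-1) l v0) -> m < 0 -> y < z -> y + l%:Z - m = z ->
  words predT y v -> words P z (aE m l v).
Proof.
move=> Pz Pl m0 yz hz Wv.
have [_ /(_ m v y m0 yz _ Wv)] := state_field_words Pz Pl.
have -> : state_field gf (aE (-1) l v0) m v = aE m l v :> V.
  have sl := state_field_linear gf m v.
  have := state_field_gen gf l; rewrite (JfieldE rV) => /(congr1 (fun f => f m v)).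
  by rewrite (linN sl) (JfieldE rV) => /oppr_inj.
by apply; lia.
Qed.

(** For [m < 0] the coefficient [2 m - l] is never 0, so the commutator with [t (d/dt)^2], which
    kills the vacuum, reaches the order [l + 1] from the order [l]. *)
Lemma act_br12 (m : int) l v : m < 0 ->
  act (dhat_br (dE K 1 2) (dE K m l)) v =
  (2 * m%:~R - l%:R) *: aE m l.+1 v + (m%:~R * (m - 1)%:~R) *: aE (m - 1) l v.
Proof.
move=> m0; rewrite (act_br rV).
have -> : psi_mon K (1, 2) (m, l) = 0.
  by rewrite /psi_mon; case: eqP => h; [lia|rewrite mulr0].
rewrite scale0r addr0 !big_ord_recl big_ord0 /= /bump /=.
have -> : \sum_(i < l) ('C(l, 1 + i)%:R * zffact K 1 (1 + i)) *:
    act (dmon K (m + 1 - (1 + i)%N%:Z) (l + 2 - (1 + i)), 0) v = l%:R *: aE m l.+1 v.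
  case: l => [|l]; first by rewrite big_ord0 scale0r.
  rewrite big_ord_recl big1 ?addr0 => [|i _]; last first.
    by rewrite /zffact !big_ord_recl /= subrr mul0r mulr0 mulr0 scale0r.
  rewrite addn0 bin1 /zffact big_ord_recl big_ord0 !mulr1 /=.
  congr (_ *: act (dmon K _ _, 0) _); lia.
rewrite /zffact !big_ord_recl !big_ord0 /= !bin0 !mul1r !mulr1 !addr0 !scale1r.
rewrite [1 + m]addrC.
have -> : (2 + l - 0 = l + 2 - 0)%N by lia.
set x := act (dmon K (m + 1) _, 0) v.
have -> : (dmon K (m + 1 - (1 + 0)%N%:Z) (2 + l - (1 + 0)), 0) = dE K m l.+1.
  by congr (dmon K _ _, _); lia.
have -> : (dmon K (m + 1 - (1 + (1 + 0))%N%:Z) (2 + l - (1 + (1 + 0))), 0) = dE K (m - 1) l.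
  by congr (dmon K _ _, _); lia.
rewrite bin1 /bump /= scalerBl opprD addrACA subrr add0r.
by rewrite addrAC.
Qed.

Section Decoupling.
Variable N : nat.
Let P : pred nat := fun l => (l < N)%N.
Hypothesis HN : words P N.+1%:Z (aE (-1) N v0).

Lemma words_raise z s : (forall y, y < z -> words predT y `<=` words P y) ->
  all (fun p => P p.2) s -> wt s + 1 = z -> words P z (aE 1 2 (word s)).
Proof.
move=> Pz; case: s => [|[k l] s] /=.
  by move=> *; rewrite aE_vac //; case: (words_subspace act v0 P z).
case/andP=> Pl Ps; rewrite wt_cons /= => hz.
have Ws : words predT (wt s) (word s).
  by apply: sub_lspan; exists s => //; split => //; exact: all_predT.
have sW := words_subspace act v0 P.
rewrite act_comm act_br12; last by lia.
apply: subspaceD => //.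
  have -> : z = (wt s + 1) + l%:Z - (-1 - k%:Z) by lia.
  apply: (words_letter linr) => //; first by lia.
  apply: (Pz _ _); first by lia.
  by have := aE_words 1 2 Ws; congr (words predT _ _); lia.
apply: subspaceD => //; apply: subspaceZ => //; last first.
  have -> : z = wt s + l%:Z - (-1 - k%:Z - 1) by lia.
  apply: (words_letter linr) => //; first by lia.
  by apply: (Pz _ _ _ Ws); lia.
have [lN|lN] := ltnP l.+1 N.
  have -> : z = wt s + l.+1%:Z - (-1 - k%:Z) by lia.
  apply: (words_letter linr) => //; first by lia.
  by apply: (Pz _ _ _ Ws); lia.
(* Raising leaves [P] only from the order [N - 1], and then lands on the order [N], where [HN]
   applies. *)
have eN : l.+1 = N by move: Pl; rewrite /P; lia.
by rewrite eN; apply: (words_subst Pz HN _ _ _ Ws); lia.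
Qed.

(** By induction on the weight, the only generator new in weight [z] is the one of order [z - 1]: it
    lies in [P], or is given by [HN], or arises by raising the generator of order [z - 2]. The first
    letter of any word of weight [z] has order below [z], so [words_subst] finishes. *)
Lemma words_all z : words predT z `<=` words P z.
Proof.
have [z0|] := ltP z 0.
  by move=> v /(words_lt0 z0) ->; case: (words_subspace act v0 P z).
case: z => // z _; elim/ltn_ind: z => z IH.
have {IH} Pz y : y < z%:Z -> words predT y `<=` words P y.
  have [y0 _|] := ltP y 0.
    by move=> v /(words_lt0 y0) ->; case: (words_subspace act v0 P y).
  by case: y => // y _ yz; apply: IH; lia.
have sW := words_subspace act v0 P.
have Sl l : (l < z)%N -> words P l.+1%:Z (aE (-1) l v0).
  have Wl : words predT l.+1%:Z (aE (-1) l v0).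
    by have := aE_words (-1) l (words_v0 act v0 predT); congr (words predT _ _); lia.
  rewrite leq_eqVlt => /orP[/eqP lz|lz]; last by apply: (Pz _ _ _ Wl); lia.
  have [lN|] := ltnP l N.
    have := words_letter linr (m := -1) isT (lN : P l) (words_v0 act v0 P).
    by congr (words P _ _); lia.
  rewrite leq_eqVlt => /orP[/eqP <- //|]; case: l lz {Wl} => // l lz Nl.
  have Wl : words predT l.+1%:Z (aE (-1) l v0).
    by have := aE_words (-1) l (words_v0 act v0 predT); congr (words predT _ _); lia.
  have Pl : words P l.+1%:Z (aE (-1) l v0) by apply: (Pz _ _ _ Wl); lia.
  have : words P z%:Z (aE 1 2 (aE (-1) l v0)).
    move: {Wl} (aE (-1) l v0) Pl; apply: lspan_min.
      case: (sW z%:Z) => S0 SD; split=> [|a x y Sx Sy] /=.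
        by rewrite (lin0 (linr _)).
      by rewrite linr; exact: SD.
    by move=> _ [s [Ps sl] ->]; apply: words_raise => //; lia.
  rewrite act_comm aE_vac // (lin0 (linr _)) add0r act_br12 // => h.
  have h2 : words P z%:Z (aE (-1 - 1) l v0).
    by apply: (words_subst Pz Pl _ _ _ (words_v0 act v0 predT)); lia.
  rewrite lz; have nz : (2 * (-1)%:~R - l%:R : K) != 0.
    have -> : (2 * (-1)%:~R - l%:R : K) = - (l.+2%:R).
      by rewrite -(addn2 l) natrD; ring.
    by rewrite oppr_eq0 pnatr_eq0.
  rewrite -[aE (-1) l.+1 v0](scalerK nz); apply: subspaceZ => //.
  rewrite -[X in words P _ X](addrK (((-1)%:~R * (-1 - 1)%:~R) *: aE (-1 - 1) l v0)).
  by apply: subspaceD => //; apply: subspaceN => //; exact: subspaceZ.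
apply: lspan_min => // _ [[|[k l] s] [_ hz] ->].
  by rewrite -hz /wt big_nil; exact: words_v0.
rewrite wt_cons /= in hz; have s0 := wt_ge0 s.
apply: (words_subst Pz (Sl l _) (y := wt s)); try by rewrite /=; lia.
by apply: sub_lspan; exists s => //; split => //; exact: all_predT.
Qed.

Lemma iter_transl k l : exists2 u : K, u != 0 &
  iter k (transl act) (Jfield act l (-1) v0) = u *: aE (-1 - k%:Z) l v0.
Proof.
elim: k => [|k [u u0 IH]] /=.
  exists (-1); first by rewrite oppr_eq0 oner_eq0.
  by rewrite (JfieldE rV) subr0 scaleN1r.
exists (u * - (-1 - k%:Z)%:~R).
  by rewrite mulf_neq0 // oppr_eq0 intr_eq0; lia.
have h := Jfield_transl rV l (-1 - k%:Z) v0.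
rewrite (gf_T0 gf) (lin0 (g_lin (gf_good gf l) _)) sub0r !(JfieldE rV) (linN (gf_T gf)) scalerN in h.
move/oppr_inj: h => h.
rewrite IH (linZ (gf_T gf)) h -scalerA; congr (_ *: _).
by rewrite scaleNr; congr (- (_ *: aE _ _ _)); lia.
Qed.

Lemma state_field_aE k l b : state_field gf (aE (-1 - k%:Z) l v0) (-1) b = aE (-1 - k%:Z) l b.
Proof.
have ga := good_iter_derf (gf_T gf) k (gf_good gf l).
(* Derivatives of a generating field enter [vfield] only through [nop]; normal ordering with the
   identity field recovers the derivative itself. *)
have vB : vfield (Jfield act) (nop (iter k (@derf K V) (Jfield act l)) (@idf K V)).
  exact/vf_nop/vf_id.
have := state_fieldE gf vB; have gi := good_idf v0 (gf_T gf).
rewrite (nop_vac ga gi) {1}/idf eqxx.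
have n1 : (-1 : int) < 0 by [].
have [u u0 hu] := iter_derfE k (Jfield act l) n1; rewrite hu.
move/(congr1 (fun f => f (-1) b)).
have -> : nop (iter k (@derf K V) (Jfield act l)) (@idf K V) (-1) b = u *: Jfield act l (-1 - k%:Z) b.
  rewrite -hu /nop /nop2 (@evsumE _ _ 1).
    by rewrite big_ord_recl big_ord0 /nopt /= addr0 /idf /= addr0.
  case=> // j _; rewrite /nopt /idf; case: eqP => [|_]; first by lia.
  by case: eqP => [|_]; [lia|rewrite (lin0 (g_lin ga _)) addr0].
have sl := state_field_linear gf (-1) b.
by rewrite (linZ sl) !(JfieldE rV) (linN sl) => /(scalerI u0)/oppr_inj.
Qed.

Lemma decoupled_strongly_generated :
  strongly_generated (reconstruct gf) [set Jfield act l (-1) v0 | l in [set l | (l < N)%N]].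
Proof.
apply/seteqP; split => // v _; set S := lspan _.
have sS : subspace S by exact: lspan_subspace.
suff wS s : all (fun p => P p.2) s -> S (word s).
  have := words_span v; apply: lspan_min => // w [z _ /words_all].
  by apply: lspan_min => // _ [s [Ps _] ->]; exact: wS.
suff H : all (fun p => P p.2) s -> exists2 u : K, u != 0 &
    exists2 t, (forall p, p \in t -> exists2 l, P l & Jfield act l (-1) v0 = p.2) &
      wick (reconstruct gf) t = u *: word s.
  move=> /H[u u0 [t tS tE]]; rewrite -[word s](scalerK u0) -tE.
  by apply: subspaceZ => //; apply: sub_lspan; exists t.
elim: s => [_|[k l] s IH /= /andP[Pl /IH [u u0 [t tS tE]]]].
  by exists 1; rewrite ?oner_eq0 //; exists [::]; rewrite //= scale1r.
have [w w0 hw] := iter_transl k l.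
exists (u * w); first by rewrite mulf_neq0.
exists ((k, Jfield act l (-1) v0) :: t).
  by move=> p; rewrite inE => /orP[/eqP -> /=|/tS //]; exists l.
have sl := state_field_linear gf (-1).
rewrite /= -/(wick _ _) tE hw (linZ (sl _)) state_field_aE (linZ (linr _)) scalerA.
by rewrite mulrC.
Qed.

End Decoupling.
End Rep.

(** * Linear maps and the polynomial Fock module of a Weyl algebra *)

Section LinearMaps.
Context (K : numFieldType) (U V W : lmodType K).

Lemma linear_id : linear (fun x : U => x).
Proof. by []. Qed.

Lemma linear_comp (f : V -> W) (g : U -> V) : linear f -> linear g -> linear (fun x => f (g x)).
Proof. by move=> lf lg a x y; rewrite lg lf. Qed.

Lemma linear_add (f g : U -> V) : linear f -> linear g -> linear (fun x => f x + g x).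
Proof. by move=> lf lg a x y; rewrite lf lg scalerDr addrACA. Qed.

Lemma linear_scale (b : K) (f : U -> V) : linear f -> linear (fun x => b *: f x).
Proof. by move=> lf a x y; rewrite lf scalerDr !scalerA mulrC. Qed.

Lemma linear_opp (f : U -> V) : linear f -> linear (fun x => - f x).
Proof. by move=> lf a x y; rewrite lf opprD scalerN. Qed.

Lemma linear_sub (f g : U -> V) : linear f -> linear g -> linear (fun x => f x - g x).
Proof. by move=> lf lg; apply/linear_add/linear_opp. Qed.

Lemma linear_zero : linear (fun _ : U => 0 : V).
Proof. by move=> a x y; rewrite scaler0 addr0. Qed.

Lemma linear_bigsum J (r : seq J) (f : J -> U -> V) : (forall j, linear (f j)) ->
  linear (fun x => \sum_(j <- r) f j x).
Proof.
move=> lf a x y; rewrite scaler_sumr -big_split /=; apply: eq_bigr => j _.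
exact: lf.
Qed.

Lemma linear_eq_subspace (f g : U -> V) : linear f -> linear g ->
  subspace [set x | f x = g x].
Proof.
by move=> lf lg; split=> [|a x y e1 e2] /=; [rewrite !lin0|rewrite lf lg e1 e2].
Qed.

End LinearMaps.

(** The monoid [M] of monomials is kept abstract because unification on
    [{cmonom I}] itself unfolds finite maps and diverges. *)
Section Polynomials.
Context (K : numFieldType) (I : choiceType) (M : conomType).
Context (U : I -> M) (ex : I -> M -> nat) (dv : I -> M -> M) (deg : M -> nat).
Local Notation "m ** k" := (mmul m k) (at level 40).
Hypotheses (ex1 : forall i, ex i mone = 0%N)
  (exU : forall i j m, ex i (U j ** m) = ((i == j) + ex i m)%N)
  (dvU : forall i m, dv i (U i ** m) = m)
  (dvUC : forall i j m, i != j -> dv i (U j ** m) = U j ** dv i m)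
  (Udv : forall i m, (0 < ex i m)%N -> U i ** dv i m = m)
  (degU : forall i m, deg (U i ** m) = (deg m).+1)
  (ex_gt0 : forall m, m != mone -> exists i, (0 < ex i m)%N).

Notation A := {malg K[M]}.

Definition mono (m : M) : A := << m >>.
Definition malgX (i : I) : A := mono (U i).
Definition partial (i : I) (f : A) : A :=
  \sum_(m <- msupp f) (f@_m * (ex i m)%:R) *: mono (dv i m).

Lemma coef_mono (m k : M) : (mono m)@_k = (m == k)%:R.
Proof. exact: mcoeffU1. Qed.

Lemma monoM m k : mono m * mono k = mono (m ** k).
Proof. by rewrite /mono malgM_def fgmulUU mulr1. Qed.

Lemma malg_ind (S : set A) : subspace S -> (forall m, S (mono m)) -> forall f, S f.
Proof.
move=> sS Sm f; rewrite [f]monalgE; apply: subspace_sum => // m _.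
have -> : << f@_m *g m >> = f@_m *: mono m.
  by apply/malgP => k; rewrite mcoeffZ coef_mono mcoeffU mulr_natr.
exact: subspaceZ.
Qed.

Lemma partialEw i (d : {fset M}) f : (msupp f `<=` d)%fset ->
  partial i f = \sum_(m <- d) (f@_m * (ex i m)%:R) *: mono (dv i m).
Proof.
move=> fd; rewrite /partial; apply: big_fset_incl => // m _ mf.
by rewrite mcoeff_outdom // mul0r scale0r.
Qed.

Lemma partial_linear i : linear (partial i).
Proof.
move=> a f g; pose d := (msupp f `|` msupp g `|` msupp (a *: f + g))%fset.
rewrite !(@partialEw i d) ?fsubsetUr //; last first.
- by rewrite /d -fsetUA fsubsetUl.
- by rewrite /d [(msupp f `|` _)%fset]fsetUC -fsetUA fsubsetUl.
rewrite scaler_sumr -big_split /=; apply: eq_bigr => m _.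
by rewrite mcoeffD mcoeffZ mulrDl scalerDl scalerA mulrA.
Qed.

Lemma malgX_linear j : linear (fun f : A => malgX j * f).
Proof. by move=> a g h; rewrite mulrDr -scalerAr. Qed.

Lemma coef_linear m : linear (fun f : A => f@_m : K^o).
Proof. by move=> a f g; rewrite mcoeffD mcoeffZ. Qed.

Lemma partial_mono i m : partial i (mono m) = (ex i m)%:R *: mono (dv i m).
Proof.
rewrite (@partialEw i [fset m]%fset); last by rewrite msuppU1.
by rewrite big_seq_fset1 coef_mono eqxx mul1r.
Qed.

Lemma partial1 i : partial i 1 = 0.
Proof. by rewrite [LHS](partial_mono i mone) ex1 scale0r. Qed.

Lemma partial_X i j f : partial i (malgX j * f) = (i == j)%:R *: f + malgX j * partial i f.
Proof.
have lX := malgX_linear j; have lp := partial_linear i.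
move: f; apply: malg_ind => [|m].
  apply: linear_eq_subspace; first exact: (linear_comp lp lX).
  apply: linear_add; last exact: (linear_comp lX lp).
  exact: (linear_scale _ (@linear_id _ _)).
rewrite /= /malgX monoM !partial_mono exU -scalerAr monoM natrD scalerDl.
have [->|ij] := eqVneq i j; last by rewrite !scale0r !add0r dvUC.
rewrite dvU; congr (_ + _).
have [->|mi] := eqVneq (ex j m) 0%N; first by rewrite !scale0r.
by rewrite Udv // lt0n.
Qed.

Lemma partial_gen (S : set A) : subspace S -> S 1 -> (forall i f, S f -> S (malgX i * f)) ->
  forall f, S f.
Proof.
move=> sS S1 SX; apply: malg_ind => // m.
elim: {m}(deg m) {-2}m (leqnn (deg m)) => [|d IH] m md.
  have [->//|/ex_gt0[i /Udv mi]] := eqVneq m mone.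
  by move: md; rewrite -mi degU.
have [->//|/ex_gt0[i /Udv mi]] := eqVneq m mone.
by rewrite -mi -monoM; apply/SX/IH; rewrite -ltnS -(degU i) mi.
Qed.

Lemma partial_coef i f m : (partial i f)@_m = (ex i m).+1%:R * f@_(U i ** m).
Proof.
move: f; apply: malg_ind => [|k].
  apply: (@linear_eq_subspace _ _ K^o).
    exact: (linear_comp (coef_linear m) (partial_linear i)).
  exact: (linear_scale _ (coef_linear _)).
rewrite /= partial_mono mcoeffZ !coef_mono.
have [->|ki] := eqVneq k (U i ** m); first by rewrite exU eqxx dvU eqxx.
rewrite mulr0; case: eqP => [e|_]; last by rewrite mulr0.
have [->|k0] := eqVneq (ex i k) 0%N; first by rewrite mul0r.
by case/eqP: ki; rewrite -e Udv // lt0n.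
Qed.

(** A coefficient at a monomial other than 1 reappears in some partial derivative, times a positive
    exponent, which is invertible in characteristic 0. *)
Lemma partial_ker f : (forall i, partial i f = 0) -> f = f@_mone *: 1.
Proof.
move=> f0; apply/malgP => m; rewrite mcoeffZ mcoeff1.
have [->|m1] := eqVneq m mone; first by rewrite mulr1.
rewrite mulr0; have [i mi] := ex_gt0 m1.
have := congr1 (mcoeff (dv i m)) (f0 i).
rewrite partial_coef mcoeff0 Udv // => /eqP.
by rewrite mulf_eq0 pnatr_eq0 => /eqP.
Qed.

Lemma coef1_X i f : (malgX i * f)@_mone = 0.
Proof.
move: f; apply: malg_ind => [|m].
  apply: (@linear_eq_subspace _ _ K^o).
    exact: (linear_comp (coef_linear _) (malgX_linear i)).
  exact: linear_zero.
rewrite /= /malgX monoM coef_mono; case: eqP => // /(congr1 (ex i)).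
by rewrite exU ex1 eqxx.
Qed.

Lemma coef1_1 : (1 : A)@_mone = 1.
Proof. by rewrite mcoeff1 eqxx. Qed.

End Polynomials.

(** The Fock module of the Weyl algebra with generators indexed by [I]; [wcst] is
    the constant term. *)
Record weyl_module (K : numFieldType) (I : choiceType) (A : comAlgType K) := WeylModule {
  wvar : I -> A;
  wder : I -> A -> A;
  wcst : A -> K;
  wder_linear : forall i, linear (wder i);
  wder1 : forall i, wder i 1 = 0;
  wder_var : forall i j f, wder i (wvar j * f) = (i == j)%:R *: f + wvar j * wder i f;
  wvar_ind : forall S : set A, subspace S -> S 1 ->
    (forall i f, S f -> S (wvar i * f)) -> forall f, S f;
  wder_ker : forall f, (forall i, wder i f = 0) -> f = wcst f *: 1;
  wcst_linear : linear (wcst : A -> K^o);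
  wcst_var : forall i f, wcst (wvar i * f) = 0;
  wcst1 : wcst 1 = 1
}.

Section WeylExists.
Context (K : numFieldType) (I : choiceType).
Notation M := {cmonom I}.

Let ex i (m : M) := m i.
Let dv i (m : M) : M := divcm m (ucm i).
Local Notation "m ** k" := (mmul (m : M) (k : M)) (at level 40).

Let exU i j m : ex i (ucm j ** m) = ((i == j) + ex i m)%N.
Proof. by rewrite /ex (mulcmE (ucm j) m i) (ucmE j i) eq_sym. Qed.

Let exdv i j m : ex i (dv j m) = (ex i m - (i == j))%N.
Proof. by rewrite /ex (divcmE m (ucm j) i) (ucmE j i) eq_sym. Qed.

Let exP m k : (forall i, ex i m = ex i k) -> m = k.
Proof. by move=> h; apply/eqP/cmP. Qed.

Lemma weyl_exists : exists A : comAlgType K, inhabited (weyl_module I A).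
Proof.
have ex1 i : ex i mone = 0%N by exact: onecmE.
have dvU i m : dv i (ucm i ** m) = m.
  by apply: exP => j; rewrite exdv exU addKn.
have dvUC i j m : i != j -> dv i (ucm j ** m) = ucm j ** dv i m.
  move=> ij; apply: exP => k; rewrite exdv !exU exdv.
  have [->|_] := eqVneq k i; last by rewrite !subn0.
  by rewrite (negPf ij) !add0n.
have Udv i m : (0 < ex i m)%N -> ucm i ** dv i m = m.
  move=> mi; apply: exP => k; rewrite exU exdv.
  by have [->|_] := eqVneq k i; [rewrite subnKC|rewrite add0n subn0].
have degU i (m : M) : mdeg (ucm i ** m) = (mdeg m).+1.
  by rewrite mdegM mdegU.
have ex_gt0 m : m != mone -> exists i, (0 < ex i m)%N.
  move=> m1; apply: contrapT => h; case/eqP: m1; apply: exP => i; rewrite ex1.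
  by have [//|mi] := posnP (ex i m); case: h; exists i.
exists {malg K[M]}; split.
refine (@WeylModule K I {malg K[M]} (malgX K (@ucm I)) (@partial K I M ex dv) (fun f => f@_(mone:M)) _ _ _ _ _ _ _ _).
- exact: partial_linear.
- exact: partial1.
- exact: partial_X.
- exact: (partial_gen Udv degU ex_gt0).
- exact: partial_ker.
- exact: coef_linear.
- exact: coef1_X.
- exact: coef1_1.
Qed.

End WeylExists.

(** * Falling factorial identities *)

Section FallingFactorials.
Context (K : numFieldType).
Notation zff := (zffact K).

Lemma zff0 m : zff m 0 = 1. Proof. by rewrite /zffact big_ord0. Qed.

Lemma zff_small (j i : nat) : (j < i)%N -> zff j i = 0.
Proof.
move=> ji; rewrite /zffact (bigD1 (Ordinal ji)) //=.
by rewrite subrr mul0r.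
Qed.

Lemma zff_add m i j : zff m (i + j) = zff m i * zff (m - i%:Z) j.
Proof.
elim: j => [|j IH]; first by rewrite addn0 zff0 mulr1.
rewrite addnS !zffactS IH -mulrA; congr (_ * (_ * _%:~R)); lia.
Qed.

Lemma zff_vandermonde m n p :
  \sum_(i < p.+1) 'C(p, i)%:R * zff m i * zff n (p - i) = zff (m + n) p.
Proof.
elim: p => [|p IH].
  by rewrite big_ord_recl big_ord0 bin0 !zff0 !mulr1 addr0.
rewrite zffactS -IH mulr_suml.
have e (i : 'I_p.+1) : 'C(p, i)%:R * zff m i * zff n (p - i) * (m + n - p%:Z)%:~R =
    'C(p, i)%:R * zff m i * zff n (p.+1 - i) + 'C(p, i)%:R * zff m i.+1 * zff n (p - i).
  have ip : (i <= p)%N by rewrite -ltnS.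
  rewrite subSn // !zffactS.
  have -> : (m + n - p%:Z)%:~R = (n - (p - i)%N%:Z)%:~R + (m - i%:Z)%:~R :> K.
    by rewrite -intrD; congr (_%:~R); lia.
  by rewrite mulrDr -!mulrA; congr (_ * (_ * _) + _ * (_ * _)); rewrite mulrC.
rewrite (eq_bigr _ (fun i _ => e i)) big_split /=.
rewrite big_ord_recl [X in _ = X + _]big_ord_recl /= !bin0 -addrA; congr (_ + _).
rewrite [X in _ = _ + X]big_ord_recr [X in X = _]big_ord_recr /= /bump /=.
rewrite [in LHS]add1n binn subnn.
rewrite addrA -big_split /= ; congr (_ + _).
  apply: eq_bigr => i _; rewrite add1n binS natrD !mulrDl; congr (_ + _).
by rewrite binn subnn.
Qed.

(** Both sides are the factor by which [(d/dt)^p t^n (d/dt)^q] acts on [t^k]; on the left the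
    Leibniz rule has been expanded. *)
Lemma zff_dmul n p q k :
  \sum_(i < p.+1) 'C(p, i)%:R * zff n i * zff k (p + q - i) = zff k q * zff (k + n - q%:Z) p.
Proof.
have -> : k + n - q%:Z = n + (k - q%:Z) by lia.
rewrite -zff_vandermonde mulr_sumr; apply: eq_bigr => i _.
have ip : (i <= p)%N by rewrite -ltnS.
have -> : (p + q - i)%N = (q + (p - i))%N by lia.
by rewrite zff_add mulrCA.
Qed.

Lemma zff_shift m i : zff (m + 1) i.+1 = zff m i.+1 + i.+1%:R * zff m i.
Proof. by rewrite -zffact_diff [RHS]addrC subrK. Qed.

Lemma zff_sum q (r : nat) : q.+1%:R * \sum_(j < r) zff j%:Z q = zff r%:Z q.+1.
Proof.
elim: r => [|r IH]; first by rewrite big_ord0 mulr0 zffact0.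
rewrite big_ord_recr mulrDr IH /=.
have -> : r.+1%:Z = r%:Z + 1 by lia.
by rewrite zff_shift.
Qed.

Lemma zff_sum_by_parts p q (r : nat) :
  q.+1%:R * \sum_(j < r) zff j%:Z q * zff (j%:Z - r%:Z) p.+1 =
  - (p.+1%:R * \sum_(j < r.+1) zff j%:Z q.+1 * zff (j%:Z - r.+1%:Z) p).
Proof.
rewrite big_ord_recl zffact0 mul0r add0r !mulr_sumr -sumrN.
apply/eqP; rewrite -subr_eq0 -sumrB; apply/eqP.
pose G (j : nat) := zff j%:Z q.+1 * zff (j%:Z - r%:Z) p.+1.
rewrite (eq_bigr (fun j : 'I_r => G j.+1 - G j)) => [|j _].
  rewrite -(big_mkord xpredT (fun j => G j.+1 - G j)) telescope_sumr // /G.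
  by rewrite subrr !zffact0 mulr0 mul0r subr0.
rewrite /G lift0; set x : int := j%:Z.
have -> : j.+1%:Z = x + 1 by lia.
have -> : x + 1 - r.+1%:Z = x - r%:Z by lia.
have -> : x + 1 - r%:Z = (x - r%:Z) + 1 by lia.
rewrite !zff_shift; ring.
Qed.

(** The left side will arise as a sum of double contractions; the right side is [psi_mon] at
    [t^(p + r) (d/dt)^p] and [t^(q - r) (d/dt)^q]. Summation by parts passes from [(p + 1, q, r)] to
    [(p, q + 1, r + 1)]. *)
Lemma zff_residue p q (r : nat) : \sum_(j < r) zff j%:Z q * zff (j%:Z - r%:Z) p =
  (p`! * q`!)%:R / ((p + q).+1)`!%:R * (zff (p%:Z + r%:Z) q.+1 * zff (q%:Z - r%:Z) p).
Proof.
have f0 i : (i`!)%:R != 0 :> K by rewrite pnatr_eq0 -lt0n fact_gt0.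
have s0 i : (i.+1)%:R != 0 :> K by rewrite pnatr_eq0.
elim: p q r => [|p IH] q r.
  rewrite (eq_bigr (fun j : 'I_r => zff j%:Z q)) => [|j _]; last by rewrite zff0 mulr1.
  apply: (mulfI (s0 q)); rewrite zff_sum zff0 add0n add0r mulr1 fact0 mul1n factS natrM.
  by field; rewrite f0 nat1r s0.
apply: (mulfI (s0 q)); rewrite zff_sum_by_parts IH.
have -> : p%:Z + r.+1%:Z = p.+1%:Z + r%:Z by lia.
have -> : q.+1%:Z - r.+1%:Z = q%:Z - r%:Z by lia.
rewrite [zff _ q.+2]zffactS [zff _ p.+1]zffactS addSnnS addnS !factS !natrM.
have -> : (p.+1%:Z + r%:Z - q.+1%:Z)%:~R = - (q%:Z - r%:Z - p%:Z)%:~R :> K.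
  by rewrite -mulrNz; congr (_%:~R); lia.
by field; rewrite f0 -natrD nat1r s0 -natrD pnatr_eq0.
Qed.

End FallingFactorials.

(** * Weyl fields and their normally ordered quadratics *)

Section FockSpace.
Context (K : numFieldType) (n : nat) (A : comAlgType K).
Context (W : weyl_module ('I_n * int)%type A).
Notation zff := (zffact K).
Notation X := (wvar W).
Notation D := (wder W).
Notation cst := (wcst W).

Let lD v := wder_linear W v.

Lemma mul_linear (g : A) : linear (fun f : A => g * f).
Proof. by move=> a x y; rewrite mulrDr scalerAr. Qed.

(** The modes [fcr] and [fan] of the two Weyl fields, acting by multiplication or
    by derivation according to the sign of the index. *)
Definition fcr (i : 'I_n) (k : int) (f : A) : A :=
  if k < 0 then X (i, k) * f else - D (i, k) f.
Definition fan (i : 'I_n) (k : int) (f : A) : A :=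
  if k < 0 then D (i, k) f else X (i, k) * f.

Lemma fcr_linear i k : linear (fcr i k).
Proof.
by rewrite /fcr; case: (k < 0); [exact: mul_linear|exact: linear_opp].
Qed.

Lemma fan_linear i k : linear (fan i k).
Proof. by rewrite /fan; case: (k < 0); [exact: lD|exact: mul_linear]. Qed.

Lemma wderC u v f : D u (D v f) = D v (D u f).
Proof.
move: f; apply: (@wvar_ind _ _ _ W).
- by apply: linear_eq_subspace; exact: linear_comp.
- by rewrite !wder1 (lin0 (lD u)) (lin0 (lD v)).
- move=> w f /= h; rewrite !wder_var (linD (lD u)) (linD (lD v)) (linZ (lD u)) (linZ (lD v)) !wder_var h.
  by rewrite addrCA.
Qed.

Lemma fanC i k j l f : fan i k (fan j l f) = fan j l (fan i k f).
Proof.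
rewrite /fan; case: ifP => hk; case: ifP => hl; rewrite ?wder_var //.
- exact: wderC.
- by case: eqP => [[_ e]|_]; [by move: hk hl; rewrite e => ->|rewrite scale0r add0r].
- by case: eqP => [[_ e]|_]; [by move: hk hl; rewrite e => ->|rewrite scale0r add0r].
- by rewrite mulrCA.
Qed.

Lemma fcrC i k j l f : fcr i k (fcr j l f) = fcr j l (fcr i k f).
Proof.
rewrite /fcr; case: ifP => hk; case: ifP => hl; rewrite ?(linN (lD _)) ?wder_var ?mulrN //.
- by rewrite mulrCA.
- by case: eqP => [[_ e]|_]; [by move: hk hl; rewrite e => ->|rewrite scale0r add0r].
- by case: eqP => [[_ e]|_]; [by move: hk hl; rewrite e => ->|rewrite scale0r add0r].
- by rewrite wderC.
Qed.

Lemma fan_fcr i k j l f :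
  fan i k (fcr j l f) = fcr j l (fan i k f) + ((i, k) == (j, l))%:R *: f.
Proof.
rewrite /fan /fcr; case: ifP => hk; case: ifP => hl; rewrite ?(linN (lD _)) ?wder_var.
- by rewrite addrC.
- rewrite wderC; case: eqP => [[_ e]|_]; last by rewrite scale0r addr0.
  by move: hk hl; rewrite e => ->.
- rewrite mulrCA; case: eqP => [[_ e]|_]; last by rewrite scale0r addr0.
  by move: hk hl; rewrite e => ->.
- by rewrite opprD [_ == (j, l)]eq_sym addrAC addNr add0r mulrN.
Qed.

Definition nord i l k (f : A) : A :=
  if l < 0 then fcr i l (fan i k f) else fan i k (fcr i l f).

Lemma nord_linear i l k : linear (nord i l k).
Proof.
rewrite /nord; have ls := fcr_linear i l; have lp := fan_linear i k.
by case: (l < 0); exact: linear_comp.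
Qed.

Lemma nord_fcr i l k j m f :
  nord i l k (fcr j m f) = fcr j m (nord i l k f) + ((i, k) == (j, m))%:R *: fcr i l f.
Proof.
rewrite /nord; case: ifP => _; last by rewrite fcrC fan_fcr.
by rewrite fan_fcr (linD (fcr_linear _ _)) (linZ (fcr_linear _ _)) fcrC.
Qed.

Lemma nord_fan i l k j m f :
  nord i l k (fan j m f) = fan j m (nord i l k f) - ((i, l) == (j, m))%:R *: fan i k f.
Proof.
have e g : fcr i l (fan j m g) = fan j m (fcr i l g) - ((i, l) == (j, m))%:R *: g.
  by rewrite fan_fcr [(j, m) == _]eq_sym addrK.
rewrite /nord; case: ifP => _; first by rewrite fanC e.
by rewrite e (linB (fan_linear _ _)) (linZ (fan_linear _ _)) fanC.
Qed.

(** A bound on the indices of the variables in [f], which makes the infinite sums over modes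
    finite. *)
Definition tame (N : nat) (f : A) := forall i k, N%:Z <= `|k| -> D (i, k) f = 0.

Lemma tame_ex f : exists N, tame N f.
Proof.
move: f; apply: (@wvar_ind _ _ _ W).
- split=> [|a f g [N hN] [M hM]]; first by exists 0%N => i k _; rewrite (lin0 (lD _)).
  by exists (maxn N M) => i k h; rewrite lD hN ?hM ?scaler0 ?addr0 //; lia.
- by exists 0%N => i k _; rewrite wder1.
- move=> [j l] f [N hN]; exists (maxn N `|l|.+1) => i k h.
  rewrite wder_var hN ?mulr0 ?addr0; last by lia.
  by case: eqP => [[_ e]|_]; [lia|rewrite scale0r].
Qed.

Lemma tame_nord N f i l k : tame N f -> (0 <= l -> N%:Z <= `|l|) -> (l < 0 -> N%:Z <= `|k| /\ k < 0) ->
  nord i l k f = 0.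
Proof.
move=> h h1 h2; rewrite /nord; case: ifPn => hl.
  by have [kN k0] := h2 hl; rewrite [fan i k f]/fan k0 h // (lin0 (fcr_linear _ _)).
rewrite [fcr i l f]/fcr (negPf hl) h ?oppr0 ?(lin0 (fan_linear _ _)) //.
by apply: h1; lia.
Qed.

(** The term of index [k] of the quadratic operator attached to [t^m (d/dt)^p]. *)
Definition opt m p i (f : A) (k : int) : A := zff k p *: nord i (k + m - p%:Z) k f.

(** The integers are enumerated in pairs [j], [-1 - j], so that a sum over all modes becomes an
    [evsum]. *)
Definition op m p (f : A) : A :=
  \sum_(i < n) evsum (fun j => opt m p i f j%:Z + opt m p i f (-1 - j%:Z)).

Definition fop M m p (f : A) : A :=
  \sum_(i < n) \sum_(j < M) (opt m p i f j%:Z + opt m p i f (-1 - j%:Z)).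

Lemma opE m p f N M : tame N f -> (N + `|m| + p <= M)%N -> op m p f = fop M m p f.
Proof.
move=> hf hM; apply: eq_bigr => i _; apply: evsumE => j jM.
rewrite /opt !(tame_nord i hf) ?scaler0 ?addr0 //; lia.
Qed.

Lemma op_ev m p f : exists N, forall M, (N <= M)%N -> op m p f = fop M m p f.
Proof. by have [N hN] := tame_ex f; exists (N + `|m| + p)%N => M; exact: opE. Qed.

End FockSpace.

Lemma sumZ_delta (V : zmodType) M (k : int) (g : int -> V) : (`|k| < M%:Z) ->
  (forall x, x != k -> g x = 0) -> \sum_(j < M) (g j%:Z + g (-1 - j%:Z)) = g k.
Proof.
move=> kM g0; rewrite -(big_mkord xpredT (fun j => g j%:Z + g (-1 - j%:Z))) /=.
have kl : (absz (if (0 <= k)%R then k else (-1 - k)%R) < M)%N by case: (leP 0 k) => h; lia.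
rewrite big_mkord (bigD1 (Ordinal kl)) //= [X in _ + X]big1 ?addr0 => [|j jk]; last first.
  by rewrite (g0 j%:Z) ?(g0 (-1 - j%:Z)) ?addr0 //; apply/eqP => e; case/eqP: jk; apply/val_inj;
    rewrite /=; case: (leP 0 k) => h; lia.
have [k0|k0] := leP 0 k.
  by rewrite [g (-1 - _)]g0 ?addr0; [congr g; lia|apply/eqP; lia].
by rewrite g0 ?add0r; [congr g; lia|apply/eqP; lia].
Qed.

(** * The Fock representation of central charge [-n] *)

Section FockRepresentation.
Context (K : numFieldType) (n : nat) (A : comAlgType K).
Context (W : weyl_module ('I_n * int)%type A).
Notation zff := (zffact K).
Notation X := (wvar W).
Notation D := (wder W).
Notation cst := (wcst W).
Notation fcr := (fcr W).
Notation fan := (fan W).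
Notation op := (op W).
Notation fop := (fop W).

Lemma opt_linear m p i k : linear (fun f => opt W m p i f k).
Proof. exact/linear_scale/nord_linear. Qed.

Lemma fop_linear M m p : linear (fop M m p).
Proof.
by apply: linear_bigsum => i; apply: linear_bigsum => j; apply: linear_add; exact: opt_linear.
Qed.

Lemma op_linear m p : linear (op m p).
Proof.
move=> a f g; have [N1 h1] := op_ev W m p f; have [N2 h2] := op_ev W m p g.
have [N3 h3] := op_ev W m p (a *: f + g).
rewrite (h1 (N1 + N2 + N3)%N) ?(h2 (N1 + N2 + N3)%N) ?(h3 (N1 + N2 + N3)%N); try lia.
exact: fop_linear.
Qed.

(** [Z] acts on the modes of the Weyl fields as the operator
    [t^k |-> sigma k * t^(k + s)]. *)
Definition has_symbol (Z : A -> A) (s : int) (sigma : int -> K) :=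
  [/\ linear Z,
      forall i k f, Z (fcr i k f) = fcr i k (Z f) + sigma k *: fcr i (k + s) f
    & forall i k f, Z (fan i k f) = fan i k (Z f) - sigma (k - s) *: fan i (k - s) f].

(** Normal ordering changes each term by a scalar only, so it does not affect commutators with a
    single mode; such a mode contracts with exactly one term of the sum. *)
Lemma op_symbol m p : has_symbol (op m p) (m - p%:Z) (fun k => zff k p).
Proof.
split; first exact: op_linear.
- move=> j k f; have [N1 h1] := op_ev W m p f; have [N2 h2] := op_ev W m p (fcr j k f).
  pose M := (N1 + N2 + `|k|.+1)%N; rewrite (h1 M) ?(h2 M) /M; try lia.
  have lp := fcr_linear W j k.
  pose g i x := zff x p *: (((i, x) == (j, k))%:R *: fcr i (x + m - p%:Z) f).
  have e i x : opt W m p i (fcr j k f) x = fcr j k (opt W m p i f x) + g i x.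
    by rewrite /opt nord_fcr scalerDr (linZ lp).
  transitivity (\sum_(i < n) (fcr j k (\sum_(x < M) (opt W m p i f x%:Z + opt W m p i f (-1 - x%:Z)))
       + \sum_(x < M) (g i x%:Z + g i (-1 - x%:Z)))).
    apply: eq_bigr => i _; rewrite (lin_sum lp) -big_split /=; apply: eq_bigr => x _.
    by rewrite !e (linD lp) addrACA.
  rewrite big_split /= -(lin_sum lp); congr (_ + _).
  rewrite (bigD1 j) //= [X in _ + X]big1 ?addr0 => [|i ij]; last first.
    rewrite big1 // => x _; rewrite /g !xpair_eqE (negPf ij) /=.
    by rewrite !scale0r !scaler0 addr0.
  rewrite (@sumZ_delta _ _ k); first last.
  + by move=> x xk; rewrite /g xpair_eqE (negPf xk) andbF scale0r scaler0.
  + rewrite /M; lia.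
  by rewrite /g eqxx scale1r addrA.
- move=> j k f; have [N1 h1] := op_ev W m p f; have [N2 h2] := op_ev W m p (fan j k f).
  pose y := k - (m - p%:Z).
  pose M := (N1 + N2 + `|y|.+1)%N; rewrite (h1 M) ?(h2 M) /M; try lia.
  have lp := fan_linear W j k.
  pose g i x := zff x p *: (((i, x + m - p%:Z) == (j, k))%:R *: fan i x f).
  have e i x : opt W m p i (fan j k f) x = fan j k (opt W m p i f x) - g i x.
    by rewrite /opt nord_fan scalerBr (linZ lp).
  transitivity (\sum_(i < n) (fan j k (\sum_(x < M) (opt W m p i f x%:Z + opt W m p i f (-1 - x%:Z)))
       - \sum_(x < M) (g i x%:Z + g i (-1 - x%:Z)))).
    apply: eq_bigr => i _; rewrite (lin_sum lp) -sumrB /=; apply: eq_bigr => x _.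
    by rewrite !e (linD lp) addrACA opprD.
  rewrite sumrB /= -(lin_sum lp); congr (_ - _).
  rewrite (bigD1 j) //= [X in _ + X]big1 ?addr0 => [|i ij]; last first.
    rewrite big1 // => x _; rewrite /g !xpair_eqE (negPf ij) /=.
    by rewrite !scale0r !scaler0 addr0.
  rewrite (@sumZ_delta _ _ y); first last.
  + move=> x xk; rewrite /g xpair_eqE; case: (_ =P k) => [h|]; last first.
      by rewrite andbF scale0r scaler0.
    by case/eqP: xk; rewrite /y; lia.
  + rewrite /M; lia.
  rewrite /g (_ : y + m - p%:Z = k); last by rewrite /y; lia.
  by rewrite eqxx scale1r.
Qed.

Lemma has_symbol_comb a Z1 Z2 s g1 g2 : has_symbol Z1 s g1 -> has_symbol Z2 s g2 ->
  has_symbol (fun f => a *: Z1 f + Z2 f) s (fun k => a * g1 k + g2 k).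
Proof.
move=> [l1 s1 p1] [l2 s2 p2]; split.
- by apply: linear_add => //; exact: linear_scale.
- move=> i k f; have lp := fcr_linear W i k.
  by rewrite s1 s2 (linD lp) (linZ lp) scalerDl scalerDr scalerA addrACA.
- move=> i k f; have lp := fan_linear W i k.
  rewrite p1 p2 (linD lp) (linZ lp) scalerDl scalerBr scalerA opprD.
  by rewrite addrACA.
Qed.

Lemma has_symbol0 s : has_symbol (fun=> 0) s (fun=> 0).
Proof.
split; first exact: linear_zero.
- by move=> i k f; rewrite (lin0 (fcr_linear W i k)) scale0r addr0.
- by move=> i k f; rewrite (lin0 (fan_linear W i k)) scale0r subr0.
Qed.

Lemma has_symbol_eq Z1 Z2 s1 s2 g1 g2 : has_symbol Z1 s1 g1 -> Z1 =1 Z2 -> s1 = s2 ->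
  g1 =1 g2 -> has_symbol Z2 s2 g2.
Proof. by move=> h /funext <- <- /funext <-. Qed.

Lemma has_symbol_sum (J : Type) (r : seq J) (a : J -> K) (Z : J -> A -> A) s (g : J -> int -> K) :
  (forall j, has_symbol (Z j) s (g j)) ->
  has_symbol (fun f => \sum_(j <- r) a j *: Z j f) s (fun k => \sum_(j <- r) a j * g j k).
Proof.
move=> h; elim: r => [|j r IH].
  by apply: has_symbol_eq (has_symbol0 s) _ _ _ => // x; rewrite big_nil.
by apply: has_symbol_eq (has_symbol_comb (a j) (h j) IH) _ _ _ => // x; rewrite big_cons.
Qed.

Lemma has_symbol_comm Z1 Z2 s1 s2 g1 g2 : has_symbol Z1 s1 g1 -> has_symbol Z2 s2 g2 ->
  has_symbol (fun f => Z1 (Z2 f) - Z2 (Z1 f)) (s1 + s2)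
    (fun k => g2 k * g1 (k + s2) - g1 k * g2 (k + s1)).
Proof.
move=> [l1 h1 p1] [l2 h2 p2]; split.
- by apply: linear_sub; exact: linear_comp.
- move=> i k f; have lp := fcr_linear W i k.
  rewrite h2 h1 (linD l1) (linD l2) (linZ l1) (linZ l2) !h1 !h2 (linB lp).
  rewrite -!addrA [s2 + s1]addrC !scalerDr !scalerA scalerBl !opprD.
  rewrite !addrA; set a := fcr _ _ _; set b := _ *: _; set e := _ *: _.
  by rewrite [LHS](ACl (1*5*4*8*(2*7)*(3*6))) /= !subrr ?addr0.
- move=> i k f; have lp := fan_linear W i k.
  have e1 : k - (s1 + s2) = k - s1 - s2 by rewrite opprD addrA.
  have e2 : k - s2 - s1 = k - s1 - s2 by rewrite addrAC.
  rewrite p2 p1 (linB l1) (linB l2) (linZ l1) (linZ l2) !p1 !p2 (linB lp) e1 e2.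
  have e3 : k - s1 - s2 + s1 = k - s2 by rewrite -e2 subrK.
  rewrite /= subrK e3 !scalerBr !scalerA scalerBl.
  rewrite [g2 _ * g1 (k - s1)]mulrC [g1 (k - s1 - s2) * _]mulrC.
  rewrite !(opprB, opprD) !addrA.
  by rewrite [LHS](ACl (1*8*3*6*(2*5)*(4*7))) /= !addNr !addr0.
Qed.

(** A Schur lemma: [Z] commutes with all variables and all derivations, so [Z 1] is killed by every
    derivation and is constant, and multiplying by variables spreads this to all polynomials. *)
Lemma symbol0_scalar Z s : has_symbol Z s (fun=> 0) -> forall f, Z f = cst (Z 1) *: f.
Proof.
move=> [lZ hs hp].
have ZX v f : Z (X v * f) = X v * Z f.
  case: v => i k; have [k0|k0] := ltP k 0.
    by have := hs i k f; rewrite /fcr k0 scale0r addr0.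
  have := hp i k f; rewrite /fan ltNge k0 /= scale0r subr0; exact.
have ZD v f : Z (D v f) = D v (Z f).
  case: v => i k; have [k0|k0] := ltP k 0.
    by have := hp i k f; rewrite /fan k0 scale0r subr0.
  have := hs i k f; rewrite /fcr ltNge k0 /= scale0r addr0 (linN lZ).
  exact: oppr_inj.
have Z1 : Z 1 = cst (Z 1) *: 1.
  by apply: wder_ker => v; rewrite -ZD wder1 (lin0 lZ).
apply: (@wvar_ind _ _ _ W); last by move=> v f /= h; rewrite ZX h scalerAr.
  by apply: linear_eq_subspace => //; exact: (linear_scale _ (@linear_id _ _)).
exact: Z1.
Qed.

Lemma fcr1 i k : 0 <= k -> fcr i k 1 = 0.
Proof. by move=> k0; rewrite /fcr ltNge k0 /= wder1 oppr0. Qed.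

Lemma fan1 i k : k < 0 -> fan i k 1 = 0.
Proof. by move=> k0; rewrite /fan k0 wder1. Qed.

Lemma nord1 i l k : ~~ ((l < 0) && (0 <= k)) -> nord W i l k 1 = 0.
Proof.
rewrite /nord; case: ltP => [l0 /= k0|l0 _].
  by rewrite fan1 ?(lin0 (fcr_linear _ _ _)) // ltNge.
by rewrite fcr1 // (lin0 (fan_linear _ _ _)).
Qed.

Lemma op1 M m p : (`|m| + p <= M)%N -> op m p 1 = \sum_(i < n) \sum_(j < M)
  zff j%:Z p *: (if j%:Z + m - p%:Z < 0 then X (i, j%:Z + m - p%:Z) * X (i, j%:Z) else 0).
Proof.
move=> hM; rewrite (opE (N := 0) (M := M)) ?add0n //; last first.
  by move=> i k _; rewrite wder1.
apply: eq_bigr => i _; apply: eq_bigr => j _; rewrite /opt.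
rewrite [X in _ + _ *: X]nord1 ?scaler0 ?addr0; last by apply/negP => /andP[_]; lia.
congr (_ *: _); rewrite /nord; case: ifP => h; last first.
  by rewrite fcr1 ?(lin0 (fan_linear _ _ _)) // leNgt h.
by rewrite /fcr /fan h mulr1.
Qed.

Lemma op_vac m p : 0 <= m -> op m p 1 = 0.
Proof.
move=> m0; rewrite (op1 (leqnn _)); apply: big1 => i _; apply: big1 => j _.
have [jp|jp] := ltnP j p; first by rewrite zff_small // scale0r.
by case: ifP => [h|_]; [lia|rewrite scaler0].
Qed.

Let lc : linear (cst : A -> K^o) := wcst_linear W.

Lemma cst_op1 m p : cst (op m p 1) = 0.
Proof.
rewrite (op1 (leqnn _)) (lin_sum lc); apply: big1 => i _; rewrite (lin_sum lc).
apply: big1 => j _; rewrite (linZ lc); case: ifP => _; last by rewrite (lin0 lc) scaler0.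
by rewrite wcst_var scaler0.
Qed.

(** Only full contractions of the two quadratics reach the constant term. Each of the [n] pairs of
    fields gives the sum of [zff_residue], negated by the sign of the derivation in [fcr]; hence the
    central charge [-n]. *)
Lemma cst_op_op1 m p m' q : cst (op m p (op m' q 1)) =
  if m' < q%:Z then - n%:R * psi_mon K (m, p) (m', q) else 0.
Proof.
have [lo hs _] := op_symbol m p.
pose M := (`|m'| + q)%N; rewrite (op1 (leqnn M)) (lin_sum lo) (lin_sum lc).
pose r := q%:Z - m'.
have e (i : 'I_n) : cst (op m p (\sum_(j < M) zff j%:Z q *:
    (if j%:Z + m' - q%:Z < 0 then X (i, j%:Z + m' - q%:Z) * X (i, j%:Z) else 0))) =
   - \sum_(j < M) if (j%:Z < r) && (m - p%:Z == r) then zff j%:Z q * zff (j%:Z - r) p else 0.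
  rewrite (lin_sum lo) (lin_sum lc) -sumrN; apply: eq_bigr => j _.
  rewrite (linZ lo) (linZ lc) -[RHS]mulrN1.
  have -> : j%:Z + m' - q%:Z = j%:Z - r by rewrite /r; lia.
  have -> : (j%:Z < r) = (j%:Z - r < 0) by rewrite subr_lt0.
  case: ifP => h /=; last by rewrite (lin0 lo) (lin0 lc) mul0r scaler0.
  have := hs i (j%:Z - r) (X (i, j%:Z)).
  rewrite {1 2}/fcr h => ->; rewrite (linD lc) (linZ lc) wcst_var add0r.
  rewrite /fcr; case: ltP => h2.
    rewrite wcst_var scaler0 scaler0; case: eqP => e; last by rewrite mul0r.
    lia.
  rewrite -[X (i, j%:Z)]mulr1 wder_var wder1 mulr0 addr0 (linN lc) (linZ lc) wcst1.
  rewrite xpair_eqE eqxx /=.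
  have -> : (j%:Z - r + (m - p%:Z) == j%:Z) = (m - p%:Z == r) by apply/eqP/eqP; lia.
  case: eqP => _; last by rewrite scale0r oppr0 !scaler0 mul0r.
  rewrite -[LHS]/(zff j%:Z q * (zff (j%:Z - r) p * - (1%:R * 1))).
  by rewrite mulr1 mulrA.
rewrite (eq_bigr _ (fun i _ => e i)) sumr_const card_ord -[LHS]mulr_natl mulrN -mulNr.
rewrite /psi_mon; have [mr|mr] := eqVneq (m - p%:Z) r; last first.
  rewrite big1 ?mulr0 => [|j _]; last by rewrite andbF.
  by case: ifP => // _; case: eqP => h; [move/eqP: mr; rewrite /r; lia|rewrite !mulr0].
have -> : (m - q.+1%:Z + (m' - p%:Z) == -1) = true by apply/eqP; move: mr; rewrite /r; lia.
have [mq|mq] := ltP m' q%:Z; last first.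
  by rewrite big1 ?mulr0 // => j _; case: ifP => // /andP[h _]; move: h; rewrite /r; lia.
congr (_ * _).
have er : r = (`|r|%N)%:Z by rewrite /r; lia.
have -> : m = p%:Z + (`|r|%N)%:Z by rewrite -er -mr; lia.
have -> : m' = q%:Z - (`|r|%N)%:Z by rewrite -er /r; lia.
rewrite -zff_residue.
rewrite (eq_bigr (fun j : 'I_M => if (j < `|r|)%N then zff j%:Z q * zff (j%:Z - r) p else 0)).
  rewrite -big_mkcond /= (big_ord_widen_cond M xpredT (fun j => zff j%:Z q * zff (j%:Z - `|r|%N%:Z) p)).
    by apply: eq_bigr => j _; rewrite -er.
  by rewrite /M /r; lia.
move=> j _; rewrite andbT; congr (if _ then _ else _); lia.
Qed.

Lemma psi_mon_anti m p m' q : psi_mon K (m, p) (m', q) = - psi_mon K (m', q) (m, p).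
Proof.
rewrite /psi_mon [(q + p)%N]addnC [(q`! * _)%N]mulnC -mulrN; congr (_ * _).
have -> : (m' - p.+1%:Z + (m - q%:Z) == -1) = (m - q.+1%:Z + (m' - p%:Z) == -1).
  by apply/eqP/eqP; lia.
case: eqP => h; last by rewrite oppr0.
rewrite !zffactS; have -> : (m - q%:Z)%:~R = - (m' - p%:Z)%:~R :> K.
  by rewrite -mulrNz; congr (_%:~R); lia.
ring.
Qed.

(** The two sides act alike on the modes of the Weyl fields, so they differ by a
    scalar, which is read off on the vacuum. *)
Lemma op_comm m p m' q f : op m p (op m' q f) - op m' q (op m p f) =
  \sum_(i < p.+1) ('C(p, i)%:R * zff m' i) *: op (m + m' - i%:Z) (p + q - i) f
  - \sum_(i < q.+1) ('C(q, i)%:R * zff m i) *: op (m' + m - i%:Z) (q + p - i) f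
  + (- n%:R * psi_mon K (m, p) (m', q)) *: f.
Proof.
pose s := m + m' - (p + q)%N%:Z.
pose Q m p m' q f := \sum_(i < p.+1) ('C(p, i)%:R * zff m' i) *: op (m + m' - i%:Z) (p + q - i) f.
have hQ m1 p1 m2 q1 : m1 + m2 - (p1 + q1)%N%:Z = s ->
    has_symbol (Q m1 p1 m2 q1) s (fun k => zff k q1 * zff (k + m2 - q1%:Z) p1).
  move=> es; have h (i : 'I_p1.+1) : has_symbol (op (m1 + m2 - i%:Z) (p1 + q1 - i)) s
      (fun k => zff k (p1 + q1 - i)).
    apply: has_symbol_eq (op_symbol _ _) _ _ _ => //.
    by have := ltn_ord i; rewrite -es; lia.
  apply: has_symbol_eq (has_symbol_sum (index_enum _) (fun i : 'I_p1.+1 => 'C(p1, i)%:R * zff m2 i) h) _ _ _ => // k.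
  by rewrite zff_dmul.
have hA := has_symbol_comm (op_symbol m p) (op_symbol m' q).
have esA : m - p%:Z + (m' - q%:Z) = s by rewrite /s; lia.
have esB : m' + m - (q + p)%N%:Z = s by rewrite /s; lia.
have hC := has_symbol_comb 1 (hQ m' q m p esB) (has_symbol_eq hA (fun=> erefl) esA (fun=> erefl)).
have hD := has_symbol_comb (-1) (hQ m p m' q erefl) hC.
have h0 : has_symbol (fun f => -1 *: Q m p m' q f + (1 *: Q m' q m p f +
    (op m p (op m' q f) - op m' q (op m p f)))) s (fun=> 0).
  apply: has_symbol_eq hD _ _ _ => // k; rewrite !addrA; ring.
have cQ m1 p1 m2 q1 : cst (Q m1 p1 m2 q1 1) = 0.
  rewrite /Q (lin_sum lc) big1 // => i _; rewrite (linZ lc) cst_op1; exact: scaler0.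
have := symbol0_scalar h0 f.
rewrite (linD lc) (linD lc) (linB lc) (linZ lc) (linZ lc) !cQ !scaler0 !add0r !cst_op_op1.
(* For [m + m' = p + q] at most one of the two conditions holds. If neither does, then [m = p] and
   [m' = q], and one of the falling factorials in [psi_mon] is 0. *)
have -> : (if m' < q%:Z then - n%:R * psi_mon K (m, p) (m', q) else 0 : K) -
   (if m < p%:Z then - n%:R * psi_mon K (m', q) (m, p) else 0) =
   - n%:R * psi_mon K (m, p) (m', q) :> K.
  have [e|ne] := eqVneq (m + m') (p + q)%N%:Z; last first.
    have h a b a' b' : a + a' <> (b + b')%N%:Z -> psi_mon K (a, b) (a', b') = 0.
      by move=> h; rewrite /psi_mon; case: eqP => h'; [case: h; lia|rewrite mulr0].
    have h1 : psi_mon K (m, p) (m', q) = 0 by apply: h; exact/eqP.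
    have h2 : psi_mon K (m', q) (m, p) = 0 by apply: h; apply/eqP; rewrite addrC addnC.
    by rewrite h1 h2 !mulr0 !if_same subr0.
  case: ltP => h1; case: ltP => h2; rewrite ?subr0 ?sub0r //; first by lia.
    by rewrite psi_mon_anti mulrN opprK.
  have [e1 e2] : m = p%:Z /\ m' = q%:Z by split; lia.
  rewrite /psi_mon e1 e2; case: (ltnP p q.+1) => pq.
    by rewrite (zff_small _ pq) mul0r if_same !mulr0.
  by rewrite (zff_small _ pq) mulr0 if_same !mulr0.
move=> <-; rewrite scaleN1r scale1r -/(Q m p m' q f) -/(Q m' q m p f).
by rewrite [RHS]addrACA subrr add0r addKr.
Qed.

Definition fock_act (x : dhat K) (f : A) : A :=
  fglift (fun b : int * nat => op b.1 b.2 f) x.1 + (- n%:R * x.2) *: f.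

Lemma fock_act_linl f : linear (fun x => fock_act x f).
Proof.
move=> a x y; rewrite /fock_act (fglift_linear _ a) scalerDr addrACA; congr (_ + _).
by rewrite scalerA -scalerDl mulrDr mulrCA.
Qed.

Lemma fock_act_dE m p f : fock_act (dE K m p) f = op m p f.
Proof. by rewrite /fock_act /= /dmon fgliftU mulr0 scale0r addr0. Qed.

Lemma fock_act_kappa a f : fock_act (0, a) f = (- n%:R * a) *: f.
Proof. by rewrite /fock_act /= (lin0 (fglift_linear _)) add0r. Qed.

Lemma fock_ind (S : set (dhat K)) : subspace S -> (forall m p, S (dE K m p)) ->
  (forall a, S (0, a)) -> forall x, S x.
Proof.
move=> sS SE Sk; apply: dhat_ind => // l m; rewrite J_shift.
exact: (subspaceN sS (SE _ _)).
Qed.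

Lemma fock_act_linr x : linear (fock_act x).
Proof.
move: x; apply: fock_ind => [|m p|a].
- split=> [|a x y lx ly] /=.
    by move=> a f g; rewrite !(lin0 (fock_act_linl _)) scaler0 addr0.
  move=> b f g; rewrite !(fock_act_linl _ a); exact: (linear_add (linear_scale a lx) ly).
- by move=> a f g; rewrite !fock_act_dE; exact: op_linear.
- by move=> b f g; rewrite !fock_act_kappa; exact: (linear_scale _ (@linear_id _ _)).
Qed.

Lemma fock_act_comm x y f :
  fock_act x (fock_act y f) - fock_act y (fock_act x f) = fock_act (dhat_br x y) f.
Proof.
have lk a : linear (fock_act (0, a)) by exact: fock_act_linr.
have br0l a z : dhat_br (0, a) z = 0 :> dhat K.
  exact: dhat_br_kappal.
have br0r a z : dhat_br z (0, a) = 0 :> dhat K.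
  exact: dhat_br_kappar.
have ll z : linear (fun x => fock_act x z) by exact: fock_act_linl.
have lr z : linear (fock_act z) by exact: fock_act_linr.
move: x; apply: fock_ind => [|m p|a].
- apply: linear_eq_subspace; last exact: (linear_comp (ll f) (dhat_br_linl y)).
  by apply: linear_sub => //; exact: (linear_comp (lr y) (ll f)).
- move: y; apply: fock_ind => [|m' q|a].
  + apply: linear_eq_subspace; last exact: (linear_comp (ll f) (dhat_br_linr _)).
    by apply: linear_sub => //; exact: (linear_comp (lr _) (ll f)).
  + rewrite /= !fock_act_dE op_comm /fock_act /= psi_monE; congr (_ + _).
    have lf := fglift_linear (fun b : int * nat => op b.1 b.2 f).
    rewrite /dbr (linB lf) !dmulE !(lin_sum lf); congr (_ - _).
      by apply: eq_bigr => i _; rewrite (linZ lf) fgliftU.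
    by apply: eq_bigr => i _; rewrite (linZ lf) fgliftU.
  + by rewrite /= br0r (lin0 (ll f)) !fock_act_kappa (linZ (lr _)) subrr.
- by rewrite /= br0l (lin0 (ll f)) !fock_act_kappa (linZ (lr _)) subrr.
Qed.

Lemma fock_act_vac x : Phat x -> fock_act x 1 = Pchar (- n%:R) x *: 1.
Proof.
case: x => a b Pa; rewrite /fock_act /Pchar /= -[RHS]add0r; congr (_ + _).
move: a Pa; rewrite /Phat /= /Psub; apply: lspan_min.
  by apply: linear_eq_subspace; [exact: fglift_linear|exact: linear_zero].
move=> _ [l [k [lk ->]]] /=; rewrite (linN (fglift_linear _)) fgliftU /=.
by rewrite op_vac ?oppr0.
Qed.

End FockRepresentation.

(** * Sums over cyclic permutations *)

Section CyclicPermutations.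

Definition ins r (c : 'S_r.+1) (p : 'I_r.+1) : 'S_r.+2 :=
  (tperm ord0 (lift ord0 p) * lift_perm ord0 ord0 c)%g.

(** The [r]-fold cyclic permutations of ['I_r.+1]: each is obtained from a unique
    cycle [c] of the other points by inserting [ord0] between [p] and [c p]. *)
Fixpoint cyc r : seq 'S_r.+1 :=
  if r is r'.+1 then [seq ins c p | c <- cyc r', p <- enum 'I_r'.+1] else [:: 1%g].

Lemma ins0 r (c : 'S_r.+1) p : ins c p ord0 = lift ord0 (c p).
Proof. by rewrite /ins permM tpermL lift_perm_lift. Qed.

Lemma ins_lift r (c : 'S_r.+1) p i :
  ins c p (lift ord0 i) = if i == p then ord0 else lift ord0 (c i).
Proof.
rewrite /ins permM; case: eqP => [->|/eqP ip]; first by rewrite tpermR lift_perm_id.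
by rewrite tpermD ?lift_perm_lift // (inj_eq lift_inj) eq_sym.
Qed.

Lemma size_cyc r : size (cyc r) = r`!.
Proof.
by elim: r => //= r IH; rewrite size_allpairs IH size_enum_ord factS mulnC.
Qed.

Lemma odd_cyc r c : c \in cyc r -> odd_perm c = odd r.
Proof.
elim: r c => [|r IH] c /=; first by rewrite inE => /eqP ->; rewrite odd_perm1.
move=> /allpairsP[[d p] [dr _ ->]] /=.
by rewrite /ins odd_permM odd_tperm neq_lift odd_lift_perm /= (IH _ dr).
Qed.

Context (K : numFieldType).
Let f (m : nat) : K := m.+1%:R^-1.

Definition cycsum r (a b : 'I_r.+1 -> nat) : K :=
  \sum_(c <- cyc r) \prod_i f (b i + a (c i)).

Definition upd r (a : 'I_r -> nat) j s i := (a i + (i == j) * s)%N.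

(** Partial fractions: the denominators [x + w + 1] and [y + z + 1] add up to [z + w + s + 1]. *)
Let f_split x y s : (s = x + y + 1)%N -> forall z w, f (z + w + s) * (f (x + w) + f (y + z)) = f (x + w) * f (y + z).
Proof.
move=> -> z w; have h m : 1 + m%:R != 0 :> K by rewrite nat1r pnatr_eq0.
have e m : m.+1%:R = 1 + m%:R :> K by rewrite nat1r.
rewrite /f !e !natrD; field.
have := h (x + w)%N; have := h (y + z)%N; have := h (z + w + (x + y + 1))%N.
rewrite !natrD !addrA => h1 h2 h3.
by apply/and3P.
Qed.

Lemma cycsum0 (a b : 'I_1 -> nat) : cycsum a b = f (b ord0 + a ord0).
Proof. by rewrite /cycsum big_seq1 big_ord1 perm1. Qed.

(** Removing [ord0] from a cycle merges its two factors, by [f_split], into one factor of the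
    shorter cycle with argument raised by [s]. The recursion has the same coefficients and updates
    as [quad_prod_recl]. *)
Lemma cycsum_rec r (a b : 'I_r.+2 -> nat) (a' := fun i => a (lift ord0 i))
    (b' := fun i => b (lift ord0 i)) (s := (a ord0 + b ord0 + 1)%N) :
  cycsum a b = \sum_j (f (b ord0 + a' j) * cycsum (upd a' j s) b'
                       + f (a ord0 + b' j) * cycsum a' (upd b' j s)).
Proof.
rewrite {1}/cycsum /= big_allpairs_dep big_split /=.
under [X in _ = X + _]eq_bigr do rewrite mulr_sumr.
under [X in _ = _ + X]eq_bigr do rewrite mulr_sumr.
rewrite [X in _ = X + _]exchange_big [X in _ = _ + X]exchange_big -big_split /=.
(* With [ord0] inserted between [p] and [c p], the shift of [a'] sits at [c p] and that of [b'] at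
   [p]; after reindexing by [c] both raise the same factor. *)
apply: eq_bigr => c _; rewrite [X in _ = X + _](reindex_inj (@perm_inj _ c)) -big_split /= big_enum /=.
apply: eq_bigr => p _.
have -> : \prod_i f (b' i + upd a' (c p) s (c i)) =
    f (b' p + a' (c p) + s) * \prod_(i | i != p) f (b' i + a' (c i)).
  rewrite (bigD1 p) //= /upd eqxx mul1n addnA; congr (_ * _).
  apply: eq_bigr => i ip; rewrite (inj_eq (@perm_inj _ c)) (negPf ip) mul0n addn0.
  by [].
have -> : \prod_i f (upd b' p s i + a' (c i)) =
    f (b' p + a' (c p) + s) * \prod_(i | i != p) f (b' i + a' (c i)).
  rewrite (bigD1 p) //= /upd eqxx mul1n addnAC; congr (_ * _).
  by apply: eq_bigr => i ip; rewrite (negPf ip) mul0n addn0.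
rewrite big_ord_recl ins0 (bigD1 p) //= ins_lift eqxx !mulrA -mulrDl.
congr (_ * _); last first.
  by apply: eq_bigr => i ip; rewrite ins_lift (negPf ip).
rewrite -mulrDl [RHS]mulrC (@f_split (b ord0) (a ord0)); last by rewrite /s; lia.
by rewrite [(a ord0 + _)%N]addnC.
Qed.

End CyclicPermutations.

(** * Nonvanishing of the Hilbert determinant *)

Section Hilbert.
Context (K : numFieldType).

(** Clearing denominators in a left kernel vector [v] gives a polynomial [p] with fewer than [n + 1]
    coefficients that vanishes at [0, ..., n - 1]. So [p = 0], and its value at [-(i + 1)] is
    [v 0 i] times a nonzero product. *)
Lemma det_hilbert n : \det (\matrix_(i < n, j < n) ((i + j).+1%:R^-1 : K)) != 0.
Proof.
apply/det0P => -[v v0 vH]; case/eqP: v0; apply/rowP => i; rewrite mxE.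
pose q (i : 'I_n) : {poly K} := \prod_(k < n | k != i) ('X + k.+1%:R%:P).
pose p : {poly K} := \sum_(i < n) v 0 i *: q i.
have qE i' x : (q i').[x] = \prod_(k < n | k != i') (x + k.+1%:R).
  by rewrite horner_prod; apply: eq_bigr => k _; rewrite !hornerE.
have szp : (size p <= n)%N.
  apply: (leq_trans (size_sum _ _ _)); apply/bigmax_leqP => k _.
  apply: (leq_trans (size_scale_leq _ _)).
  apply: (leq_trans (size_prod_leq _ _)).
  rewrite (eq_bigr (fun=> 2%N)) => [|j _]; last by rewrite size_XaddC.
  rewrite sum_nat_const (eq_card (B := predC1 k)) // cardC1 card_ord.
  have := ltn_ord k; lia.
have p0 : p = 0.
  apply: (@roots_geq_poly_eq0 _ p [seq (j%:R : K) | j <- iota 0 n]).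
  - apply/allP => x /mapP[j]; rewrite mem_iota /= => jn ->.
    apply/rootP; rewrite horner_sum.
    have := congr1 (fun u : 'rV_n => u 0 (Ordinal jn)) vH; rewrite !mxE => e.
    transitivity ((\prod_(k < n) (j%:R + k.+1%:R)) * \sum_(k < n) v 0 k * (k + j).+1%:R^-1 : K).
      rewrite mulr_sumr; apply: eq_bigr => k _; rewrite hornerZ qE [in RHS](bigD1 k) //=.
      have k0 : (j%:R + k.+1%:R : K) != 0 by rewrite -natrD pnatr_eq0 addnS.
      have -> : (k + j).+1%:R = j%:R + k.+1%:R :> K by rewrite -natrD addnS addnC.
      by rewrite [RHS]mulrCA [X in _ = _ * (X / _)]mulrC mulfK.
    rewrite [X in _ * X](_ : _ = 0) ?mulr0 // -[RHS]e.
    by apply: eq_bigr => k _; rewrite !mxE.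
  - rewrite map_inj_uniq ?iota_uniq // => x y /eqP; rewrite eqr_nat; exact: eqP.
  - by rewrite size_map size_iota.
have := congr1 (fun u : {poly K} => u.[- i.+1%:R]) p0.
rewrite horner0 horner_sum (bigD1 i) //= big1 ?addr0 => [|k ki]; last first.
  by rewrite hornerZ qE (bigD1 i) 1?eq_sym //= addNr mul0r mulr0.
rewrite hornerZ qE => /eqP; rewrite mulf_eq0 => /orP[/eqP //|].
rewrite prodf_seq_eq0 => /hasP[k _ /andP[ki]].
by rewrite addrC subr_eq0 eqr_nat eqSS => /eqP/val_inj e; rewrite e eqxx in ki.
Qed.
End Hilbert.

(** * The determinant relation and its linear part *)

Section Minor.
Context (K : numFieldType) (n : nat) (A : comAlgType K).
Context (W : weyl_module ('I_n * int)%type A).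
Notation zff := (zffact K).
Notation X := (wvar W).
Notation op := (op W).
Notation act := (fock_act W).

(** The operator attached to [(d/dt)^a t^(-1) (d/dt)^b]. *)
Definition eop a b (f : A) : A :=
  \sum_(i < a.+1) ('C(a, i)%:R * zff (-1) i) *: op (-1 - i%:Z) (a + b - i) f.

(** The constants are those of [(d/dt)^a t^(-1)] and [(d/dt)^b t^b]; they make
    [eop1] and [eop_quad] free of further factors. *)
Definition fx i a : A := zff (-1) a *: X (i, -1 - a%:Z).
Definition fy i b : A := b`!%:R *: X (i, b%:Z).
Definition quad a b : A := \sum_(i < n) fx i a * fy i b.

Lemma eop_symbol a b : has_symbol W (eop a b) (- (a + b + 1)%N%:Z)
  (fun k => zff k b * zff (k - 1 - b%:Z) a).
Proof.
have h (i : 'I_a.+1) : has_symbol W (op (-1 - i%:Z) (a + b - i)) (- (a + b + 1)%N%:Z)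
    (fun k => zff k (a + b - i)).
  by apply: has_symbol_eq (op_symbol _ _ _) _ _ _ => //; have := ltn_ord i; lia.
apply: has_symbol_eq (has_symbol_sum (index_enum _) (fun i : 'I_a.+1 => 'C(a, i)%:R * zff (-1) i) h) _ _ _ => // k.
by rewrite zff_dmul.
Qed.

Lemma eop_linear a b : linear (eop a b).
Proof. by have [] := eop_symbol a b. Qed.

Lemma zff_fact m i : zff (m + i)%N%:Z i * m`!%:R = (m + i)`!%:R.
Proof.
elim: i => [|i IH]; first by rewrite zff0 mul1r addn0.
rewrite addnS factS natrM -IH.
have -> : (m + i).+1%:Z = (m + i)%N%:Z + 1 by lia.
rewrite zffactSl -!mulrA; congr (_ * _).
by rewrite -[RHS]/((m + i).+1%:Z%:~R); congr (_%:~R); lia.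
Qed.

(** On the vacuum only the modes [0 <= j < a + b + 1] contribute, and there
    [zff j b * zff (j - 1 - b) a] vanishes unless [j = b]. A single product remains for each pair of
    fields. *)
Lemma eop1 a b : eop a b 1 = quad a b.
Proof.
pose M := (2 * (a + b + 1))%N.
rewrite /eop (eq_bigr (fun i : 'I_a.+1 => \sum_(k < n) \sum_(j < M)
   ('C(a, i)%:R * zff (-1) i * zff j%:Z (a + b - i)) *:
   (if j%:Z - (a + b + 1)%N%:Z < 0 then X (k, j%:Z - (a + b + 1)%N%:Z) * X (k, j%:Z) else 0))).
  rewrite exchange_big; apply: eq_bigr => k _; rewrite exchange_big /=.
  under eq_bigr => j _.
    rewrite -scaler_suml zff_dmul; over.
  have bM : (b < M)%N by rewrite /M; lia.
  rewrite (bigD1 (Ordinal bM)) //= big1 ?addr0 => [|j jb].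
    rewrite ifT; last by lia.
    rewrite /fx /fy -scalerAl -scalerAr scalerA; congr (_ *: (X (k, _) * _)); last by lia.
    have := zff_fact 0 b; rewrite fact0 mulr1 add0n => ->; rewrite mulrC; congr (zff _ _ * _); lia.
  have [jlt|jge] := ltnP j b; first by rewrite zff_small // mul0r scale0r.
  have {}jb : (b < j)%N by rewrite ltn_neqAle jge andbT eq_sym.
  case: ifP => h; last by rewrite scaler0.
  have -> : j%:Z + (-1) - b%:Z = (j - b.+1)%N%:Z by lia.
  by rewrite [zff (j - b.+1)%N%:Z a]zff_small ?mulr0 ?scale0r //; lia.
move=> i _; have ia := ltn_ord i.
rewrite (@op1 _ _ _ _ M); last by rewrite /M; lia.
rewrite scaler_sumr; apply: eq_bigr => k _; rewrite scaler_sumr; apply: eq_bigr => j _.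
rewrite scalerA; congr (_ *: _).
by have -> : j%:Z + (-1 - i%:Z) - (a + b - i)%N%:Z = j%:Z - (a + b + 1)%N%:Z by lia.
Qed.

Lemma eop_fx a b i k f :
  eop a b (fx i k * f) = fx i k * eop a b f - (b + k).+1%:R^-1 *: (fx i (a + b + k + 1) * f).
Proof.
have [le hs _] := eop_symbol a b; have k0 : -1 - k%:Z < 0 by lia.
have := hs i (-1 - k%:Z) f; rewrite {1 2}/fcr k0.
have -> : -1 - k%:Z + - (a + b + 1)%N%:Z = -1 - (a + b + k + 1)%N%:Z by lia.
rewrite {1}/fcr (_ : -1 - (a + b + k + 1)%N%:Z < 0); last by lia.
rewrite /fx -!scalerAl (linZ le) => ->; rewrite scalerDr; congr (_ + _).
rewrite !scalerA -scaleNr; congr (_ *: _).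
have -> : (a + b + k + 1 = (k + b) + (1 + a))%N by lia.
rewrite !zff_add [zff _ 1]zffactS zff0 mul1r mulrA.
have -> : -1 - k%:Z - 1 - b%:Z = -1 - (k + b)%N%:Z - 1 by lia.
have -> : -1 - (k + b)%N%:Z - 0%N%:Z = - (b + k).+1%:Z by lia.
rewrite mulrNz.
have n0 : (b + k).+1%:R != 0 :> K by rewrite pnatr_eq0.
rewrite -[_%:~R]/((b + k).+1%:R); field.
by rewrite -natrD nat1r.
Qed.

Lemma eop_fy a b i l f :
  eop a b (fy i l * f) = fy i l * eop a b f - (a + l).+1%:R^-1 *: (fy i (a + b + l + 1) * f).
Proof.
have [le _ hp] := eop_symbol a b.
have := hp i l%:Z f; rewrite {1 2}/fan (_ : (l%:Z < 0) = false) //.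
have -> : l%:Z - - (a + b + 1)%N%:Z = (a + b + l + 1)%N%:Z by lia.
rewrite {1}/fan (_ : ((a + b + l + 1)%N%:Z < 0) = false) //.
rewrite /fy -!scalerAl (linZ le) => ->; rewrite scalerBr; congr (_ - _).
rewrite !scalerA; congr (_ *: _).
have e1 := zff_fact l a; have e2 := zff_fact (l + a).+1 b.
have -> : (a + b + l + 1)%N%:Z - 1 - b%:Z = (l + a)%N%:Z by lia.
have -> : (a + b + l + 1 = (l + a).+1 + b)%N by lia.
rewrite [(a + l)%N]addnC -e2 factS natrM -e1.
have n0 : (l + a).+1%:R != 0 :> K by rewrite pnatr_eq0.
field.
by rewrite -natrD nat1r.
Qed.

Lemma eop_quad a b k l f : eop a b (quad k l * f) = quad k l * eop a b f
  - ((b + k).+1%:R^-1 *: quad (a + b + k + 1) l + (a + l).+1%:R^-1 *: quad k (a + b + l + 1)) * f.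
Proof.
rewrite /quad !mulr_suml (lin_sum (eop_linear a b)) !scaler_sumr -big_split /= mulr_suml -sumrB.
apply: eq_bigr => i _; rewrite -!mulrA eop_fx eop_fy mulrBr -addrA; congr (_ + _).
move: (fx i k) (fx i (a + b + k + 1)%N) (fy i l) (fy i (a + b + l + 1)%N) => x x2 y y2.
by rewrite mulrDl opprD addrC -!scalerAr -!scalerAl !mulrA.

Qed.

Lemma leibniz (D : A -> A) r (F G : 'I_r -> A) : D 1 = 0 ->
  (forall j f, D (F j * f) = F j * D f + G j * f) ->
  D (\prod_j F j) = \sum_j G j * \prod_(i | i != j) F i.
Proof.
move=> D1; elim: r F G => [|r IH] F G DF; first by rewrite !big_ord0.
rewrite big_ord_recl DF (IH _ (fun j => G (lift ord0 j))) // big_ord_recl addrC.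
congr (_ + _).
  by congr (_ * _); rewrite [in RHS]big_mkcond big_ord_recl /= mul1r.
rewrite mulr_sumr; apply: eq_bigr => j _; rewrite mulrCA; congr (_ * _).
rewrite [RHS]big_mkcond big_ord_recl /=; congr (_ * _); rewrite big_mkcond /=.
by apply: eq_bigr => i _; rewrite (inj_eq lift_inj).
Qed.

Lemma eop_prod a b r (al be : 'I_r -> nat) (s := (a + b + 1)%N) :
  eop a b (\prod_i quad (al i) (be i)) = quad a b * \prod_i quad (al i) (be i)
  - \sum_j ((b + al j).+1%:R^-1 *: \prod_i quad (upd al j s i) (be i)
            + (a + be j).+1%:R^-1 *: \prod_i quad (al i) (upd be j s i)).
Proof.
pose G (j : 'I_r) := - ((b + al j).+1%:R^-1 *: quad (a + b + al j + 1) (be j)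
   + (a + be j).+1%:R^-1 *: quad (al j) (a + b + be j + 1)).
(* Subtracting multiplication by the value at 1 makes the operator kill 1, as [leibniz] requires. *)
have := @leibniz (fun f => eop a b f - quad a b * f) r (fun j => quad (al j) (be j)) G.
rewrite eop1 mulr1 subrr => /(_ erefl) h.
apply/eqP; rewrite -[X in _ == X]addrC -subr_eq; apply/eqP; rewrite h => [|j f]; last first.
  by rewrite eop_quad mulrBr /G mulNr [quad a b * _]mulrCA addrAC.
rewrite -sumrN; apply: eq_bigr => j _; rewrite /G mulNr mulrDl -!scalerAl.
congr (- (_ *: _ + _ *: _)); rewrite [in RHS](bigD1 j) //= /upd eqxx mul1n.
  congr (quad _ _ * _); first by rewrite /s; lia.
  by apply: eq_bigr => i ij; rewrite (negPf ij) mul0n addn0.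
congr (quad _ _ * _); first by rewrite /s; lia.
by apply: eq_bigr => i ij; rewrite (negPf ij) mul0n addn0.
Qed.

Section Relation.
Variable N : nat.
Let P : pred nat := fun l => (l < N)%N.
Notation G := (words act 1 P).
Let sG z : subspace (G z). Proof. exact: words_subspace. Qed.
Let linr := fock_act_linr W.

Lemma eop_words a b z f : (a + b < N)%N -> G z f -> G (z + (a + b + 1)%N%:Z) (eop a b f).
Proof.
move=> abN Gf; apply: subspace_sum => // i _; apply: subspaceZ => //.
have ia := ltn_ord i; rewrite -fock_act_dE.
have := words_letter linr (m := -1 - i%:Z) (l := (a + b - i)%N) _ _ Gf.
move=> /(_ ltac:(lia)); rewrite /P => /(_ ltac:(lia)).
by congr (G _ _); lia.
Qed.

Definition wsum r (al be : 'I_r -> nat) := (\sum_i (al i + be i + 1))%N.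

Lemma wsum_updl r (al be : 'I_r -> nat) j s : wsum (upd al j s) be = (wsum al be + s)%N.
Proof.
rewrite /wsum (bigD1 j) //= [in RHS](bigD1 j) //= {1}/upd eqxx mul1n.
rewrite (eq_bigr (fun i => al i + be i + 1)%N); first by lia.
by move=> i ij; rewrite /upd (negPf ij) mul0n addn0.
Qed.

Lemma wsum_updr r (al be : 'I_r -> nat) j s : wsum al (upd be j s) = (wsum al be + s)%N.
Proof.
rewrite /wsum (bigD1 j) //= [in RHS](bigD1 j) //= {1}/upd eqxx mul1n.
rewrite (eq_bigr (fun i => al i + be i + 1)%N); first by lia.
by move=> i ij; rewrite /upd (negPf ij) mul0n addn0.
Qed.

Lemma wsum_recl r (al be : 'I_r.+1 -> nat) : wsum al be = (al ord0 + be ord0 + 1 +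
  wsum (fun i => al (lift ord0 i)) (fun i => be (lift ord0 i)))%N.
Proof. by rewrite /wsum big_ord_recl. Qed.

(** This is [eop_prod] solved for the longer product; it drives the two inductions on the number of
    factors below. *)
Lemma quad_prod_recl r (al be : 'I_r.+1 -> nat) (s := (al ord0 + be ord0 + 1)%N)
    (al' := fun i => al (lift ord0 i)) (be' := fun i => be (lift ord0 i)) :
  \prod_i quad (al i) (be i) = eop (al ord0) (be ord0) (\prod_i quad (al' i) (be' i))
   + \sum_j ((be ord0 + al' j).+1%:R^-1 *: \prod_i quad (upd al' j s i) (be' i)
            + (al ord0 + be' j).+1%:R^-1 *: \prod_i quad (al' i) (upd be' j s i)).
Proof. by rewrite eop_prod subrK big_ord_recl. Qed.

Lemma quad_prod_words r (al be : 'I_r -> nat) : (wsum al be <= N)%N ->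
  G (wsum al be)%:Z (\prod_i quad (al i) (be i)).
Proof.
elim: r al be => [|r IH] al be wN; first by rewrite /wsum !big_ord0; exact: words_v0.
have e := wsum_recl al be; rewrite quad_prod_recl; apply: subspaceD => //.
  have w1 : (wsum (fun i => al (lift ord0 i)) (fun i => be (lift ord0 i)) <= N)%N by lia.
  have ab : (al ord0 + be ord0 < N)%N by lia.
  by have := eop_words ab (IH _ _ w1); rewrite e PoszD addrC.
apply: subspace_sum => // j _; apply: subspaceD => //; apply: subspaceZ => //.
  set a' := upd _ _ _; set b' := fun i => be (lift ord0 i).
  have e' : wsum a' b' = wsum al be by rewrite /a' wsum_updl e addnC.
  by rewrite -e'; apply: IH; rewrite e'.
set b' := upd _ _ _; set a' := fun i => al (lift ord0 i).
have e' : wsum a' b' = wsum al be by rewrite /b' wsum_updr e addnC.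
by rewrite -e'; apply: IH; rewrite e'.
Qed.

(** With several factors, [a + b < N] holds for the first one because the others have positive
    weight, so its operator term stays in [G]. The corrections keep the weight [N + 1], and
    [cycsum_rec] adds up their coefficients. *)
Lemma quad_prod_linear_part r (al be : 'I_r.+1 -> nat) : wsum al be = N.+1 ->
  G N.+1%:Z (\prod_i quad (al i) (be i) - (N.+1%:R * cycsum K al be) *: op (-1) N 1).
Proof.
elim: r al be => [|r IH] al be wN.
  (* For one factor [cycsum] is [1 / (N + 1)], which the prefactor cancels; the Leibniz terms of
     index [i > 0] have order below [N]. *)
  rewrite big_ord1 cycsum0 -eop1; set a := al ord0; set b := be ord0.
  have abN : (a + b = N)%N by move: wN; rewrite /wsum big_ord1 -/a -/b; lia.
  rewrite -[(b + a)%N]addnC abN mulfV ?pnatr_eq0 // scale1r /eop big_ord_recl.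
  rewrite bin0 zff0 mulr1 scale1r subr0 subn0 abN addrAC subrr add0r.
  apply: subspace_sum => // i _; apply: subspaceZ => //.
  have ia := ltn_ord i; rewrite -fock_act_dE.
  have := words_letter linr (m := -1 - (lift ord0 i)%:Z) (l := (a + b - lift ord0 i)%N) _ _ (words_v0 act 1 P).
  rewrite /P lift0 abN => /(_ ltac:(lia) ltac:(lia)).
  by congr (G _ _); lia.
have e := wsum_recl al be; rewrite quad_prod_recl cycsum_rec.
rewrite mulr_sumr scaler_suml -addrA -sumrB.
set al' := fun i => al (lift ord0 i); set be' := fun i => be (lift ord0 i).
have w1 : (0 < wsum al' be')%N by rewrite wsum_recl; lia.
apply: subspaceD => //.
  have w2 : (wsum al' be' <= N)%N by rewrite /al' /be'; lia.
  have ab : (al ord0 + be ord0 < N)%N by move: w1; rewrite /al' /be'; lia.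
  by have := eop_words ab (quad_prod_words w2); rewrite -wN e PoszD addrC.
apply: subspace_sum => // j _.
set s := (al ord0 + be ord0 + 1)%N.
have i1 := IH (upd al' j s) be' _; have i2 := IH al' (upd be' j s) _.
have {}i1 := i1 ltac:(by rewrite wsum_updl -wN e addnC).
have {}i2 := i2 ltac:(by rewrite wsum_updr -wN e addnC).
have := subspaceD (sG _) (subspaceZ (be ord0 + al' j).+1%:R^-1 (sG _) i1)
  (subspaceZ (al ord0 + be' j).+1%:R^-1 (sG _) i2).
rewrite !scalerBr !scalerA addrACA -opprD -scalerDl mulrDr.
by rewrite ![N.+1%:R * (_ * _)]mulrCA.
Qed.

End Relation.

Lemma det_quad0 : \det (\matrix_(i < n.+1, j < n.+1) quad i j) = 0.
Proof.
(* A zero column in [B] and a zero row in [C] pad the rank [n] factorization to square matrices, so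
   that the determinant is multiplicative. *)
pose B : 'M[A]_(n.+1, n.+1) := \matrix_(i, k) if unlift ord0 k is Some k' then fx k' i else 0.
pose C : 'M[A]_(n.+1, n.+1) := \matrix_(k, j) if unlift ord0 k is Some k' then fy k' j else 0.
have -> : \matrix_(i, j) quad i j = B *m C.
  apply/matrixP => i j; rewrite !mxE big_ord_recl !mxE unlift_none mul0r add0r.
  by apply: eq_bigr => k _; rewrite !mxE liftK.
rewrite det_mulmx (expand_det_col B ord0) big1 ?mul0r // => i _.
by rewrite mxE unlift_none mul0r.
Qed.

Lemma op_decoupled (N := (n ^ 2 + 2 * n)%N) :
  words act 1 (fun l => (l < N)%N) N.+1%:Z (op (-1) N 1).
Proof.
set G := words _ _ _ _; have sG : subspace G by exact: words_subspace.
pose kap : K := \sum_(s : 'S_n.+1) (-1) ^+ s * (N.+1%:R * cycsum K (fun i : 'I_n.+1 => i) (fun i => s i)).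
have : G (- (kap *: op (-1) N 1)).
  rewrite -[X in G X]add0r -det_quad0 /determinant /kap scaler_suml -sumrB.
  apply: subspace_sum => // s _.
  (* Each term has weight [2 (0 + ... + n) + (n + 1) = (n + 1)^2 = N + 1]. *)
  have ws : wsum (fun i : 'I_n.+1 => i) (fun i => s i) = N.+1.
    rewrite /wsum !big_split /= sum1_card card_ord.
    have -> : (\sum_i (s i : nat) = \sum_(i < n.+1) i)%N.
      by rewrite [RHS](reindex_inj (@perm_inj _ s)).
    have := bin2_sum n.+1; rewrite big_mkord => ->; rewrite bin2 /N.
    have := odd_double_half (n.+1 * n); rewrite oddM /= andNb add0n -mul2n; lia.
  have := subspaceZ ((-1) ^+ s) sG (quad_prod_linear_part ws).
  rewrite scalerBr scalerA; congr (G (_ - _)).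
  rewrite scaler_sign -mulr_sign; congr (_ * _).
  by apply: eq_bigr => i _; rewrite mxE.
have k0 : kap != 0.
  pose H : 'M[K]_n.+1 := \matrix_(i, j) (i + j).+1%:R^-1.
  (* Summing over [s] first, a fixed cycle [c] gives the determinant of [H] with rows permuted by
     [c], that is [(-1)^n] times that of [H]. *)
  have -> : kap = N.+1%:R * (n`!%:R * ((-1) ^+ n * \det H)).
    rewrite /kap; under eq_bigr do rewrite mulrCA; rewrite -mulr_sumr; congr (_ * _).
    under eq_bigr do rewrite /cycsum mulr_sumr; rewrite exchange_big /=.
    rewrite -size_cyc -sum1_size natr_sum mulr_suml !big_seq; apply: eq_bigr => c cc.
    rewrite mul1r -(signr_odd K n) -(odd_cyc cc) -det_perm -det_mulmx -row_permE.
    apply: eq_bigr => s _; congr (_ * _); apply: eq_bigr => i _.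
    by rewrite !mxE addnC.
  by rewrite !mulf_neq0 ?signr_eq0 ?det_hilbert // pnatr_eq0 -?lt0n ?fact_gt0.
move=> /(subspaceN sG); rewrite opprK => h; rewrite -[op _ _ _](scalerK k0).
exact: subspaceZ.
Qed.

End Minor.

(** * Homomorphisms out of the induced module *)

Section InducedUniversal.
Context (K : numFieldType) (g : lmodType K) (br : g -> g -> g) (h : set g) (chi : g -> K).
Context (V : lmodType K) (act : g -> V -> V) (v0 : V).
Hypotheses (linl : forall v, linear (fun x => act x v)) (linr : forall x, linear (act x))
  (comm : forall x y v, act x (act y v) - act y (act x v) = act (br x y) v)
  (act_chi : forall x, h x -> act x v0 = chi x *: v0).

Lemma foldr_act_linear u : linear (fun z => foldr act z u).
Proof. by elim: u => [|x u IH] a y z //=; rewrite IH linr. Qed.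

(** The target is not asked to be a [cyclic_rep]: for [n >= 1] the Fock space is not generated by
    [1], since quadratic operators preserve the parity of the degree. *)
Lemma ind_hom : exists f : ind br h chi -> V, [/\ linear f, f (ind_vac br h chi) = v0
  & forall x v, f (ind_act x v) = act x (f v)].
Proof.
pose F0 := fglift (foldr act v0); have l0 : linear F0 by exact: fglift_linear.
pose F1 : env br -> V := llift F0.
have r0 r : env_rel br r -> F0 r = 0.
  case=> [[u [v [x [y [a ->]]]]]|[u [v [x [y ->]]]]].
    rewrite (linB l0) (linD l0) (linZ l0) /F0 !fgliftU !foldr_cat /=.
    by rewrite linl foldr_act_linear subrr.
  rewrite !(linB l0) /F0 !fgliftU !foldr_cat /=.
  by rewrite -!(linB (foldr_act_linear u)) comm subrr (lin0 (foldr_act_linear u)).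
have l1 : linear F1 by exact: (llift_linear l0 r0).
have F1w w : F1 (env_word br w) = foldr act v0 w.
  by rewrite /F1 /env_word (llift_proj l0 r0) /F0 fgliftU.
pose F2 : ind br h chi -> V := llift F1.
have r1 r : ind_rel h chi (r : env br) -> F1 r = 0.
  move=> [w [x [hx ->]]]; rewrite (linB l1) (linZ l1) !F1w foldr_rcons.
  by rewrite act_chi // (linZ (foldr_act_linear w)) subrr.
exists F2; split; first exact: (llift_linear l1 r1).
  by rewrite /F2 /ind_vac (llift_proj l1 r1) F1w.
move=> x v; have [r ->] := lprojP v; rewrite ind_act_proj /F2 !(llift_proj l1 r1).
move: r; apply: lin_env.
- exact: (linear_comp l1 (env_mul_linear x)).
- exact: (linear_comp (linr x) l1).
- by move=> w; rewrite env_mul_word !F1w.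
Qed.

End InducedUniversal.

Section WordsHom.
Context (K : numFieldType) (V V' : lmodType K).
Context (act : dhat K -> V -> V) (v0 : V) (act' : dhat K -> V' -> V') (v0' : V').
Context (f : V -> V').
Hypotheses (lf : linear f) (f0 : f v0 = v0') (fa : forall x v, f (act x v) = act' x (f v)).

Lemma word_hom s : f (word act v0 s) = word act' v0' s.
Proof. by elim: s => //= p s IH; rewrite fa IH. Qed.

Lemma words_hom P z v : words act v0 P z v -> words act' v0' P z (f v).
Proof.
move: v; apply: lspan_min.
  have [W0 WD] := words_subspace act' v0' P z.
  by split=> [|a x y Wx Wy] /=; [rewrite (lin0 lf)|rewrite lf; exact: WD].
by move=> _ [s [Ps <-] ->]; rewrite word_hom; exact: word_words.
Qed.

Lemma words_hom_lift P z w : words act' v0' P z w -> exists2 v, words act v0 P z v & f v = w.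
Proof.
have [W0 WD] := words_subspace act v0 P z.
move: w; apply: lspan_min.
  split=> [|a _ _ [x Wx <-] [y Wy <-]]; first by exists 0 => //; exact: lin0.
  by exists (a *: x + y); [exact: WD|exact: lf].
move=> _ [s [Ps <-] ->]; exists (word act v0 s); last exact: word_hom.
exact: word_words.
Qed.

End WordsHom.

(** * The grading by the Euler operator *)

Section Grading.
Context (K : numFieldType) (c : K) (V : lmodType K) (act : dhat K -> V -> V) (v0 : V).
Hypothesis rV : dhat_rep c act v0.
Notation aE m p := (act (dE K m p)).
Notation words := (words act v0 predT).

Lemma act_br11 m l v : m < 0 ->
  act (dhat_br (dE K 1 1) (dE K m l)) v = (m - l%:Z)%:~R *: aE m l v.
Proof.
move=> m0; rewrite (act_br rV).
have -> : psi_mon K (1, 1%N) (m, l) = 0.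
  by rewrite /psi_mon; case: eqP => h; [lia|rewrite mulr0].
rewrite scale0r addr0 !big_ord_recl big_ord0 /= /bump /=.
have -> : \sum_(i < l) ('C(l, 1 + i)%:R * zffact K 1 (1 + i)) *:
    act (dmon K (m + 1 - (1 + i)%N%:Z) (l + 1 - (1 + i)), 0) v = l%:R *: aE m l v.
  case: l => [|l]; first by rewrite big_ord0 scale0r.
  rewrite big_ord_recl big1 ?addr0 => [|i _]; last first.
    by rewrite /zffact !big_ord_recl /= subrr mul0r mulr0 mulr0 scale0r.
  rewrite addn0 bin1 /zffact big_ord_recl big_ord0 !mulr1 /=.
  congr (_ *: act (dmon K _ _, 0) _); lia.
rewrite /zffact !big_ord_recl !big_ord0 /= !bin0 !mul1r !mulr1 !addr0 !scale1r.
rewrite [1 + m]addrC.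
have -> : (1 + l - 0 = l + 1 - 0)%N by lia.
set x := act (dmon K (m + 1) _, 0) v.
have -> : (dmon K (m + 1 - (1 + 0)%N%:Z) (1 + l - (1 + 0)), 0) = dE K m l.
  by congr (dmon K _ _, _); lia.
rewrite ?bin1 ?mul1r opprD addrACA subrr add0r -scalerBl; congr (_ *: _).
by rewrite intrD mulrNz.
Qed.

Lemma act11_words z v : words z v -> aE 1 1 v = - z%:~R *: v.
Proof.
move: v; apply: lspan_min.
  apply: linear_eq_subspace; first exact: (rep_linr rV).
  exact: (linear_scale _ (@linear_id _ _)).
move=> _ [s [_ <-] ->]; elim: s {z} => [|[k l] s IH] /=.
  by rewrite (aE_vac rV) // /wt big_nil oppr0 scale0r.
rewrite (act_comm rV) IH (linZ (rep_linr rV _)) act_br11; last by lia.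
rewrite -scalerDl; congr (_ *: _); rewrite wt_cons -!mulrNz -intrD; congr (_%:~R).
rewrite /=; lia.
Qed.

(** The bound is free above [M] so that decompositions of different lengths can be added. *)
Lemma words_decomp v : exists x : nat -> V, (forall i, words i%:Z (x i)) /\
  exists M, forall M', (M <= M')%N -> v = \sum_(i < M') x i.
Proof.
have sW z := words_subspace act v0 predT z.
move: v (words_span rV v); apply: lspan_min.
  split=> [|a u w [x [Wx [M hx]]] [y [Wy [M' hy]]]].
    exists (fun=> 0); split; first by move=> i; case: (sW i%:Z).
    by exists 0%N => M _; rewrite big1.
  exists (fun i => a *: x i + y i); split; first by move=> i; case: (sW i%:Z) => _; apply.
  exists (maxn M M') => m hm; rewrite (hx m) ?(hy m) ?scaler_sumr -?big_split //; lia.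
move=> w [z _ Wz]; have [z0|z0] := ltP z 0.
  rewrite (words_lt0 z0 Wz); exists (fun=> 0); split; first by move=> i; case: (sW i%:Z).
  by exists 0%N => M _; rewrite big1.
exists (fun i => if i%:Z == z then w else 0); split.
  by move=> i; case: eqP => [->//|_]; case: (sW i%:Z).
exists (`|z|.+1)%N => m hm.
have zm : (`|z| < m)%N by lia.
rewrite (bigD1 (Ordinal zm)) //= ifT; last by apply/eqP; lia.
rewrite big1 ?addr0 // => i /eqP iz; case: eqP => // h; case: iz.
by apply/val_inj => /=; rewrite -h.
Qed.

(** Separation of eigenvectors: the Euler operator plus [i] kills [x i] and multiplies [x j] by
    [i - j], which shortens the sum without losing the other components. *)
Lemma words_sum_mem (N : set V) (s : seq nat) (x : nat -> V) :
  subspace N -> (forall v, N v -> N (aE 1 1 v)) -> uniq s ->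
  (forall i, words i%:Z (x i)) -> N (\sum_(i <- s) x i) -> forall i, i \in s -> N (x i).
Proof.
move=> sN aN; elim: s x => //= i s IH x /andP[is_ us] Wx.
rewrite big_cons => Nx.
have Ns j : j \in s -> N (x j).
  move=> js; have ij : (i%:R - j%:R : K) != 0.
    by rewrite subr_eq0 eqr_nat; apply: contra is_ => /eqP ->.
  rewrite -[x j](scalerK ij); apply: subspaceZ => //.
  apply: (IH (fun j => (i%:R - j%:R) *: x j)) => //.
    by move=> k; apply: subspaceZ => //; exact: words_subspace.
  have := subspaceD sN (aN _ Nx) (subspaceZ i%:R sN Nx).
  rewrite (linD (rep_linr rV _)) (lin_sum (rep_linr rV _)) scalerDr addrACA.
  rewrite (act11_words (Wx i)) scaleNr addNr add0r scaler_sumr -big_split /=.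
  congr N; apply: eq_bigr => k _; rewrite (act11_words (Wx k)) -scalerDl addrC.
  by [].
move=> j; rewrite inE => /orP[/eqP ->|/Ns //].
rewrite -[x i](addrK (\sum_(j <- s) x j)); apply: (subspaceD sN Nx).
by apply: (subspaceN sN); rewrite big_seq; exact: subspace_sum.
Qed.

End Grading.

(** * Transfer of the relation to the simple quotient *)

Section Main.
Context (K : numFieldType) (n : nat).
Let c : K := - n%:R.
Let N := (n ^ 2 + 2 * n)%N.
Let rM := Mc_rep c.
Let rW := Winf_rep c.

Lemma words_Mc_weight z : words (@Mc_act K c) (Mc_vac c) predT z `<=` Mc_weight z.
Proof.
have sW : subspace (@Mc_weight K c z) by exact: lspan_subspace.
apply: lspan_min => // _ [s [_ <-] ->].
pose t := [seq (p.2, -1 - p.1%:Z - p.2%:Z) | p <- s].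
have -> : word (@Mc_act K c) (Mc_vac c) s = (-1) ^+ size s *:
    foldr (fun p => Mc_act (J K p.1 p.2)) (Mc_vac c) t.
  rewrite /t; elim: s {sW t} => [|p s IH] /=; first by rewrite scale1r.
  rewrite IH (linZ (rep_linr rM _)) J_shift (linN (rep_linl rM _)) exprS mulN1r.
  by rewrite scaleNr scalerN opprK.
apply: subspaceZ; first exact: lspan_subspace.
apply: sub_lspan; exists t => //.
rewrite /t big_map /wt; apply: eq_bigr => p _ /=; lia.
Qed.

(** The target carries no grading; the kernel is graded because it is stable under the Euler
    operator, and proper because it misses the vacuum. *)
Lemma ker_Ic (V : lmodType K) (act : dhat K -> V -> V) (f : Mc c -> V) :
  linear f -> (forall x v, f (Mc_act x v) = act x (f v)) -> (forall x, linear (act x)) ->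
  f (Mc_vac c) <> 0 -> forall v, f v = 0 -> Ic v.
Proof.
move=> lf fa la f0; apply: sub_Ic.
have s0 : subspace [set v | f v = 0].
  by apply: linear_eq_subspace => //; exact: linear_zero.
have a0 x v : f v = 0 -> f (Mc_act x v) = 0 by move=> e; rewrite fa e (lin0 (la x)).
split; last by move=> e; apply: f0; rewrite -/([set v | f v = 0] (Mc_vac c)) e.
split=> // v v0; have [x [Wx [M /(_ M (leqnn M)) ve]]] := words_decomp rM v.
rewrite ve; apply: subspace_sum; first exact: lspan_subspace.
move=> i _; apply: sub_lspan; split; last by exists i%:Z => //; exact: words_Mc_weight.
apply: (words_sum_mem rM (s := iota 0 M) s0) => //.
- by move=> w; exact: a0.
- exact: iota_uniq.
- by have := v0; rewrite {1}ve -(big_mkord xpredT x) /index_iota subn0.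
- by rewrite mem_iota /= ltn_ord.
Qed.

(** The relation in the Fock space lifts to [Mc] up to an element of the kernel, which [ker_Ic] puts
    in [Ic]. *)
Lemma jst_decoupled :
  words (@Winf_act K c) (Winf_proj (Mc_vac c)) (fun l => (l < N)%N) N.+1%:Z
    (Winf_act (dE K (-1) N) (Winf_proj (Mc_vac c))).
Proof.
have [A [W]] := weyl_exists K ('I_n * int)%type.
have [f [lf f0 fa]] := @ind_hom _ _ (@dhat_br K) (@Phat K) (Pchar c) A (fock_act W) 1
  (fock_act_linl W) (fock_act_linr W) (fock_act_comm W) (@fock_act_vac _ _ _ W).
have : words (fock_act W) 1 (fun l => (l < N)%N) N.+1%:Z (fock_act W (dE K (-1) N) 1).
  by rewrite fock_act_dE; exact: op_decoupled.
move=> /(words_hom_lift lf f0 fa)[b Pb fb].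
have fv : f (Mc_act (dE K (-1) N) (Mc_vac c) - b) = 0.
  by rewrite (linB lf) fb [f (Mc_act _ _)]fa f0 subrr.
have /lproj_eq e : lspan (Ic (c := c)) (Mc_act (dE K (-1) N) (Mc_vac c) - b).
  apply: sub_lspan; apply: (ker_Ic lf fa (fock_act_linr W)) => //.
  by rewrite [f (Mc_vac c)]f0 => /eqP; rewrite oner_eq0.
rewrite -[Winf_act _ _](Winf_proj_act (dE K (-1) N) (Mc_vac c)) /Winf_proj e.
by apply: (words_hom (act := @Mc_act K c) (v0 := Mc_vac c)) Pb => //;
  [exact: lproj_linear|exact: Winf_proj_act].
Qed.

Lemma Winf_strongly_generated : (1 <= n)%N ->
  strongly_generated (Winf_va c)
    [set jst c l | l in [set l : nat | (l <= n ^ 2 + 2 * n - 1)%N]].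
Proof.
move=> n1; have := decoupled_strongly_generated rW jst_decoupled.
congr (strongly_generated _ _); apply/seteqP; split=> _ [l hl <-].
  exists l; first by move: hl; rewrite /= /N; lia.
  by rewrite /jst /Jst Winf_proj_act.
exists l; first by move: hl; rewrite /= /N; lia.
by rewrite /jst /Jst Winf_proj_act.
Qed.

End Main.

Local Open Scope complex_scope.
Theorem theorem4p16 (R : realType) (n : nat) (hn : (1 <= n)%N) :
  strongly_generated (Winf_va (- n%:R : R[i]))
    [set jst (- n%:R : R[i]) l | l in [set l : nat | (l <= n ^ 2 + 2 * n - 1)%N]].
Proof. exact: Winf_strongly_generated. Qed.
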